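(* Let $N$ be an unmarked linear graphon Hawkes process on $\mathscr X=[0,1]$ and time interval $\mathbb R_+$, starting with an empty history, with parameters $\lambda_\infty,h,W$ satisfying the assumptions listed in the context. Suppose $\rho(T_{\mathrm{hom}})>1$, where $$T_{\mathrm{hom}}:L^1[0,1]\to L^1[0,1],\qquad (T_{\mathrm{hom}}f)(x)=\|h\|_{L^1(\mathbb R_+)}\int_0^1W(x,y)f(y)\,\mathrm dy.$$ Then, for each $A\in\mathcal B[0,1]$ of positive Lebesgue measure, $$\frac{N_T(A)}{T}\to\infty\quad\text{almost surely, as }T\to\infty.$$
   Context: Unmarked linear graphon Hawkes process on $[0,1]$: the point process of events $(s,y)\in\mathbb R_+\times[0,1]$ with conditional intensity density $\lambda_t(x)=\lambda_\infty(x)+\sum_{(s,y)\in N,\ s<t}W(x,y)h(t-s)$, i.e. given the past, events occur in $\mathrm dt\times\mathrm dx$ at rate $\lambda_t(x)\,\mathrm dt\,\mathrm dx$. $N_t(A)$ is the number of events up to time $t$ with location in $A$. $\rho$ denotes the spectral radius of a bounded operator on $L^1[0,1]$. Assumptions: $\lambda_\infty:[0,1]\to\mathbb R_+$ is in $L^\infty[0,1]$ with $\alpha:=\|\lambda_\infty\|_{L^1[0,1]}>0$; $h:\mathbb R_+\to\mathbb R_+$ is in $L^1(\mathbb R_+)$ with $\int_0^\infty t\,h(t)\,\mathrm dt<\infty$; $W:[0,1]^2\to\mathbb R_+$ is measurable, bounded by a constant $C_W$, and symmetric, $W(x,y)=W(y,x)$. With $$W^{(k)}(x,y):=\int_0^1\cdots\int_0^1W(x,x_1)W(x_1,x_2)\cdots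 W(x_{k-1},y)\,\mathrm dx_1\cdots\mathrm dx_{k-1}$$ ($W^{(1)}=W$), there exist $k\in\mathbb N$ and $\kappa\in(0,1]$ such that $\inf_{x,y\in[0,1]}W^{(k)}(x,y)\ge\kappa$. *)

(* Defs.v *)
From HB Require Import structures.
From mathcomp Require Import all_boot all_order all_algebra.
From mathcomp Require Import all_classical all_reals all_analysis.
From mathcomp Require Import measurable_realfun.
From mathcomp.real_closed Require Import complex.

Set Implicit Arguments.
Unset Strict Implicit.
Unset Printing Implicit Defensive.

Import Order.TTheory GRing.Theory Num.Theory.
Import numFieldNormedType.Exports.

Local Open Scope classical_set_scope.
Local Open Scope ring_scope.

(* All functions on [0,1], [0,1]^2 and R_+ are total functions on R (or R x R)
   of which only the values on these domains matter. *)
Section Model.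
Context {R : realType}.
Local Notation mu := (@lebesgue_measure R).

Definition unit_itv : set R := `[0, 1].
Definition Rplus : set R := `[0, +oo[.

Definition L1norm (D : set R) (f : R -> R) : R := \int[mu]_(x in D) `|f x|.

(* The (k-1)-fold integral defining W^(k), for k >= 1, as an iterated integral:
   W^(1) = W and W^(k+1)(x, y) = \int_0^1 W(x, z) W^(k)(z, y) dz.
   The value at k = 0 is junk. *)
Definition kernel_pow (W : R -> R -> R) (k : nat) : R -> R -> R :=
  iter k.-1
    (fun V x y => \int[mu]_(z in unit_itv) (W x z * V z y)) W.

Record hawkes_parameters (linf h : R -> R) (W : R -> R -> R) : Prop := {
  linf_ge0 : forall x, unit_itv x -> 0 <= linf x ;
  linf_measurable : measurable_fun unit_itv linf ;
  linf_bounded :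
    exists M : R, {ae mu, forall x, unit_itv x -> `|linf x| <= M} ;
  linf_gt0 : 0 < L1norm unit_itv linf ;
  h_ge0 : forall t, Rplus t -> 0 <= h t ;
  h_integrable : mu.-integrable Rplus (EFin \o h) ;
  h_moment : (\int[mu]_(t in Rplus) (t * h t)%:E < +oo)%E ;
  W_ge0 : forall x y, unit_itv x -> unit_itv y -> 0 <= W x y ;
  W_measurable :
    measurable_fun (unit_itv `*` unit_itv) (fun p : R * R => W p.1 p.2) ;
  W_bounded : exists C_W : R,
    forall x y, unit_itv x -> unit_itv y -> W x y <= C_W ;
  W_sym : forall x y, unit_itv x -> unit_itv y -> W x y = W y x ;
  W_pow_lower : exists (k : nat) (kappa : R),
    [/\ (0 < k)%N, 0 < kappa, kappa <= 1 &
      forall x y, unit_itv x -> unit_itv y -> kappa <= kernel_pow W k x y] }.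

Definition T_hom (h : R -> R) (W : R -> R -> R) (f : R -> R) : R -> R :=
  fun x => L1norm Rplus h * \int[mu]_(y in unit_itv) (W x y * f y).

End Model.

(* The spectrum of a bounded operator of the real Banach space L^1[0,1] is that
   of its complexification, acting on L^1([0,1]; C).  Elements of L^1 are
   represented by integrable functions, with equality almost everywhere. *)
Section SpectralRadius.
Context {R : realType}.
Local Notation mu := (@lebesgue_measure R).
Implicit Types (f g : R -> R[i]) (T : (R -> R) -> (R -> R)) (z : R[i]).

Definition L1C f : Prop :=
  mu.-integrable unit_itv (fun x => (complex.Re (f x))%:E) /\
  mu.-integrable unit_itv (fun x => (complex.Im (f x))%:E).

Definition ae_eqC f g : Prop := {ae mu, forall x, unit_itv x -> f x = g x}.

Definition L1normC f : R := \int[mu]_(x in unit_itv) ComplexField.Normc.normc (f x).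

Definition complexify T f : R -> R[i] :=
  fun x => Complex (T (fun y => complex.Re (f y)) x)
                   (T (fun y => complex.Im (f y)) x).

Definition shift_op T z f : R -> R[i] := fun x => z * f x - complexify T f x.

(* z - T is injective and surjective on L^1, and its inverse is bounded *)
Definition resolvent_set T : set R[i] := [set z |
  [/\ forall f g, L1C f -> L1C g ->
        ae_eqC (shift_op T z f) (shift_op T z g) -> ae_eqC f g,
      forall g, L1C g -> exists2 f, L1C f & ae_eqC (shift_op T z f) g
    & exists C : R, forall f, L1C f ->
        L1normC f <= C * L1normC (shift_op T z f)]].

Definition spectrum T : set R[i] := ~` resolvent_set T.

Definition spectral_radius T : \bar R :=
  ereal_sup [set (ComplexField.Normc.normc z)%:E | z in spectrum T].

End SpectralRadius.

Section HawkesProcess.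
Context {d : measure_display} {Omega : measurableType d} {R : realType}.
Local Notation mu := (@lebesgue_measure R).

(* A realisation N w is the set of events (s, y), s the time, y the location. *)
Implicit Type N : Omega -> set (R * R).

Definition event_count N (t : R) (A : set R) (w : Omega) : \bar R :=
  counting (N w `&` (`[0, t] `*` A)).

(* Simplicity is that of the process of event times: no two events occur
   simultaneously, even at distinct locations. *)
Record point_process N : Prop := {
  pp_sub : forall w, N w `<=` Rplus `*` unit_itv ;
  pp_locally_finite : forall w t, finite_set (N w `&` (`[0, t] `*` unit_itv)) ;
  pp_simple : forall w z z', N w z -> N w z' -> z.1 = z'.1 -> z = z' ;
  pp_measurable : forall t A, measurable A -> A `<=` unit_itv ->
    measurable_fun [set: Omega] (event_count N t A) }.

(* sigma(N_s(A) : 0 <= s <= t, A Borel in [0,1]) *)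
Definition history N (t : R) : set (set Omega) :=
  <<s [set E | exists s A U,
        [/\ 0 <= s <= t, measurable A, A `<=` unit_itv, measurable U
          & E = (event_count N s A) @^-1` U]] >>.

(* Generators of the predictable sigma-algebra, on ((time, location), outcome) *)
Definition predictable_rectangles N : set (set ((R * R) * Omega)) :=
  [set D | exists a b B E,
     [/\ 0 <= a <= b, measurable B, B `<=` unit_itv, history N a E
       & D = (`]a, b] `*` B) `*` E]] `|`
  [set D | exists B E,
     [/\ measurable B, B `<=` unit_itv, history N 0 E
       & D = ([set 0] `*` B) `*` E]].

Definition predictable N (C : (R * R) * Omega -> \bar R) : Prop :=
  measurable_fun [set: g_sigma_algebraType (predictable_rectangles N)]
    (C : g_sigma_algebraType (predictable_rectangles N) -> \bar R).

Definition intensity (linf h : R -> R) (W : R -> R -> R) N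
    (t x : R) (w : Omega) : \bar R :=
  ((linf x)%:E +
   \esum_(z in N w `&` [set z | (z.1 < t)%R]) (W x z.2 * h (t - z.1))%:E)%E.

(* lam is the conditional intensity density of N given its own past: for every
   nonnegative predictable C,
   E[sum_{(s,y) in N} C(s,y)] = E[int_0^oo int_0^1 C(t,x) lam_t(x) dx dt]. *)
Definition has_conditional_intensity (P : probability Omega R) N
    (lam : R -> R -> Omega -> \bar R) : Prop :=
  forall C : (R * R) * Omega -> \bar R,
    predictable N C -> (forall u, 0 <= C u)%E ->
    ((\int[P]_w \esum_(z in N w) C (z, w)) =
     \int[P]_w \int[mu]_(t in Rplus) \int[mu]_(x in unit_itv)
        (C ((t, x), w) * lam t x w))%E.

(* The history before time 0 is empty since all events of N have times in R_+. *)
Definition linear_graphon_hawkes (P : probability Omega R)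
    (linf h : R -> R) (W : R -> R -> R) N : Prop :=
  point_process N /\ has_conditional_intensity P N (intensity linf h W N).

End HawkesProcess.

(* Main.v *)
(* Let [f >= 0] be bounded, [N_t(f)] the sum of [f] over the events of [(0, t]], and
   [W f] the function [x |-> int_0^1 W(x, y) f(y) dy].  Replace [h] by a bounded
   [k <= h] of bounded support.  For small [theta] the variable
   [exp (C_t - theta N_t(f))] has mean at most 1, where
   [C_t = int (1 - exp (- theta f)) linf * t + sum_(s, y) psi(y) int_0^(t - s) k]
   and [psi <= W (1 - exp (- theta f))]; this follows from the intensity identity
   applied to one predictable integrand.  By Markov and Borel-Cantelli,
   [theta N_n(f) >= C_n - theta^2 n] for all large integers [n], so with
   [theta -> 0] and [k -> h] a lower growth rate [b] of [N(W f)] yields the lower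
   growth rate [<f, linf> + |h| b] of [N(f)], by the symmetry of [W].  Iterated,
   [liminf N_n(1_A) / n >= sum_(j < m) |h|^j <W^j 1_A, linf>] for every [m].
   These sums are unbounded.  As [W^k f >= kappa int f] they dominate a multiple of
   the sums of [|h|^j <W^j 1, 1>]; if the latter were bounded, the Neumann series
   of [T_hom] would converge on the whole of [|z| > 1], because
   [T^(j+2) f <= (|h| C_W)^2 |f|_1 <T^j 1, 1>] for [f >= 0], and the spectral
   radius would be at most 1. *)

From HB Require Import structures.
Require Import Defs.
From mathcomp Require Import all_boot all_order all_algebra.
From mathcomp Require Import all_classical all_reals all_analysis.
From mathcomp Require Import finmap measurable_realfun ring lra.
From mathcomp.real_closed Require Import complex.
Import Order.TTheory GRing.Theory Num.Theory.
Import numFieldNormedType.Exports.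
Set Implicit Arguments.
Unset Strict Implicit.
Unset Printing Implicit Defensive.
Local Open Scope classical_set_scope.
Local Open Scope ring_scope.

(** * Integration lemmas *)

(** The intensity identity holds for nonnegative integrands only and both of its sides may be
    infinite, so the exponential cannot be compensated directly. It is replaced by [bexp e], a
    function that is at most [1 / e] and has derivative at most itself. Along every path, the sum
    over the jumps plus the terminal value equals the initial value plus a drift, and this drift is
    at most [1 / e]. The intensity dominates the rate built from [k] and [psi], so the identity
    makes the mean of the jump sum at least that of the drift. Hence the terminal value has mean at
    most [bexp e 0 <= 1], and monotone convergence as [e] tends to 0 gives the exponential bound.
    Only a lower bound on the intensity enters, which leaves the freedom to cut [h] down to [k]:
    boundedness makes the compensator Lipschitz in time, and bounded support means that every event
    older than a fixed lag has released its whole mass. Since [1 - exp (- theta f)] falls short of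
    [theta f] by a factor of at most [1 - theta B] for [f <= B], a fixed [theta] loses a proportion
    of the rate; the loss vanishes in the limit. *)

Section LowerIntegral.
Context {d} {T : measurableType d} {R : realType}.
Local Open Scope ereal_scope.
Import HBNNSimple.

(** The integral of a nonnegative function is a supremum over the simple functions below it, whether
    or not the function is measurable. *)
Lemma ge0_le_integral_nonmeasurable (mu : {measure set T -> \bar R}) (D : set T) (f g : T -> \bar R) :
  (forall x, D x -> 0 <= f x) -> (forall x, D x -> f x <= g x) ->
  \int[mu]_(x in D) f x <= \int[mu]_(x in D) g x.
Proof.
move=> f0 fg; have g0 x : D x -> 0 <= g x by move=> Dx; rewrite (le_trans (f0 x Dx)) ?fg.
rewrite !ge0_integralE//; apply: ereal_sup_le => _ /= [k kf <-]; exists k => // x.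
by rewrite (le_trans (kf x))//; exact: lee_restrict.
Qed.

(* Only the superadditivity of the lower integral of [f] and the translation by a
   constant are needed, so neither [f] nor [g] has to be measurable. *)
Lemma integral_balance (P : probability T R) (f g Z : T -> R) (c B : R) :
  (forall x, 0 <= f x)%R -> (forall x, 0 <= g x <= B)%R -> (forall x, 0 <= Z x)%R ->
  (0 <= c)%R ->
  measurable_fun setT Z -> (forall x, f x + Z x = c + g x)%R ->
  \int[P]_x (g x)%:E <= \int[P]_x (f x)%:E ->
  \int[P]_x (Z x)%:E <= c%:E.
Proof.
move=> f0 gB Z0 c0 mZ fZ gf.
have g0 x : (0 <= g x)%R by case/andP: (gB x).
have Ig : \int[P]_x (g x)%:E \is a fin_num.
  rewrite ge0_fin_numE ?integral_ge0//; last by move=> x _; rewrite lee_fin.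
  apply: (@le_lt_trans _ _ (\int[P]_x B%:E)); last first.
    by rewrite integral_cst//= probability_setT mule1 ltry.
  apply: ge0_le_integral_nonmeasurable => x _; rewrite lee_fin//.
  by case/andP: (gB x).
have simple_le (s : {nnsfun T >-> R}) : (forall x, (s x)%:E <= (f x)%:E) ->
    sintegral P s + \int[P]_x (Z x)%:E <= c%:E + \int[P]_x (g x)%:E.
  move=> sf.
  (* The positive part of [s + Z - c] is measurable and still below [g], because [s <= f].
     Additivity is thus used for measurable functions only. *)
  pose m x := Num.max (s x + Z x - c)%R 0%R.
  have mm : measurable_fun setT m.
    apply: measurable_maxr => //; apply: measurable_funB => //.
    exact: measurable_funD.
  have m0 x : (0 <= m x)%R by rewrite le_max lexx orbT.
  have mg x : (m x <= g x)%R.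
    rewrite ge_max g0 andbT lerBlDl -fZ lerD2r -lee_fin; exact: sf.
  apply: (@le_trans _ _ (c%:E + \int[P]_x (m x)%:E)); last first.
    by rewrite leeD2l//; apply: ge0_le_integral_nonmeasurable => x _; rewrite lee_fin.
  have -> : sintegral P s = \int[P]_x (s x)%:E.
    by rewrite integral_nnsfun// patch_setT.
  have <- : \int[P]_x c%:E = c%:E by rewrite integral_cst//= probability_setT mule1.
  rewrite -!ge0_integralD//; try by move=> x _; rewrite lee_fin.
  - apply: ge0_le_integral => //.
    + by move=> x _; rewrite adde_ge0// lee_fin.
    + by apply/measurable_EFinP; apply: measurable_funD.
    + by apply/measurable_EFinP; apply: measurable_funD.
    + by move=> x _; rewrite -!EFinD lee_fin -lerBlDl le_max lexx.
  - exact/measurable_EFinP.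
  - exact/measurable_EFinP.
  - exact/measurable_EFinP.
(* The case [s = 0] shows that [Z] has finite mean, so it can be subtracted. *)
have IZ : \int[P]_x (Z x)%:E \is a fin_num.
  rewrite ge0_fin_numE ?integral_ge0//; last by move=> x _; rewrite lee_fin.
  have /simple_le : forall x, ((@nnsfun0 _ T R) x)%:E <= (f x)%:E.
    by move=> x; rewrite lee_fin /=.
  rewrite sintegral0 add0e => /le_lt_trans; apply.
  by rewrite -(fineK Ig) -EFinD ltry.
have IfZ : \int[P]_x (f x)%:E <= c%:E + \int[P]_x (g x)%:E - \int[P]_x (Z x)%:E.
  rewrite ge0_integralTE//.
  apply: ge_ereal_sup => _ /= [s sf <-].
  by rewrite leeBrDr//; exact: simple_le.
have := le_trans gf IfZ.
rewrite -(fineK Ig) -(fineK IZ) -EFinN -!EFinD !lee_fin => ?; lra.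
Qed.
End LowerIntegral.

Section Lebesgue.
Context {R : realType}.
Local Notation mu := (@lebesgue_measure R).

Lemma bounded_itv_integrable (a b M : R) (f : R -> R) :
  measurable_fun `[a, b] f -> (forall x, a <= x <= b -> `|f x| <= M) ->
  mu.-integrable `[a, b] (EFin \o f).
Proof.
move=> mf fM; apply: measurable_bounded_integrable => //.
  by rewrite /= lebesgue_measure_itv/=; case: ifPn => // _; rewrite -EFinB ltry.
exists M; split; first exact: num_real.
by move=> N /ltW MN x /=; rewrite in_itv/= => /fM /le_trans; exact.
Qed.

(** The image of Lebesgue measure under a translation agrees with it on half-open intervals, hence
    on all Borel sets. *)
Lemma integral_translation (s : R) (D : set R) (f : R -> \bar R) :
  measurable D -> measurable_fun D f -> (forall x, D x -> 0 <= f x)%E ->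
  (\int[mu]_(x in [set x | D (x - s)%R]) f (x - s)%R = \int[mu]_(x in D) f x)%E.
Proof.
move=> mD mf f0.
have mphi : measurable_fun setT (fun x : measurableTypeR R => x - s : measurableTypeR R).
  by apply: measurable_funB.
pose phi : {mfun measurableTypeR R >-> measurableTypeR R} :=
  HB.pack (fun x : R => x - s : R) (isMeasurableFun.Build _ _ _ _ _ mphi).
have E A : measurable A -> mu A = pushforward mu phi A.
  apply: (@lebesgue_measure_unique R (pushforward mu phi)) => _ [[a b] _ <-] /=.
  rewrite /pushforward (_ : _ @^-1` _ = `]a + s, b + s]%classic); last first.
    by apply/seteqP; split => x /=; rewrite !in_itv/= ltrBrDr lerBlDr.
  rewrite !lebesgue_measure_itv/= !lte_fin ltrD2r; case: ifP => // _.
  by rewrite -!EFinB; congr (_%:E); ring.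
rewrite -[LHS](@ge0_integral_pushforward _ _ _ _ _ _ mphi mu D f)//; last first.
  by move=> y /set_mem; exact: f0.
by apply: eq_measure_integral => A mA _; exact/esym/E.
Qed.
End Lebesgue.

(** * Products over past events and summation by parts *)

Section Telescope.
Context {R : realType}.
Implicit Types (l : seq (R * R)) (q : R * R -> R).

(** With [q z = exp (- f z.2)] this is [exp (- N(f))] just before time [u]; the strict inequality
    makes it left-continuous, hence predictable. *)
Definition prod_before (l : seq (R * R)) (q : R * R -> R) (u : R) : R :=
  \prod_(z <- l | z.1 < u) q z.

(** Going forward in time from [u], an event [z] lowers the product by its value just before the
    event times [1 - q z]. Distinct times keep these jumps apart. *)
Lemma prod_before_telescope l q u : uniq (map fst l) ->
  prod_before l q u = \prod_(z <- l) q z +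
    \sum_(z <- l | u <= z.1) prod_before l q z.1 * (1 - q z).
Proof.
pose r (z z' : R * R) := z'.1 <= z.1.
have r_total : total r by move=> z z'; exact: le_total.
have r_trans : transitive r by move=> x y z /= xy yz; exact: le_trans yz xy.
(* Both sides are invariant under permutations of the list. With the latest event at the head, the
   induction removes it without changing the product before any other event. *)
wlog ls : l / sorted r l.
  move=> H ul; have pl := permEl (perm_sort r l).
  have E v : prod_before l q v = prod_before (sort r l) q v.
    exact/esym/perm_big.
  rewrite E H ?sort_sorted//; last by rewrite (perm_uniq (perm_map fst pl)).
  congr (_ + _); first exact: perm_big.
  rewrite (perm_big _ pl) /=; apply: eq_bigr => z _; by rewrite E.
elim: l ls => [|z0 l IH] ls /=; first by rewrite /prod_before !big_nil addr0.
move=> /andP[z0l ul].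
have lt_z0 z : z \in l -> z.1 < z0.1.
  move=> zl; rewrite lt_neqAle; apply/andP; split.
    by apply: contraNneq z0l => <-; exact: map_f.
  by move: ls; rewrite /= (path_sortedE r_trans) => /andP[/allP/(_ z zl)].
have {}IH := IH (path_sorted ls) ul.
have pb v : v <= z0.1 -> prod_before (z0 :: l) q v = prod_before l q v.
  by move=> vz; rewrite /prod_before big_cons ltNge vz.
have pall v : z0.1 <= v -> prod_before l q v = \prod_(z <- l) q z.
  move=> zv; rewrite /prod_before big_mkcond big_seq [RHS]big_seq.
  by apply: eq_bigr => z /lt_z0 /lt_le_trans/(_ zv) ->.
have [uz|zu] := leP u z0.1.
  rewrite [LHS]pb// IH !big_cons uz (pb z0.1)// (pall z0.1)//.
  rewrite [X in _ = _ + (_ + X)](_ : _ =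
      \sum_(z <- l | u <= z.1) prod_before l q z.1 * (1 - q z)); first by ring.
  rewrite big_seq_cond [RHS]big_seq_cond; apply: eq_bigr => z /andP[zl _].
  by rewrite pb// ltW// lt_z0.
rewrite {1}/prod_before !big_cons leNgt zu /= -/(prod_before l q u) pall ?(ltW zu)//.
rewrite [X in _ = _ + X]big1_seq ?addr0// => z /andP[uz zl].
by have := lt_trans (lt_z0 z zl) zu; rewrite ltNge uz.
Qed.

End Telescope.

Section PathIdentity.
Context {R : realType}.
Local Notation mu := (@lebesgue_measure R).
Implicit Types (l : seq (R * R)) (q : R * R -> R).

Lemma integrableZl_EFin d (T : measurableType d) (m : {measure set T -> \bar R})
    (D : set T) (k : R) (f : T -> R) :
  measurable D -> m.-integrable D (EFin \o f) ->
  m.-integrable D (EFin \o (fun x => k * f x)).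
Proof. by move=> mD intf; exact: (integrableZl mD k intf). Qed.

Lemma integrableB_EFin d (T : measurableType d) (m : {measure set T -> \bar R})
    (D : set T) (f g : T -> R) : measurable D ->
  m.-integrable D (EFin \o f) -> m.-integrable D (EFin \o g) ->
  m.-integrable D (EFin \o (fun x => f x - g x)).
Proof.
move=> mD intf intg; rewrite (_ : _ \o _ = ((EFin \o f) \- (EFin \o g))%E).
  exact: integrableB.
by apply/funext => x /=; rewrite EFinB.
Qed.

Lemma integrableD_EFin d (T : measurableType d) (m : {measure set T -> \bar R})
    (D : set T) (f g : T -> R) : measurable D ->
  m.-integrable D (EFin \o f) -> m.-integrable D (EFin \o g) ->
  m.-integrable D (EFin \o (fun x => f x + g x)).
Proof. by move=> mD intf intg; exact: (integrableD mD intf intg). Qed.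

Lemma integrable_sum_EFin d (T : measurableType d) (m : {measure set T -> \bar R})
    (I : eqType) (s : seq I) (D : set T) (f : I -> T -> R) :
  measurable D -> (forall i, i \in s -> m.-integrable D (EFin \o f i)) ->
  m.-integrable D (EFin \o (fun x => \sum_(i <- s) f i x)).
Proof.
move=> mD intf; rewrite (_ : _ \o _ = fun x => (\sum_(i <- s | i \in s) (EFin \o f i) x)%E).
  exact: integrable_sum.
by apply/funext => x; rewrite /= -big_seq sumEFin.
Qed.

Lemma Rintegral_sum d (T : measurableType d) (m : {measure set T -> \bar R})
    (I : eqType) (s : seq I) (D : set T) (f : I -> T -> R) :
  measurable D -> (forall i, i \in s -> m.-integrable D (EFin \o f i)) ->
  \int[m]_(x in D) (\sum_(i <- s) f i x) = \sum_(i <- s) \int[m]_(x in D) f i x.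
Proof.
move=> mD; elim: s => [|i s IH] intf.
  by under eq_Rintegral do rewrite big_nil; rewrite Rintegral_cst// mul0r big_nil.
have intf' j : j \in s -> m.-integrable D (EFin \o f j).
  by move=> js; apply: intf; rewrite inE js orbT.
rewrite big_cons -IH// -RintegralD//; last 2 first.
- by apply: intf; rewrite inE eqxx.
- exact: integrable_sum_EFin.
by apply: eq_Rintegral => x _; rewrite big_cons.
Qed.

Lemma prod_before_ge0 l q u : (forall z, 0 <= q z) -> 0 <= prod_before l q u.
Proof. by move=> q0; apply: prodr_ge0. Qed.

Lemma prod_before_le1 l q u : (forall z, 0 <= q z <= 1) -> prod_before l q u <= 1.
Proof.
move=> q01; rewrite /prod_before; elim/big_rec: _ => // z x _ x1.
by have /andP[q0 q1] := q01 z; rewrite -[leRHS]mulr1 (le_trans (ler_wpM2l q0 x1))// !mulr1.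
Qed.

Lemma measurable_prod_before l q : measurable_fun setT (prod_before l q).
Proof.
rewrite /prod_before; elim: l => [|z l IH].
  by rewrite (_ : (fun _ => _) = cst 1)//; apply/funext => u; rewrite big_nil.
rewrite (_ : (fun _ => _) =
    fun u => (if z.1 < u then q z else 1) * \prod_(z <- l | z.1 < u) q z).
  apply: measurable_funM => //; apply: measurable_fun_ifT => //.
  exact: measurable_fun_ltr.
by apply/funext => u; rewrite big_cons; case: ifP; rewrite ?mul1r.
Qed.

(* Summation by parts between the product over past points, a pure jump function
   of time, and the absolutely continuous function [A]. *)
Lemma jump_sum_identity l q (T : R) (a A : R -> R) :
  0 <= T -> (forall z, 0 <= q z <= 1) ->
  uniq (map fst l) -> (forall z, z \in l -> 0 < z.1 <= T) ->
  mu.-integrable `[0, T] (EFin \o a) ->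
  (forall s, 0 <= s <= T -> A s = A 0 + \int[mu]_(u in `[0, s]) a u) ->
  \sum_(z <- l) A z.1 * prod_before l q z.1 * (1 - q z) + A T * \prod_(z <- l) q z
  = A 0 + \int[mu]_(u in `[0, T]) (a u * prod_before l q u).
Proof.
move=> T0 q01 ul lT inta AE.
have q0 z : 0 <= q z by case/andP: (q01 z).
set Y := \prod_(z <- l) q z.
pose w z := prod_before l q z.1 * (1 - q z).
pose a_ z := a \_ `]-oo, (z : R * R).1]%classic.
have inta_le z : mu.-integrable `[0, T] (EFin \o a_ z).
  rewrite /a_ (_ : EFin \o _ = (EFin \o a) \_ `]-oo, z.1]%classic).
    apply/integrable_restrict => //; apply: integrableS inta => //.
      exact: measurableI.
  by apply/funext => u /=; rewrite /patch; case: ifP.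
(* Inserting the telescoped product leaves, for each event, the integral of [a] up to [z.1], which
   is [A z.1 - A 0]. *)
have -> : \int[mu]_(u in `[0, T]) (a u * prod_before l q u) =
    Y * \int[mu]_(u in `[0, T]) a u +
    \sum_(z <- l) w z * \int[mu]_(u in `[0, T]) a_ z u.
  rewrite -RintegralZl//; under eq_bigr do rewrite -RintegralZl//.
  have intw z : mu.-integrable `[0, T] (EFin \o (fun u => w z * a_ z u)).
    exact: integrableZl_EFin.
  rewrite -Rintegral_sum// -RintegralD//; last 2 first.
  - exact: integrableZl_EFin.
  - exact: integrable_sum_EFin.
  apply: eq_Rintegral => u _; rewrite (prod_before_telescope q u ul) -/Y mulrDr.
  rewrite mulrC; congr (_ + _); rewrite mulr_sumr [LHS]big_mkcond.
  apply: eq_bigr => z _; rewrite /a_ /patch mem_setE in_itv/=.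
  by case: ifP => _; rewrite ?mulr0// mulrC.
have intE z : z \in l -> \int[mu]_(u in `[0, T]) a_ z u = A z.1 - A 0.
  move=> /lT/andP[z0 zT]; rewrite AE ?(ltW z0)// addrAC subrr add0r.
  rewrite /a_ -Rintegral_mkcondr; congr (Rintegral _ _ _).
  apply/seteqP; split => u /=; rewrite !in_itv/=.
    by move=> [/andP[-> _] ->].
  by move=> /andP[-> uz]; rewrite uz (le_trans uz).
rewrite -(addKr (A 0) (\int[mu]_(u in _) _)) -AE ?lexx ?T0//.
(* All events have positive times, so the product before time 0 is empty and the jumps add up to
   [1 - Y]. *)
have w1 : \sum_(z <- l) w z = 1 - Y.
  have := prod_before_telescope q 0 ul; rewrite -/Y.
  rewrite {1}/prod_before big_seq_cond big1 => [|z /andP[/lT/andP[z0 _]]]; last first.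
    by rewrite ltNge (ltW z0).
  move=> ->; rewrite addrC addKr big_seq_cond [RHS]big_seq_cond.
  by apply: eq_bigl => z; case: (boolP (z \in l)) => // /lT/andP[/ltW ->].
have -> : \sum_(z <- l) A z.1 * prod_before l q z.1 * (1 - q z) =
    \sum_(z <- l) w z * (A z.1 - A 0) + A 0 * (1 - Y).
  rewrite -w1 mulr_sumr -big_split/=; apply: eq_bigr => z _; rewrite /w; ring.
rewrite [in RHS](eq_big_seq (fun z => w z * (A z.1 - A 0))); first by ring.
by move=> z zl; rewrite intE.
Qed.

End PathIdentity.

(** * A chain rule for bounded measurable densities *)

Section ChainRule.
Context {R : realType}.
Local Notation mu := (@lebesgue_measure R).

(** Cutting [[0, T]] into [n + 1] equal steps bounds the total increment by [B T^2 / (n + 1)]. This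
    stands in for a vanishing derivative. *)
Lemma quadratic_oscillation_constant (F : R -> R) (B T : R) : 0 <= T ->
  (forall s t, 0 <= s -> s <= t -> t <= T -> `|F t - F s| <= B * (t - s) ^+ 2) ->
  F T = F 0.
Proof.
move=> T0 HF; apply/eqP; rewrite -subr_eq0 -normr_eq0; apply/negPn/negP => nz.
have B0 : 0 <= B * T ^+ 2.
  by have := HF 0 T (lexx 0) T0 (lexx T); rewrite subr0; exact: le_trans.
have step n : `|F T - F 0| <= B * T ^+ 2 / n.+1%:R.
  pose t k : R := T * k%:R / n.+1%:R.
  have -> : F T - F 0 = \sum_(k < n.+1) (F (t k.+1) - F (t k)).
    rewrite -(big_mkord xpredT (fun k => F (t k.+1) - F (t k))) telescope_sumr//.
    by rewrite /t mulr0 mul0r mulfK.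
  rewrite (le_trans (ler_norm_sum _ _ _))//.
  have -> : B * T ^+ 2 / n.+1%:R = \sum_(k < n.+1) (B * (T / n.+1%:R) ^+ 2).
    rewrite sumr_const card_ord -[RHS]mulr_natr; by field; rewrite nat1r pnatr_eq0.
  apply: ler_sum => k _; rewrite (le_trans (HF (t k) _ _ _ _))//.
  - by rewrite /t !mulr_ge0// invr_ge0.
  - by rewrite /t ler_wpM2r ?invr_ge0// ler_wpM2l// ler_nat.
  - by rewrite /t ler_pdivrMr// ler_wpM2l// ler_nat.
  - rewrite (_ : t k.+1 - t k = T / n.+1%:R)// /t -!natr1.
    by rewrite -mulrBl -mulrBr addrAC subrr add0r mulr1.
have Fpos : 0 < `|F T - F 0| by rewrite lt0r nz normr_ge0.
pose n := Num.truncn (B * T ^+ 2 / `|F T - F 0|).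
have := step n; rewrite ler_pdivlMr// mulrC -ler_pdivlMr// leNgt.
by rewrite truncnS_gt.
Qed.

Lemma Rintegral_itv_oc_cst (s t k : R) : s <= t ->
  \int[mu]_(u in `]s, t]) k = k * (t - s).
Proof.
move=> st; rewrite Rintegral_cst//= lebesgue_measure_itv/= lte_fin.
case: ifPn => //; rewrite -leNgt => ts.
have -> : t = s by apply/eqP; rewrite eq_le st ts.
by rewrite subrr.
Qed.

(* The integrand is only bounded and measurable, so the composite need not be
   differentiable; instead its defect is of second order in the time step. *)
Lemma chain_rule_bounded_density (lam G g : R -> R) (L B T : R) :
  measurable_fun setT lam -> (forall u, 0 <= u <= T -> 0 <= lam u <= L) ->
  (forall x : R, is_derive x (1 : R) G (g x)) ->
  (forall x y, 0 <= x -> x <= y -> `|g y - g x| <= B * (y - x)) ->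
  measurable_fun setT g -> 0 <= T ->
  let Lam t := \int[mu]_(u in `[0, t]) lam u in
  mu.-integrable `[0, T] (EFin \o (fun u => g (Lam u) * lam u)) /\
  G (Lam T) = G 0 + \int[mu]_(u in `[0, T]) (g (Lam u) * lam u).
Proof.
move=> mlam lamL dG gB mg T0 Lam.
have L0 : 0 <= L by have /andP[/le_trans h /h] := lamL 0 (introT andP (conj (lexx 0) T0)).
have B0 : 0 <= B.
  by have := gB 0 1 (lexx 0) ler01; rewrite subr0 mulr1; exact: le_trans.
have intlam t : t <= T -> mu.-integrable `[0, t] (EFin \o lam).
  move=> tT; apply: (@bounded_itv_integrable _ _ _ L); first exact: measurable_funTS.
  move=> u /andP[u0 ut]; have /lamL/andP[l0 lL] : 0 <= u <= T by rewrite u0 (le_trans ut).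
  by rewrite ger0_norm.
have LamB s t : 0 <= s -> s <= t -> t <= T ->
    Lam t - Lam s = \int[mu]_(u in `]s, t]) lam u.
  by move=> s0 st tT; rewrite /Lam Rintegral_itvB// ?bnd_simp//; exact: intlam.
have sub_itv s t : 0 <= s -> t <= T -> `]s, t]%classic `<=` `[0, T]%classic.
  move=> s0 tT u /=; rewrite !in_itv/= => /andP[su ut].
  by rewrite (le_trans s0 (ltW su)) (le_trans ut).
have Lam_le s t : 0 <= s -> s <= t -> t <= T -> Lam s <= Lam t.
  move=> s0 st tT; rewrite -subr_ge0 LamB//; apply: Rintegral_ge0 => u ut.
  by have := sub_itv s t s0 tT u ut; rewrite /= in_itv/= => /lamL/andP[].
have Lam0 : Lam 0 = 0 by rewrite /Lam set_itv1 Rintegral_set1.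
have Lam_ge0 s : 0 <= s -> s <= T -> 0 <= Lam s.
  by move=> s0 sT; rewrite -Lam0 Lam_le.
have LamL s t : 0 <= s -> s <= t -> t <= T -> Lam t - Lam s <= L * (t - s).
  move=> s0 st tT; rewrite LamB//.
  have -> : L * (t - s) = \int[mu]_(u in `]s, t]) L.
    by rewrite Rintegral_itv_oc_cst.
  apply: le_Rintegral => //.
  - apply: integrableS (intlam T (lexx _)) => //; exact: sub_itv.
  - apply: (@integrableS _ _ _ mu `[s, t]) => //; first by apply: subset_itvr; rewrite bnd_simp.
    by apply: (@bounded_itv_integrable _ _ _ `|L|).
  - by move=> u /(sub_itv s t s0 tT); rewrite /= in_itv/= => /lamL/andP[].
(* [Lam] is known to be monotone on [[0, T]] only; clipping its argument gives a monotone, hence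
   measurable, function on the line. *)
have mLam : measurable_fun `[0, T] Lam.
  apply: (eq_measurable_fun (fun x : R => Lam (Num.min (Num.max x 0) T) : R)).
    by move=> x /set_mem; rewrite /= in_itv/= => /andP[x0 xT]; rewrite max_l// min_l.
  apply: nondecreasing_measurable => // x y xy; apply: Lam_le.
  - by rewrite le_min T0 le_max lexx orbT.
  - by rewrite le_min !ge_min !ge_max !le_max !lexx xy !orbT.
  - by rewrite ge_min lexx orbT.
have gLam s : 0 <= s <= T -> `|g (Lam s)| <= `|g 0| + B * (L * T).
  move=> /andP[s0 sT]; rewrite -[g (Lam s)](subrK (g 0)) addrC (le_trans (ler_normD _ _))// lerD2l.
  rewrite (le_trans (gB 0 (Lam s) _ _))// ?Lam_ge0//; rewrite ler_wpM2l//.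
  have := LamL 0 s (lexx _) s0 sT; rewrite Lam0 !subr0 => /le_trans; apply.
  by rewrite ler_wpM2l.
have mgl : measurable_fun `[0, T] (fun u => g (Lam u) * lam u).
  apply: measurable_funM; last exact: measurable_funTS.
  exact: measurableT_comp.
have intg : mu.-integrable `[0, T] (EFin \o (fun u => g (Lam u) * lam u)).
  apply: (@bounded_itv_integrable _ _ _ ((`|g 0| + B * (L * T)) * L)) => // u uT.
  have /andP[l0 lL] := lamL u uT.
  by rewrite normrM ler_pM// ?gLam// ger0_norm.
split=> //.
pose F t := G (Lam t) - \int[mu]_(u in `[0, t]) (g (Lam u) * lam u).
suff : F T = F 0.
  by rewrite /F set_itv1 Rintegral_set1 subr0 Lam0 => <-; rewrite subrK.
apply: (@quadratic_oscillation_constant _ (B * L * L)) => // s t s0 st tT.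
have intg' : mu.-integrable `[0, t] (EFin \o (fun u => g (Lam u) * lam u)).
  by apply: integrableS intg => //; apply: subset_itvl; rewrite bnd_simp.
have intgst : mu.-integrable `]s, t] (EFin \o (fun u => g (Lam u) * lam u)).
  by apply: integrableS intg => //; exact: sub_itv.
have intlst : mu.-integrable `]s, t] (EFin \o lam).
  by apply: integrableS (intlam T (lexx _)) => //; exact: sub_itv.
have [c /= cin Gc] : exists2 c, c \in `[Lam s, Lam t] &
    G (Lam t) - G (Lam s) = g c * (Lam t - Lam s).
  have cG : {within `[Lam s, Lam t], continuous G}.
    apply: continuous_subspaceT => x.
    by apply/differentiable_continuous/derivable1_diffP; have [] := dG x.
  have dG' x : x \in `]Lam s, Lam t[ -> is_derive x 1 G (g x) by move=> _; exact: dG.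
  by have [c cin ->] := MVT_segment (Lam_le s t s0 st tT) dG' cG; exists c.
(* With [c] from the mean value theorem, both [c] and [Lam u] lie between [Lam s] and [Lam t], at
   distance at most [L (t - s)]. The integrand is therefore at most [B L (t - s) L], which makes the
   increment of [F] quadratic in the step. *)
have FE : F t - F s = \int[mu]_(u in `]s, t]) ((g c - g (Lam u)) * lam u).
  under eq_Rintegral do rewrite mulrBl.
  rewrite RintegralB//; last exact: integrableZl_EFin.
  rewrite RintegralZl// -LamB// -Gc -(Rintegral_itvB intg') ?bnd_simp//.
  rewrite /F; ring.
rewrite FE.
have intFE : mu.-integrable `]s, t] (EFin \o (fun u => (g c - g (Lam u)) * lam u)).
  rewrite (_ : (fun u => _) = fun u => g c * lam u - g (Lam u) * lam u).
    by apply: integrableB_EFin => //; exact: integrableZl_EFin.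
  by apply/funext => u; rewrite mulrBl.
rewrite (le_trans (le_normr_Rintegral _ intFE))//.
have -> : B * L * L * (t - s) ^+ 2 = \int[mu]_(u in `]s, t]) (B * L * L * (t - s)).
  by rewrite Rintegral_itv_oc_cst// expr2 mulrA.
apply: le_Rintegral => //.
- have := integrable_norm intFE; exact.
- apply: (@integrableS _ _ _ mu `[s, t]) => //; first by apply: subset_itvr; rewrite bnd_simp.
  by apply: (@bounded_itv_integrable _ _ _ `|B * L * L * (t - s)|).
move=> u ust; have u0T := sub_itv s t s0 tT u ust.
move: ust u0T; rewrite /= !in_itv/= => /andP[su ut] u0T.
have /andP[u0 uT] := u0T.
have /andP[l0 lL] := lamL u u0T.
rewrite normrM (ger0_norm l0).
have -> : B * L * L * (t - s) = (B * (L * (t - s))) * L by ring.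
apply: ler_pM => //.
have Lsu := Lam_le s u s0 (ltW su) uT; have Lut := Lam_le u t u0 ut tT.
have Lst := LamL s t s0 st tT.
have Ls0 := Lam_ge0 s s0 (le_trans st tT).
move: cin; rewrite in_itv/= => /andP[sc ct].
have [cu|/ltW uc] := leP c (Lam u).
  rewrite distrC (le_trans (gB _ _ _ _))//; first by rewrite (le_trans Ls0).
  by rewrite ler_wpM2l// (le_trans _ Lst)// lerB.
rewrite (le_trans (gB _ _ _ _))//; first by rewrite (le_trans Ls0).
by rewrite ler_wpM2l// (le_trans _ Lst)// lerB.
Qed.

End ChainRule.

(** * The bounded substitute for the exponential *)

Section BoundedExponential.
Context {R : realType}.
Implicit Types (e x y : R).

(* A bounded substitute for the exponential whose logarithmic derivative is at
   most 1; it increases to [expR x] as [e] decreases to 0. *)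
Definition bexp e x : R := (expR (- x) + e)^-1.
Definition dbexp e x : R := expR (- x) * (expR (- x) + e) ^- 2.

Lemma bexp_gt0 e x : 0 < e -> 0 < bexp e x.
Proof. by move=> e0; rewrite invr_gt0 addr_gt0 ?expR_gt0. Qed.

Lemma bexp_le e x : 0 < e -> bexp e x <= e^-1.
Proof.
move=> e0; rewrite lef_pV2 ?posrE ?addr_gt0 ?expR_gt0//.
by rewrite lerDr expR_ge0.
Qed.

Lemma bexp0_le1 e : 0 < e -> bexp e 0 <= 1.
Proof.
by move=> e0; rewrite /bexp oppr0 expR0 invf_le1 ?addr_gt0// lerDl ltW.
Qed.

Lemma dbexp_ge0 e x : 0 < e -> 0 <= dbexp e x.
Proof. by move=> e0; rewrite mulr_ge0 ?expR_ge0// invr_ge0 exprn_ge0// addr_ge0 ?expR_ge0 ?ltW. Qed.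

Lemma dbexp_le_bexp e x : 0 < e -> dbexp e x <= bexp e x.
Proof.
move=> e0; have p0 := expR_gt0 (- x); rewrite /dbexp /bexp -exprVn expr2 mulrA.
have i0 : 0 < (expR (- x) + e)^-1 by rewrite invr_gt0 addr_gt0.
apply: ler_piMl; first exact: ltW.
by rewrite ler_pdivrMr ?addr_gt0// mul1r lerDl ltW.
Qed.

Lemma is_derive_bexp e x : 0 < e -> is_derive x (1 : R) (bexp e) (dbexp e x).
Proof.
move=> e0; have d0 : expR (- x) + e != 0 by rewrite gt_eqF ?addr_gt0 ?expR_gt0.
have d1 : is_derive x (1 : R) (fun y => expR (- y) + e) (- expR (- x)).
  have dn : is_derive x (1 : R) (-%R : R -> R) (-1) by apply: is_deriveNid.
  have de := is_derive1_comp (is_derive_expR (- x)) dn.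
  rewrite [X in is_derive _ _ X _](_ : _ = (expR \o -%R) + cst e)//.
  by apply: is_derive_eq; rewrite addr0 mulrN1.
have := @is_deriveV _ (fun y => expR (- y) + e) x _ 1 d0 d1; rewrite (_ : _ *: _ = dbexp e x)//.
by rewrite /dbexp /GRing.scale/= mulrNN mulrC.
Qed.

Lemma dbexp_lipschitz e x y : 0 < e -> 0 <= x -> x <= y ->
  `|dbexp e y - dbexp e x| <= e ^- 2 * (y - x).
Proof.
move=> e0 x0 xy.
set p := expR (- x); set r := expR (- y).
have p0 : 0 < p by exact: expR_gt0.
have r0 : 0 < r by exact: expR_gt0.
have p1 : p <= 1 by rewrite -expR0 ler_expR oppr_le0.
have rp : r <= p by rewrite ler_expR lerN2.
have pr : p - r <= y - x.
  have := expR_ge1Dx (x - y); rewrite -[x - y]opprB => h.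
  have -> : r = p * expR (- (y - x)) by rewrite -expRD; congr expR; ring.
  have : p * (y - x) <= y - x by rewrite ler_piMl// subr_ge0.
  have : p * (1 - (y - x)) <= p * expR (- (y - x)) by rewrite ler_wpM2l// ltW.
  rewrite mulrBr mulr1; lra.
have P0 : 0 < p + e by rewrite addr_gt0.
have R0 : 0 < r + e by rewrite addr_gt0.
(* In absolute value the numerator is at most [(y - x) (p + e) (r + e)]. This cancels one factor of
   the denominator, and the remaining one is at least [e^2]. *)
have -> : dbexp e y - dbexp e x = (p - r) * (p * r - e ^+ 2) / ((p + e) ^+ 2 * (r + e) ^+ 2).
  by rewrite /dbexp -/p -/r; field; rewrite !gt_eqF.
rewrite normrM normfV (gtr0_norm (x := _ ^+ 2 * _)) ?mulr_gt0 ?exprn_gt0//.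
rewrite normrM (ger0_norm (x := p - r)) ?subr_ge0//.
have N : `|p * r - e ^+ 2| <= (p + e) * (r + e).
  have ? : 0 < p * r by rewrite mulr_gt0.
  have ? : 0 < e ^+ 2 by rewrite exprn_gt0.
  have ? : 0 < p * e by rewrite mulr_gt0.
  have ? : 0 < e * r by rewrite mulr_gt0.
  have -> : (p + e) * (r + e) = p * r + e ^+ 2 + p * e + e * r by ring.
  by rewrite ler_norml; apply/andP; split; lra.
have E : e ^+ 2 <= (p + e) * (r + e).
  by rewrite expr2 ler_pM// ?ltW// ltrDr.
rewrite ler_pdivrMr ?mulr_gt0 ?exprn_gt0//.
apply: (@le_trans _ _ ((y - x) * ((p + e) * (r + e)))).
  by apply: ler_pM => //; rewrite subr_ge0.
have -> : e ^- 2 * (y - x) * ((p + e) ^+ 2 * (r + e) ^+ 2) =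
   ((y - x) * ((p + e) * (r + e))) * (e ^- 2 * ((p + e) * (r + e))) by ring.
apply: ler_peMr; first by rewrite !mulr_ge0 ?subr_ge0// ltW.
by rewrite mulrC ler_pdivlMr ?mul1r// exprn_gt0.
Qed.

Lemma continuous_bexp e : 0 < e -> continuous (bexp e).
Proof.
move=> e0 x; apply/differentiable_continuous/derivable1_diffP.
by have [] := @is_derive_bexp e x e0.
Qed.

Lemma measurable_dbexp e : 0 < e -> measurable_fun setT (dbexp e).
Proof.
move=> e0; rewrite (_ : dbexp e = fun x => expR (- x) * bexp e x ^+ 2).
  apply: measurable_funM; first exact: measurableT_comp.
  apply: measurable_funX; apply: continuous_measurable_fun.
  exact: continuous_bexp.
by apply/funext => x; rewrite /dbexp /bexp exprVn.
Qed.

Lemma cvg_bexp x : bexp n.+1%:R^-1 x @[n --> \oo] --> expR x.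
Proof.
rewrite -[expR x]invrK -expRN -[expR (- x)]addr0.
apply: cvgV; first by rewrite addr0 gt_eqF ?expR_gt0.
by apply: cvgD; [exact: cvg_cst|exact: cvg_harmonic].
Qed.
End BoundedExponential.

(** * Pathwise identity *)

Section Paths.
Context {R : realType}.
Local Notation mu := (@lebesgue_measure R).
Variables (k : R -> R) (K : R).
Hypothesis mk : measurable_fun setT k.
Hypothesis kK : forall v, 0 <= k v <= K.
Hypothesis k0 : forall v, v <= 0 -> k v = 0.

Definition primitive (f : R -> R) (v : R) : R := \int[mu]_(u in `[0, v]) f u.

Let intk a b : mu.-integrable `[a, b] (EFin \o k).
Proof.
apply: (@bounded_itv_integrable _ _ _ K); first exact: measurable_funTS.
by move=> x _; have /andP[? ?] := kK x; rewrite ger0_norm.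
Qed.

Let K0 : 0 <= K.
Proof. by have /andP[h /(le_trans h)] := kK 0. Qed.

Lemma primitive_le0 v : v <= 0 -> primitive k v = 0.
Proof.
rewrite /primitive le_eqVlt => /predU1P[->|v0]; first by rewrite set_itv1 Rintegral_set1.
by rewrite set_itv_ge ?bnd_simp -?ltNge// Rintegral_set0.
Qed.

Lemma primitive_ge0 v : 0 <= primitive k v.
Proof. by apply: Rintegral_ge0 => u _; case/andP: (kK u). Qed.

Let primitive_lipschitz_ge0 s t : 0 <= s -> s <= t ->
  0 <= primitive k t - primitive k s <= K * (t - s).
Proof.
move=> s0 st; rewrite /primitive (Rintegral_itvB (intk _ _)) ?bnd_simp//.
rewrite -(Rintegral_itv_oc_cst K st) Rintegral_ge0/=; last first.
  by move=> u _; case/andP: (kK u).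
apply: le_Rintegral => //.
- apply: (@integrableS _ _ _ mu `[s, t]) => //.
  by apply: subset_itvr; rewrite bnd_simp.
- apply: (@integrableS _ _ _ mu `[s, t]) => //; first by apply: subset_itvr; rewrite bnd_simp.
  by apply: (@bounded_itv_integrable _ _ _ `|K|).
- by move=> u _; case/andP: (kK u).
Qed.

Lemma primitive_lipschitz s t : s <= t -> 0 <= primitive k t - primitive k s <= K * (t - s).
Proof.
move=> st; have [s0|s0] := leP 0 s; first exact: primitive_lipschitz_ge0.
have [t0|t0] := leP t 0.
  by rewrite !primitive_le0 ?(ltW s0)// subrr lexx mulr_ge0// subr_ge0.
have /andP[h1 h2] := primitive_lipschitz_ge0 (lexx 0) (ltW t0).
have -> : primitive k s = primitive k 0 by rewrite !primitive_le0// ltW.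
rewrite h1 (le_trans h2)//; by rewrite ler_wpM2l// lerD2l lerN2 ltW.
Qed.

Lemma primitive_continuous v : primitive k x @[x --> v] --> primitive k v.
Proof.
have lip x y : `|primitive k x - primitive k y| <= K * `|x - y|.
  wlog xy : x y / y <= x.
    by move=> H; have [/H//|/ltW/H] := leP y x; rewrite distrC (distrC y).
  have /andP[h1 h2] := primitive_lipschitz xy.
  by rewrite (ger0_norm h1) (ger0_norm (x := x - y)) ?subr_ge0.
have K1 : 0 < K + 1 by rewrite ltr_wpDl.
apply/cvgrPdist_le => eps eps0; near=> x.
rewrite (le_trans (lip _ _))//.
rewrite (@le_trans _ _ ((K + 1) * `|v - x|))//; first by rewrite ler_wpM2r// lerDl.
rewrite mulrC -ler_pdivlMr//; near: x.
exists (eps / (K + 1)); first by rewrite /= divr_gt0.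
by move=> x /= /ltW.
Unshelve. all: by end_near. Qed.

Lemma Rintegral_translation s t : 0 <= s -> 0 <= t ->
  \int[mu]_(u in `[0, t]) k (u - s) = primitive k (t - s).
Proof.
move=> s0 t0; have [ts|st] := ltP t s.
  rewrite primitive_le0 ?subr_le0 ?ltW//.
  rewrite (@eq_Rintegral _ _ _ _ _ (fun=> 0)).
    by rewrite Rintegral_cst// mul0r.
  move=> u /set_mem; rewrite /= in_itv/= => /andP[_ ut].
  by rewrite k0// subr_le0 (le_trans ut)// ltW.
rewrite /primitive /Rintegral; congr fine.
rewrite -(@integral_translation _ s _ (EFin \o k))//; last 2 first.
- by apply/measurable_EFinP; exact: measurable_funTS.
- by move=> u _; rewrite lee_fin; case/andP: (kK u).
have -> : [set x | `[0, t - s]%classic (x - s)] = `[s, t]%classic.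
  by apply/seteqP; split => u /=; rewrite !in_itv/= lerD2r subr_ge0.
rewrite [LHS]integral_mkcond [RHS]integral_mkcond; apply: eq_integral => u _.
rewrite /patch !mem_setE !in_itv/=; case: leP => u0 /=; last first.
  by case: leP => //= su; have := lt_le_trans u0 (le_trans s0 su); rewrite ltxx.
case: leP => ut /=; rewrite ?andbT ?andbF//.
by case: leP => // us; rewrite k0// subr_le0 ltW.
Qed.

Section OnePath.
Variables (l : seq (R * R)) (psi g : R -> R) (c M T e : R).
Hypothesis ul : uniq (map fst l).
Hypothesis lT : forall z, z \in l -> 0 < z.1 <= T.
Hypothesis c0 : 0 <= c.
Hypothesis psiM : forall y, 0 <= psi y <= M.
Hypothesis g01 : forall y, 0 <= g y <= 1.
Hypothesis T0 : 0 <= T.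
Hypothesis e0 : 0 < e.

(** The sums run over the whole list: [k] and its primitive vanish on negative arguments, so events
    after the current time contribute 0. *)
Definition path_rate (u : R) : R := c + \sum_(z <- l) psi z.2 * k (u - z.1).
Definition path_compensator (t : R) : R :=
  c * t + \sum_(z <- l) psi z.2 * primitive k (t - z.1).

Let intk_shift (z : R * R) t : mu.-integrable `[0, t] (EFin \o (fun u => psi z.2 * k (u - z.1))).
Proof.
apply: integrableZl_EFin => //; apply: (@bounded_itv_integrable _ _ _ K).
  apply: measurable_funTS; apply: measurableT_comp => //; exact: measurable_funB.
by move=> x _; have /andP[? ?] := kK (x - z.1); rewrite ger0_norm.
Qed.

Lemma path_compensatorE t : 0 <= t ->
  path_compensator t = \int[mu]_(u in `[0, t]) path_rate u.
Proof.
move=> t0; rewrite /path_rate RintegralD//; last 2 first.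
- by apply: (@bounded_itv_integrable _ _ _ `|c|).
- by apply: integrable_sum_EFin => // z _; exact: intk_shift.
rewrite Rintegral_sum//; congr (_ + _).
  rewrite -(Rintegral_itv_obnd_cbnd); last by apply: (@integrableS _ _ _ mu `[0, t]) => //;
    [apply: subset_itvr; rewrite bnd_simp|apply: (@bounded_itv_integrable _ _ _ `|c|)].
  by rewrite Rintegral_itv_oc_cst// subr0.
apply: eq_big_seq => z /lT/andP[/ltW z0 _]; rewrite RintegralZl ?Rintegral_translation//.
apply: (@bounded_itv_integrable _ _ _ K).
  apply: measurable_funTS; apply: measurableT_comp => //; exact: measurable_funB.
by move=> x _; have /andP[? ?] := kK (x - z.1); rewrite ger0_norm.
Qed.

Lemma path_rate_bounded u : 0 <= path_rate u <= c + \sum_(z <- l) M * K.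
Proof.
rewrite addr_ge0//=; last first.
  apply: sumr_ge0 => z _; rewrite mulr_ge0//; first by case/andP: (psiM z.2).
  by case/andP: (kK (u - z.1)).
rewrite lerD2l; apply: ler_sum => z _.
by have /andP[? ?] := psiM z.2; have /andP[? ?] := kK (u - z.1); rewrite ler_pM.
Qed.

Lemma measurable_path_rate : measurable_fun setT path_rate.
Proof.
apply: measurable_funD => //; apply: measurable_sum => z.
apply: measurable_funM => //; apply: measurableT_comp => //; exact: measurable_funB.
Qed.

Let q (z : R * R) := 1 - g z.2.

Let q01 z : 0 <= q z <= 1.
Proof. by have /andP[h1 h2] := g01 z.2; rewrite /q subr_ge0 h2 gerBl h1. Qed.

Let D := \int[mu]_(u in `[0, T])
  (dbexp e (path_compensator u) * path_rate u * prod_before l q u).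

Let chain t : 0 <= t <= T ->
  mu.-integrable `[0, t] (EFin \o (fun u => dbexp e (path_compensator u) * path_rate u)) /\
  bexp e (path_compensator t) = bexp e 0 +
    \int[mu]_(u in `[0, t]) (dbexp e (path_compensator u) * path_rate u).
Proof.
move=> /andP[t0 tT].
rewrite path_compensatorE//; have [|||h1 ->] := @chain_rule_bounded_density _ path_rate (bexp e) (dbexp e)
  (c + \sum_(z <- l) M * K) (e ^- 2) t measurable_path_rate _ _ _ (measurable_dbexp e0) t0.
- by move=> u _; exact: path_rate_bounded.
- by move=> x; exact: is_derive_bexp.
- by move=> x y; exact: dbexp_lipschitz.
have E : {in `[0, t]%classic, (fun u => dbexp e (\int[mu]_(v in `[0, u]) path_rate v) * path_rate u)
    =1 (fun u => dbexp e (path_compensator u) * path_rate u)}.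
  by move=> u /set_mem; rewrite /= in_itv/= => /andP[u0 _]; rewrite path_compensatorE.
split; last by congr (_ + _); exact: eq_Rintegral.
by apply: eq_integrable h1 => // u ut /=; rewrite E.
Qed.

Lemma path_density_integrable : mu.-integrable `[0, T]
  (EFin \o (fun u => dbexp e (path_compensator u) * path_rate u * prod_before l q u)).
Proof.
have [h _] := chain (introT andP (conj T0 (lexx T))).
apply: le_integrable h => //.
  apply/measurable_EFinP/measurable_funM; last first.
    by apply: measurable_funTS; exact: measurable_prod_before.
  by have [/measurable_int/measurable_EFinP] := chain (introT andP (conj T0 (lexx T))).
move=> u _ /=; rewrite lee_fin normrM ler_piMr//.
by rewrite ger0_norm ?prod_before_le1// prod_before_ge0// => z; case/andP: (q01 z).
Qed.

(** Summation by parts with [bexp e] of the compensator as the absolutely continuous factor; its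
    density comes from the chain rule. *)
Lemma path_identity :
  \sum_(z <- l) bexp e (path_compensator z.1) * prod_before l q z.1 * g z.2 +
    bexp e (path_compensator T) * \prod_(z <- l) q z = bexp e 0 + D.
Proof.
have [hint _] := chain (introT andP (conj T0 (lexx T))).
have comp0 : path_compensator 0 = 0.
  by rewrite path_compensatorE// set_itv1 Rintegral_set1.
rewrite -{2}comp0 -(@jump_sum_identity _ l q T _ (bexp e \o path_compensator) T0 q01 ul lT hint).
  by congr (_ + _); apply: eq_bigr => z _; rewrite /q subKr.
by move=> s /chain[_]; rewrite /= comp0.
Qed.

(** Dropping the product, which is at most 1, leaves the increment of [bexp e] along the
    compensator. The bound is uniform over the paths, so the drift has finite mean. *)
Lemma path_density_bounded : 0 <= D <= e^-1.
Proof.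
have rate0 u : 0 <= path_rate u by case/andP: (path_rate_bounded u).
have pb0 u : 0 <= prod_before l q u.
  by apply: prod_before_ge0 => z; case/andP: (q01 z).
apply/andP; split.
  by apply: Rintegral_ge0 => u _; apply: mulr_ge0 => //; apply: mulr_ge0 => //; exact: dbexp_ge0.
have [hint E] := chain (introT andP (conj T0 (lexx T))).
apply: (@le_trans _ _ (bexp e (path_compensator T))); last exact: bexp_le.
rewrite E; apply: (@le_trans _ _ (\int[mu]_(u in `[0, T]) (dbexp e (path_compensator u) * path_rate u))).
  apply: le_Rintegral => //; first exact: path_density_integrable.
  by move=> u _; rewrite ler_piMr ?prod_before_le1//; apply: mulr_ge0 => //; exact: dbexp_ge0.
by rewrite lerDr ltW// bexp_gt0.
Qed.

End OnePath.
End Paths.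

(** * Measurability and predictability of sums over past events *)

Lemma cvg_sum_seq (R : realType) (I : eqType) (s : seq I) (f : nat -> I -> R) (l : I -> R) :
  (forall i, i \in s -> f n i @[n --> \oo] --> l i) ->
  \sum_(i <- s) f n i @[n --> \oo] --> \sum_(i <- s) l i.
Proof.
elim: s => [|i s IH] fl.
  by under eq_fun do rewrite big_nil; rewrite big_nil; exact: cvg_cst.
under eq_fun do rewrite big_cons; rewrite big_cons.
apply: cvgD; first by apply: fl; rewrite inE eqxx.
by apply: IH => k ks; apply: fl; rewrite inE ks orbT.
Qed.

Section Counting.
Import HBNNSimple.
Context {d} {Omega : measurableType d} {R : realType}.
Variable N : Omega -> set (R * R).
Hypothesis ppN : point_process N.

(** The generators of [history], isolated so that the generated sigma-algebra can serve as the
    domain of a measurable function. *)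
Definition history_generators (t : R) : set (set Omega) :=
  [set E | exists s A U,
     [/\ 0 <= s <= t, measurable A, A `<=` unit_itv, measurable U
       & E = (event_count N s A) @^-1` U]].

Definition history_measurable (t : R) (X : Omega -> R) : Prop :=
  measurable_fun [set: g_sigma_algebraType (history_generators t)]
    (X : g_sigma_algebraType (history_generators t) -> R).

(* Events at time 0 are left out, since the integrand of the exponential inequality
   vanishes there. *)
Definition points (T : R) (w : Omega) : seq (R * R) :=
  enum_fset (fset_set (N w `&` (`]0, T] `*` unit_itv))).

Definition point_sum (T : R) (f : R -> R) (w : Omega) : R :=
  \sum_(z <- points T w) f z.2.

Let points0 (T : R) (w : Omega) : seq (R * R) :=
  enum_fset (fset_set (N w `&` (`[0, T] `*` unit_itv))).

Let mem_points0 T w z : (z \in points0 T w) <-> N w z /\ z.1 <= T.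
Proof.
rewrite /points0 in_fset_set; last exact: pp_locally_finite.
split=> [/set_mem[Nz []]|[Nz zT]].
  by rewrite /= in_itv/= => /andP[].
apply/mem_set; split=> //; have [z1 z2] := pp_sub ppN Nz; split=> //=.
by move: z1; rewrite /Rplus/= !in_itv/= andbT => ->.
Qed.

Lemma finite_points T w : finite_set (N w `&` (`]0, T] `*` unit_itv)).
Proof.
apply: sub_finite_set (pp_locally_finite ppN w T) => z [Nz [z1 z2]].
split=> //; split=> //; move: z1; rewrite /= !in_itv/= => /andP[/ltW -> ->//].
Qed.

Lemma mem_points T w z : (z \in points T w) <-> N w z /\ 0 < z.1 <= T.
Proof.
rewrite /points in_fset_set; last exact: finite_points.
split=> [/set_mem[Nz []]|[Nz zT]].
  by rewrite /= in_itv.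
apply/mem_set; split=> //; have [z1 z2] := pp_sub ppN Nz.
by split; rewrite //= in_itv.
Qed.

Lemma points_uniq_times T w : uniq (map fst (points T w)).
Proof.
rewrite map_inj_in_uniq ?fset_uniq// => z z' /mem_points[Nz _] /mem_points[Nz' _].
exact: pp_simple Nz Nz'.
Qed.

Let event_countE s (B : set R) w : fine (event_count N s (B `&` unit_itv) w) =
  \sum_(z <- points0 s w) \1_B z.2.
Proof.
have fin : finite_set (N w `&` (`[0, s] `*` (B `&` unit_itv))).
  apply: sub_finite_set (pp_locally_finite ppN w s) => z [Nz [z1 [_ z2]]].
  by split.
rewrite /event_count /counting asboolT//=.
transitivity (\sum_(z <- points0 s w | z.2 \in B) (1 : R)).
  rewrite -big_filter big_const_seq count_predT iter_addr_0; congr (_ *+ _).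
  apply/perm_size/uniq_perm; rewrite ?filter_uniq ?fset_uniq// => z.
  rewrite in_fset_set// mem_filter; apply/idP/idP.
    move=> /set_mem[Nz [z1 [Bz z2]]]; apply/andP; split; first exact/mem_set.
    by apply/mem_points0; split=> //; move: z1; rewrite /= in_itv/= => /andP[].
  move=> /andP[/set_mem Bz /mem_points0[Nz zs]]; have [z1 z2] := pp_sub ppN Nz.
  apply/mem_set; do !split => //; move: z1; rewrite /Rplus/= !in_itv/= andbT => ->//.
by rewrite big_mkcond; apply: eq_bigr => z _; rewrite indicE; case: (_ \in _).
Qed.

(** Counts include the events at time 0 and [points] leaves them out, hence the subtraction of the
    count at time 0. *)
Let point_sum_indic s (B : set R) w : 0 <= s ->
  point_sum s \1_B w = fine (event_count N s (B `&` unit_itv) w) -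
    fine (event_count N 0 (B `&` unit_itv) w).
Proof.
move=> s0; rewrite !event_countE (bigID (fun z : R * R => 0 < z.1))/= addrC.
have -> : \sum_(z <- points0 s w | ~~ (0 < z.1)) \1_B z.2 =
    \sum_(z <- points0 0 w) \1_B z.2 :> R.
  rewrite -big_filter; apply/perm_big/uniq_perm; rewrite ?filter_uniq ?fset_uniq// => z.
  rewrite mem_filter -leNgt; apply/idP/idP.
    by move=> /andP[z0 /mem_points0[Nz zs]]; apply/mem_points0.
  by move=> /mem_points0[Nz z0]; rewrite z0; apply/mem_points0; split=> //; exact: le_trans s0.
rewrite addrAC subrr add0r -big_filter; apply/perm_big/uniq_perm; rewrite ?filter_uniq ?fset_uniq// => z.
rewrite mem_filter; apply/idP/idP.
  by move=> /mem_points[Nz /andP[z0 zs]]; rewrite z0; apply/mem_points0.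
by move=> /andP[z0 /mem_points0[Nz zs]]; apply/mem_points; rewrite z0.
Qed.

Lemma history_measurable_point_sum s t (f : R -> R) : 0 <= s <= t ->
  measurable_fun setT f -> (forall y, 0 <= f y) ->
  history_measurable t (point_sum s f).
Proof.
move=> /andP[s0 st] mf f0.
have mcount r B : 0 <= r <= t -> measurable B ->
    history_measurable t (fun w => fine (event_count N r (B `&` unit_itv) w)).
  move=> rt mB; apply: measurableT_comp => //.
  move=> _ U mU; rewrite setTI; apply: sub_sigma_algebra.
  exists r, (B `&` unit_itv), U; split=> //.
  by apply: measurableI => //; exact: measurable_itv.
have mindic B : measurable B -> history_measurable t (point_sum s \1_B).
  move=> mB; rewrite /history_measurable (funext (fun w => point_sum_indic B w s0)).
  by apply: measurable_funB; apply: mcount => //; rewrite ?s0 ?st ?lexx ?(le_trans s0 st).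
have mf' : measurable_fun setT (EFin \o f) by exact/measurable_EFinP.
(* Indicators reduce to counts, simple functions are finite combinations of them, and the limit
   passes through because the sum over the events is finite. *)
pose g := nnsfun_approx measurableT mf'.
rewrite /history_measurable.
apply: (@measurable_fun_cvg _ (g_sigma_algebraType (history_generators t)) _ setT (fun n w => point_sum s (g n) w)).
  move=> n; rewrite (_ : point_sum s _ = fun w =>
      \sum_(r <- fset_set (range (g n))) r * point_sum s \1_(g n @^-1` [set r]) w).
    apply: measurable_sum => r; apply: measurable_funM => //; apply: mindic.
    by rewrite -[X in measurable X]setTI; exact: measurable_funP.
  apply/funext => w; rewrite /point_sum.
  under [RHS]eq_bigr do rewrite mulr_sumr.
  rewrite exchange_big/=; apply: eq_bigr => z _.
  by rewrite {1}(fimfunE (g n)) fsbig_finite.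
move=> w _; apply: cvg_sum_seq => z _.
have f0' y : setT y -> (0%:E <= (EFin \o f) y)%E by move=> _; rewrite /= lee_fin.
by have /fine_cvgP[_] := cvg_nnsfun_approx measurableT mf' f0' (Logic.I : setT z.2).
Qed.

End Counting.

Lemma grid_index (R : realType) (m : nat) (s : R) : 0 < s ->
  exists i : nat, i%:R / m.+1%:R < s <= i.+1%:R / m.+1%:R.
Proof.
move=> s0; have m0 : 0 < m.+1%:R :> R by rewrite ltr0n.
have sm0 : 0 < s * m.+1%:R by rewrite mulr_gt0.
have /ex_minnP[[|i]] : exists i : nat, s * m.+1%:R <= i%:R.
- by exists (Num.truncn (s * m.+1%:R)).+1; rewrite ltW// truncnS_gt.
- by rewrite leNgt sm0.
move=> si min; exists i; rewrite ltr_pdivrMr// ler_pdivlMr// si andbT ltNge.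
by apply/negP => /min; rewrite ltnn.
Qed.

(** The difference of truth values is the indicator that [s] lies in the cell []k/(m+1),
    (k+1)/(m+1)]], so at most one term survives. *)
Lemma grid_sum (R : realType) (m i j : nat) (s : R) (Q : nat -> R) :
  i%:R / m.+1%:R < s <= i.+1%:R / m.+1%:R ->
  \sum_(k < j) Q k * ((s <= k.+1%:R / m.+1%:R)%R%:R - (s <= k%:R / m.+1%:R)%R%:R) =
  if (i < j)%N then Q i else 0.
Proof.
move=> /andP[is_ si]; have m0 : 0 < m.+1%:R :> R by rewrite ltr0n.
have le_s k : (s <= k%:R / m.+1%:R) = (i < k)%N.
  apply/idP/idP => [sk|ik].
    have := lt_le_trans is_ sk; rewrite ltr_pM2r ?invr_gt0// ltr_nat//.
  by rewrite (le_trans si)// ler_pM2r ?invr_gt0// ler_nat.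
have E k : Q k * ((s <= k.+1%:R / m.+1%:R)%R%:R - (s <= k%:R / m.+1%:R)%R%:R) =
    if k == i then Q k else 0.
  rewrite !le_s ltnS; case: ltngtP => /= _; rewrite ?subrr ?mulr0// subr0 mulr1//.
under eq_bigr do rewrite E.
rewrite -big_mkcond/=; have [ij|ji] := ltnP i j.
  by rewrite (big_pred1 (Ordinal ij)).
by rewrite big_pred0// => k; apply/eqP => ki; move: (ltn_ord k); rewrite ki ltnNge ji.
Qed.

Section Predictability.
Context {d} {Omega : measurableType d} {R : realType}.
Variable N : Omega -> set (R * R).
Hypothesis ppN : point_process N.

Let PT := g_sigma_algebraType (predictable_rectangles N).

Definition strip (a b : R) : set ((R * R) * Omega) :=
  (`]a, b] `*` unit_itv) `*` [set: Omega].

Lemma historyT t : history N t [set: Omega].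
Proof.
rewrite -setC0 -setTD; apply: sigma_algebraCD.
exact: (@sigma_algebra0 _ setT).
Qed.

Lemma predictable_rectangle a b B E : 0 <= a <= b -> measurable B -> history N a E ->
  measurable ((`]a, b] `*` (B `&` unit_itv)) `*` E : set PT).
Proof.
move=> ab mB hE; apply: sub_sigma_algebra; left.
exists a, b, (B `&` unit_itv), E; split=> //.
by apply: measurableI => //; exact: measurable_itv.
Qed.

Lemma predictable_strip a b : 0 <= a <= b -> measurable (strip a b : set PT).
Proof.
move=> ab; have := predictable_rectangle ab measurableT (@historyT a).
by rewrite setTI.
Qed.

Lemma predictable_location a b (g : R -> R) : 0 <= a <= b -> measurable_fun setT g ->
  measurable_fun (strip a b : set PT) (fun u : PT => g u.1.2).
Proof.
move=> ab mg _ U mU.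
have := predictable_rectangle ab (mg measurableT U mU) (@historyT a).
congr (measurable _); rewrite setTI; apply/seteqP; split=> -[[t x] w] /=.
  by move=> [[tab [gx ux]] _].
by move=> [[[tab ux] _] gx].
Qed.

Lemma predictable_time a b : 0 <= a <= b ->
  measurable_fun (strip a b : set PT) (fun u : PT => u.1.1).
Proof.
move=> /andP[a0 ab].
apply: (measurability _ (RGenOInfty.measurableE R)) => _ [_ [x ->] <-].
have [bx|xb] := leP b x.
  rewrite (_ : _ `&` _ = set0)//; apply/seteqP; split=> // -[[t y] w] /=.
  move=> [[[tab _] _] xt]; move: tab xt; rewrite /= !in_itv/= andbT => /andP[_ tb] xt.
  by have := le_lt_trans (le_trans tb bx) xt; rewrite ltxx.
have := @predictable_strip (Num.max a x) b; rewrite le_max a0 ge_max ab (ltW xb) => /(_ isT).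
congr (measurable _); apply/seteqP; split=> -[[t y] w] /=.
  move=> [[/= tab uy] _]; move: tab; rewrite in_itv/= gt_max => /andP[/andP[at_ xt] tb].
  by split; [split=> //; split=> //=; rewrite in_itv/= at_|rewrite in_itv/= xt].
move=> [[[/= tab uy] _] xt]; split=> //; split=> //=; move: tab xt; rewrite !in_itv/= andbT.
by move=> /andP[at_ tb] xt; rewrite gt_max at_ xt.
Qed.

(** A predictable rectangle over []a, b]] may carry any event of the history up to [a], so what is
    known at time [a] is predictable on the strip. *)
Lemma predictable_history a b (X : Omega -> R) : 0 <= a <= b -> history_measurable N a X ->
  measurable_fun (strip a b : set PT) (fun u : PT => X u.2).
Proof.
move=> ab mX _ U mU.
have := predictable_rectangle ab measurableT (mX measurableT U mU).
congr (measurable _); rewrite !setTI; apply/seteqP; split=> -[[t x] w] /=.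
  by move=> [[tab ux] Xw].
by move=> [[[tab ux] _] Xw].
Qed.

Lemma point_sum_points s T (f : R -> R) w : s <= T ->
  point_sum N s f w = \sum_(z <- points N T w) f z.2 * (z.1 <= s)%R%:R.
Proof.
move=> sT; rewrite /point_sum.
have -> : \sum_(z <- points N s w) f z.2 =
    \sum_(z <- points N T w | z.1 <= s) f z.2.
  rewrite -[RHS]big_filter; apply/perm_big/uniq_perm; rewrite ?filter_uniq ?fset_uniq// => z.
  rewrite mem_filter; apply/idP/idP.
    move=> /mem_points-/(_ ppN)[Nz /andP[z0 zs]]; rewrite zs; apply/mem_points => //.
    by rewrite z0 (le_trans zs).
  move=> /andP[zs /mem_points-/(_ ppN)[Nz /andP[z0 zT]]]; apply/mem_points => //.
  by rewrite z0.
rewrite big_mkcond; apply: eq_bigr => z _.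
by case: ifP => _; rewrite ?mulr1 ?mulr0.
Qed.

(** On a grid of mesh [1/(n+1)] the current time is rounded down and each event time up. The
    resulting sum is known at the left end of the current cell, hence predictable there. The rounded
    difference approaches [t - z.1] from below, so left limits of [Q] suffice. *)
Lemma predictable_point_sum T (psi Q : R -> R) : 0 <= T ->
  measurable_fun setT psi -> (forall y, 0 <= psi y) ->
  (forall v, v <= 0 -> Q v = 0) ->
  (forall v, 0 < v -> Q x @[x --> v^'-] --> Q v) ->
  measurable_fun (strip 0 T : set PT)
    (fun u : PT => \sum_(z <- points N T u.2) psi z.2 * Q (u.1.1 - z.1)).
Proof.
move=> T0 mpsi psi0 Q0 Qleft.
have mt n : 0 < n.+1%:R :> R by rewrite ltr0n.
pose J n := (Num.truncn (T * n.+1%:R)).+1.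
pose Xi n j w := \sum_(i < j) Q ((j - i.+1)%N%:R / n.+1%:R) *
  (point_sum N (i.+1%:R / n.+1%:R) psi w - point_sum N (i%:R / n.+1%:R) psi w).
pose X n (u : PT) := \sum_(j < J n) ((Xi n j \o snd) \_ (strip (j%:R / n.+1%:R) (j.+1%:R / n.+1%:R))) u.
have mXi n j : history_measurable N (j%:R / n.+1%:R) (Xi n j).
  apply: measurable_sum => i; apply: measurable_funM => //.
  apply: measurable_funB; apply: history_measurable_point_sum => //.
    by rewrite divr_ge0//= ler_pM2r ?invr_gt0// ler_nat.
  by rewrite divr_ge0//= ler_pM2r ?invr_gt0// ler_nat ltnW.
have mX n : measurable_fun setT (X n).
  apply: measurable_sum => j; apply/(measurable_restrictT _ _).1.
    by apply: predictable_strip; rewrite divr_ge0//= ler_pM2r ?invr_gt0// ler_nat.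
  apply: predictable_history; last exact: mXi.
  by rewrite divr_ge0//= ler_pM2r ?invr_gt0// ler_nat.
apply: (@measurable_fun_cvg _ PT _ _ X) => [n|]; first exact: measurable_funTS.
move=> [[t x] w] /= [[t0T x01] _]; rewrite /= in x01.
have /andP[t0 tT] : 0 < t <= T by move: t0T; rewrite /= in_itv.
have Xsum n j : j%:R / n.+1%:R < t <= j.+1%:R / n.+1%:R ->
    X n ((t, x), w) = \sum_(z <- points N T w) psi z.2 *
      \sum_(i < j) Q ((j - i.+1)%N%:R / n.+1%:R) *
        ((z.1 <= i.+1%:R / n.+1%:R)%R%:R - (z.1 <= i%:R / n.+1%:R)%R%:R).
  move=> /andP[jt tj].
  have jJ : (j < J n)%N.
    rewrite ltnS -ltnS -(ltr_nat R) (le_lt_trans _ (truncnS_gt _))//.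
    by rewrite -ler_pdivrMr// (le_trans (ltW jt)).
  have E (k : 'I_(J n)) : ((Xi n k \o snd) \_ (strip (k%:R / n.+1%:R) (k.+1%:R / n.+1%:R))) ((t, x), w) =
      if k == Ordinal jJ then Xi n j w else 0.
    rewrite -val_eqE/=; case: ltngtP => [kj|jk|->]; last first.
    - rewrite /patch mem_set//; split=> //; split=> //=.
      by rewrite in_itv/= jt.
    - rewrite /patch memNset// => -[[/= + _] _]; rewrite in_itv/= => /andP[kt _].
      have := lt_le_trans kt tj; rewrite ltr_pM2r ?invr_gt0// ltr_nat ltnS.
      by rewrite leqNgt jk.
    - rewrite /patch memNset// => -[[/= + _] _]; rewrite in_itv/= => /andP[_ tk].
      have := lt_le_trans jt tk; rewrite ltr_pM2r ?invr_gt0// ltr_nat ltnS.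
      by rewrite leqNgt kj.
  rewrite /X (eq_bigr _ (fun k _ => E k)) -big_mkcond big_pred1_eq /Xi.
  under [RHS]eq_bigr do rewrite mulr_sumr.
  rewrite exchange_big/=; apply: eq_bigr => i _.
  have iT : i.+1%:R / n.+1%:R <= T.
    rewrite (le_trans _ tT)// (le_trans _ (ltW jt))// ler_pM2r ?invr_gt0// ler_nat//.
  have iT' : i%:R / n.+1%:R <= T.
    by rewrite (le_trans _ iT)// ler_pM2r ?invr_gt0// ler_nat.
  rewrite !(point_sum_points _ _ iT) (point_sum_points _ _ iT') -sumrB mulr_sumr.
  by apply: eq_bigr => z _; rewrite -mulrBr mulrCA.
have termcvg (z : R * R) : 0 < z.1 -> forall eps, 0 < eps -> \forall n \near \oo, forall j, j%:R / n.+1%:R < t <= j.+1%:R / n.+1%:R ->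
    `|Q (t - z.1) - \sum_(i < j) Q ((j - i.+1)%N%:R / n.+1%:R) *
        ((z.1 <= i.+1%:R / n.+1%:R)%R%:R - (z.1 <= i%:R / n.+1%:R)%R%:R)| < eps.
  move=> z0 eps eps0.
  (* An event at or after [t] lies in the cell of [t] or a later one; it is not counted by the
     approximation, and [Q] vanishes at [t - z.1]. *)
  have [tz|zt] := leP t z.1.
    apply: nearW => n j /andP[jt _]; have [i izi] := grid_index n z0.
    rewrite (grid_sum _ (fun k => Q ((j - k.+1)%N%:R / n.+1%:R)) izi) Q0 ?subr_le0// ifF ?subrr ?normr0//.
    apply/negP => ij; move: izi => /andP[_ zi].
    have := lt_le_trans jt (le_trans tz zi).
    by rewrite ltr_pM2r ?invr_gt0// ltr_nat ltnS leqNgt ij.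
  have v0 : 0 < t - z.1 by rewrite subr_gt0.
  have /cvgrPdist_lt/(_ eps eps0)[del /= del0 Hdel] := Qleft _ v0.
  (* The rounding error is below two meshes. Two meshes below [t - z.1] put the event in an earlier
     cell than [t]; two meshes below [del] give the estimate. *)
  have [K HK] : exists K : nat, forall n, (K <= n)%N -> 2 / n.+1%:R < Num.min del (t - z.1).
    exists (Num.truncn (2 / Num.min del (t - z.1))) => n Kn.
    have mm : 0 < Num.min del (t - z.1) by rewrite lt_min del0.
    rewrite ltr_pdivrMr// mulrC -ltr_pdivrMr//.
    by rewrite (lt_le_trans (truncnS_gt _))// ler_nat ltnS.
  exists K => // n /= /HK; rewrite lt_min => /andP[n_del n_v] j /andP[jt tj].
  have [i izi] := grid_index n z0; rewrite (grid_sum _ (fun k => Q ((j - k.+1)%N%:R / n.+1%:R)) izi).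
  have /andP[iz zi] := izi.
  have m1 : 0 < n.+1%:R^-1 :> R by rewrite invr_gt0.
  have Sk (k : nat) : k.+1%:R / n.+1%:R = k%:R / n.+1%:R + n.+1%:R^-1 :> R.
    by rewrite -natr1 mulrDl mul1r.
  have n2 : 2 / n.+1%:R = n.+1%:R^-1 + n.+1%:R^-1 :> R by rewrite mulrDl mul1r.
  have ij : (i < j)%N.
    rewrite ltnNge; apply/negP => ji.
    have : j%:R / n.+1%:R <= i%:R / n.+1%:R :> R by rewrite ler_pM2r ?invr_gt0// ler_nat.
    move: n_v tj iz m1; rewrite n2 Sk.
    move: n.+1%:R^-1 (j%:R / n.+1%:R) (i%:R / n.+1%:R) => c a b; lra.
  rewrite ij natrB// mulrBl.
  apply: Hdel => /=; move: tj zi iz jt n_del m1; rewrite n2 !Sk;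
    move: n.+1%:R^-1 (j%:R / n.+1%:R) (i%:R / n.+1%:R) => c a b; last by lra.
  by move=> *; rewrite ger0_norm; lra.
pose jn n := xchoose (grid_index n t0).
have jnP n : (jn n)%:R / n.+1%:R < t <= (jn n).+1%:R / n.+1%:R by exact: (xchooseP (grid_index n t0)).
under eq_fun do rewrite (Xsum _ _ (jnP _)).
apply: cvg_sum_seq => z /mem_points-/(_ ppN)[_ /andP[z0 _]].
apply: cvgM; first exact: cvg_cst.
apply/cvgrPdist_lt => eps eps0.
have [K _ HK] := termcvg z z0 eps eps0.
by exists K => // n /= Kn; exact: HK.
Qed.

Lemma history_sub t (E : set Omega) : history N t E -> measurable E.
Proof.
apply: smallest_sub; first exact: sigma_algebra_measurable.
move=> _ [s [A [U [st mA A01 mU ->]]]].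
by rewrite -[X in measurable X]setTI; exact: pp_measurable.
Qed.

Lemma history_measurable_measurable t (X : Omega -> R) :
  history_measurable N t X -> measurable_fun setT X.
Proof. by move=> mX _ U mU; apply: (@history_sub t); exact: mX. Qed.

(** The section of a generating rectangle at a fixed time and location is empty or an event of the
    history. This gives ordinary measurability of the compensator at a fixed time. *)
Lemma predictable_section (f : PT -> R) (u : R * R) : measurable_fun setT f ->
  measurable_fun setT (fun w : Omega => f (u, w)).
Proof.
move=> mf.
pose phi : Omega -> PT := pair u.
have mpair : measurable_fun setT phi.
  apply: (@measurability _ _ _ PT setT phi (predictable_rectangles N) erefl) => _ [D0 [G|G] <-].
    case: G => a [b [B [E [_ _ _ hE ->]]]].
    rewrite setTI; have [uB|uB] := pselect ((`]a, b]%classic `*` B) u).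
      rewrite (_ : _ @^-1` _ = E); first exact: history_sub hE.
      by apply/seteqP; split=> w //= -[].
    rewrite (_ : _ @^-1` _ = set0)//.
    by apply/seteqP; split=> w //= -[].
  case: G => B [E [_ _ hE ->]].
  rewrite setTI; have [uB|uB] := pselect (([set 0] `*` B) u).
    rewrite (_ : _ @^-1` _ = E); first exact: history_sub hE.
    by apply/seteqP; split=> w //= -[].
  rewrite (_ : _ @^-1` _ = set0)//.
  by apply/seteqP; split=> w //= -[].
exact: (measurableT_comp mf mpair).
Qed.

End Predictability.

(** * Exponential inequality *)

Section ExponentialInequality.
Context {d} {Omega : measurableType d} {R : realType}.
Variables (P : probability Omega R) (linf h : R -> R) (W : R -> R -> R).
Variable N : Omega -> set (R * R).
Local Notation mu := (@lebesgue_measure R).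
Hypothesis ppN : point_process N.
Hypothesis hC : has_conditional_intensity P N (intensity linf h W N).
Hypothesis linf0 : forall x, unit_itv x -> 0 <= linf x.
Hypothesis intlinf : mu.-integrable unit_itv (EFin \o linf).
Hypothesis mW : forall y, unit_itv y -> measurable_fun unit_itv (W ^~ y).
Variable CW : R.
Hypothesis WC : forall x y, unit_itv x -> unit_itv y -> 0 <= W x y <= CW.
Variables (k : R -> R) (K : R).
Hypothesis mk : measurable_fun setT k.
Hypothesis kK : forall v, 0 <= k v <= K.
Hypothesis k0 : forall v, v <= 0 -> k v = 0.
Hypothesis kh : forall v, 0 < v -> k v <= h v.
Variables (f psi : R -> R) (c M T : R).
Hypothesis mf : measurable_fun setT f.
Hypothesis f0 : forall y, 0 <= f y.
Hypothesis mpsi : measurable_fun setT psi.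
Hypothesis psiM : forall y, 0 <= psi y <= M.
(** Here [f] already contains the factor [theta]. The constant [c] and the function [psi] bound from
    below what the background and an event at [y] add to the intensity weighted by [g]. *)
Let g y := 1 - expR (- f y).
Hypothesis psi_le : forall y, unit_itv y ->
  psi y <= \int[mu]_(x in unit_itv) (g x * W x y).
Hypothesis c0 : 0 <= c.
Hypothesis c_le : c <= \int[mu]_(x in unit_itv) (g x * linf x).
Hypothesis Tpos : 0 < T.
Let T0 : 0 <= T := ltW Tpos.

Let compens (w : Omega) (t : R) := path_compensator k (points N T w) psi c t.
Let rate (w : Omega) (t : R) := path_rate k (points N T w) psi c t.

Let g01 y : 0 <= g y <= 1.
Proof. by rewrite subr_ge0 gerBl expR_ge0 andbT -expR0 ler_expR oppr_le0. Qed.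

Let mg : measurable_fun setT g.
Proof. by apply: measurable_funB => //; apply: measurableT_comp => //; exact: measurableT_comp. Qed.

Let munit : measurable (unit_itv : set R).
Proof. exact: measurable_itv. Qed.

Let pointsT w z : z \in points N T w -> [/\ N w z, 0 < z.1 <= T & unit_itv z.2].
Proof. by move=> /mem_points-/(_ ppN)[Nz z1]; split=> //; have [] := pp_sub ppN Nz. Qed.

(** The finitely many events in []0, t[] give a subsum of the intensity, and [k <= h] lowers each of
    its terms. *)
Let intensity_lower t x w : 0 < t <= T -> unit_itv x ->
  ((linf x + \sum_(z <- points N T w) W x z.2 * k (t - z.1))%:E <=
   intensity linf h W N t x w)%E.
Proof.
move=> /andP[t0 tT] ux; rewrite /intensity EFinD leeD2l//; apply: esum_ge.
pose X := [set z | z \in points N T w] `&` [set z | z.1 < t].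
have finX : finite_set X.
  apply: sub_finite_set (finite_points ppN T w) => z [/= zp _].
  by have [Nz zT uz] := pointsT zp; split=> //; split; rewrite //= in_itv.
exists X; first by split=> // z [/= /pointsT[Nz _ _] zt].
rewrite fsbig_finite//= sumEFin lee_fin.
have -> : \sum_(z <- points N T w) W x z.2 * k (t - z.1) =
    \sum_(z <- points N T w | z.1 < t) W x z.2 * k (t - z.1).
  rewrite [RHS]big_mkcond; apply: eq_bigr => z _; case: ltP => // tz.
  by rewrite k0 ?mulr0// subr_le0.
have -> : \sum_(z <- points N T w | z.1 < t) W x z.2 * k (t - z.1) =
    \sum_(z <- fset_set X) W x z.2 * k (t - z.1).
  rewrite -big_filter; apply/perm_big/uniq_perm; rewrite ?filter_uniq ?fset_uniq// => z.
  rewrite mem_filter (in_fset_set finX); apply/idP/idP.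
    by move=> /andP[zt zp]; apply/mem_set.
  by move=> /set_mem[/= -> ->].
rewrite big_seq [leRHS]big_seq; apply: ler_sum => z.
rewrite (in_fset_set finX) => /set_mem[/= /pointsT[Nz zT uz] zt].
by rewrite ler_wpM2l ?kh ?subr_gt0//; case/andP: (WC ux uz).
Qed.

Let predictable_compens :
  measurable_fun (strip 0 T : set (g_sigma_algebraType (predictable_rectangles N)))
    (fun u : g_sigma_algebraType (predictable_rectangles N) => compens u.2 u.1.1).
Proof.
have T00 : (0 : R) <= 0 <= T by apply/andP.
apply: measurable_funD.
  by apply: measurable_funM => //; exact: predictable_time.
apply: (predictable_point_sum ppN T0 mpsi).
- by move=> y; case/andP: (psiM y).
- by move=> v; exact: primitive_le0.
- move=> v v0; apply: cvg_at_left_filter.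
  exact: (primitive_continuous mk kK).
Qed.

Let measurable_compens : measurable_fun setT (compens ^~ T).
Proof.
have T00 : (0 : R) <= 0 <= T by apply/andP.
have /(measurable_restrictT _ _).1 := predictable_compens.
move=> /(_ (predictable_strip T00)) /(predictable_section ppN (T, 0)).
apply: eq_measurable_fun => w _ /=.
rewrite patchE mem_set//; split=> //; split; rewrite /unit_itv/= in_itv/=.
  by rewrite Tpos/=.
by rewrite lexx ler01.
Qed.

Let prod_jump w : \prod_(z <- points N T w) (1 - g z.2) = expR (- point_sum N T f w).
Proof.
rewrite /point_sum -sumrN expR_sum; apply: eq_bigr => z _.
by rewrite /g subKr.
Qed.

Section FixedScale.
Variable e : R.
Hypothesis e0 : 0 < e.

Let past w t := prod_before (points N T w) (fun z => 1 - g z.2) t.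

(** The drop of [bexp e (compens w t) * past w t] caused by an event at [(t, x)]. It is computed
    from the events before [t], hence predictable. *)
Let integrand (u : (R * R) * Omega) : \bar R :=
  ((EFin \o (fun u : (R * R) * Omega => bexp e (compens u.2 u.1.1) * past u.2 u.1.1 * g u.1.2))
   \_ (strip 0 T)) u.

(** Brings the product to the form of [predictable_point_sum], with [Q] the indicator of the
    positive reals. *)
Let past_expR w t : past w t =
  expR (- \sum_(z <- points N T w) f z.2 * (0 < t - z.1)%R%:R).
Proof.
rewrite /past /prod_before -sumrN expR_sum big_mkcond; apply: eq_bigr => z _.
rewrite subr_gt0 /g; case: ifP => _; last by rewrite mulr0 oppr0 expR0.
by rewrite mulr1 subKr.
Qed.

Let predictable_integrand : predictable N integrand.
Proof.
have T00 : (0 : R) <= 0 <= T by apply/andP.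
apply/(measurable_restrictT _ _).1; first exact: (predictable_strip (N := N)).
apply/measurable_EFinP; apply: measurable_funM; first apply: measurable_funM.
- apply: measurableT_comp; first by apply: continuous_measurable_fun; exact: continuous_bexp.
  exact: predictable_compens.
- under eq_fun do rewrite past_expR.
  apply: measurableT_comp => //; apply: measurableT_comp => //.
  apply: (predictable_point_sum (Q := fun v => (0 < v)%R%:R) ppN T0 mf f0).
    by move=> v v0; rewrite ltNge v0.
  move=> v v0; apply: cvg_near_cst.
  near=> x; have -> : 0 < x by near: x; exact: nbhs_left_gt.
  by rewrite v0.
- exact: predictable_location.
Unshelve. all: by end_near. Qed.


Let q01 y : 0 <= 1 - g y <= 1.
Proof. by have /andP[h1 h2] := g01 y; rewrite subr_ge0 h2 gerBl h1. Qed.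

Let past0 w t : 0 <= past w t.
Proof. by apply: prod_before_ge0 => z; case/andP: (q01 z.2). Qed.

Let g0 y : 0 <= g y.
Proof. by case/andP: (g01 y). Qed.

Let integrandE t x w : 0 < t <= T -> unit_itv x ->
  integrand ((t, x), w) = (bexp e (compens w t) * past w t * g x)%:E.
Proof.
by move=> tT ux; rewrite /integrand patchE mem_set//; split=> //; split; rewrite //= in_itv.
Qed.

Let integrand_ge0 u : (0 <= integrand u)%E.
Proof.
rewrite /integrand /patch; case: ifP => // _; rewrite /= lee_fin.
by rewrite !mulr_ge0//; apply/ltW/bexp_gt0.
Qed.

Let jump_sum w := \sum_(z <- points N T w) bexp e (compens w z.1) * past w z.1 * g z.2.

Let density w t := dbexp e (compens w t) * rate w t * past w t.
Let drift w := \int[mu]_(t in `[0, T]) density w t.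

Let esum_integrand w : \esum_(z in N w) integrand (z, w) = (jump_sum w)%:E.
Proof.
have finp := finite_points ppN T w.
transitivity (\esum_(z in N w `&` (`]0, T] `*` unit_itv)) (bexp e (compens w z.1) * past w z.1 * g z.2)%:E).
  rewrite esum_mkcondr; apply: eq_esum => -[t x] Nz.
  case: ifPn => [/set_mem[/= tT ux]|nz].
    by rewrite integrandE//; move: tT; rewrite in_itv.
  rewrite /integrand patchE memNset// => -[/= h1 _].
  by move/negP: nz; apply; apply/mem_set.
rewrite esum_fset//; last first.
  by move=> z _; rewrite lee_fin !mulr_ge0//; apply/ltW/bexp_gt0.
by rewrite fsbig_finite// sumEFin.
Qed.

Let path_facts w := (points_uniq_times ppN T w,
  fun z (zp : z \in points N T w) => let: And3 _ zT _ := pointsT zp in zT).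

Let int_rate w t : 0 < t <= T ->
  mu.-integrable unit_itv (EFin \o (fun x => g x * (linf x + \sum_(z <- points N T w) W x z.2 * k (t - z.1)))) /\
  rate w t <= \int[mu]_(x in unit_itv) (g x * (linf x + \sum_(z <- points N T w) W x z.2 * k (t - z.1))).
Proof.
move=> tT.
have intgl : mu.-integrable unit_itv (EFin \o (fun x => g x * linf x)).
  apply: le_integrable intlinf => //.
    apply/measurable_EFinP/measurable_funM; first exact: measurable_funTS.
    by have /measurable_int/measurable_EFinP := intlinf.
  move=> x ux; rewrite /= lee_fin normrM ler_piMl//.
  by rewrite ger0_norm; [case/andP: (g01 x)|exact: g0].
have intgW z : z \in points N T w -> mu.-integrable unit_itv (EFin \o (fun x => g x * W x z.2)).
  move=> /pointsT[_ _ uz]; apply: (@bounded_itv_integrable _ _ _ CW).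
    by apply: measurable_funM; [exact: measurable_funTS|exact: mW].
  move=> x x01; have /andP[W0 WCW] := WC x01 uz.
  rewrite normrM (ger0_norm W0) ger0_norm ?g0// -[leRHS]mul1r.
  by rewrite ler_pM//; case/andP: (g01 x).
have E : (fun x => g x * (linf x + \sum_(z <- points N T w) W x z.2 * k (t - z.1))) =
   fun x => g x * linf x + \sum_(z <- points N T w) k (t - z.1) * (g x * W x z.2).
  apply/funext => x; rewrite mulrDr; congr (_ + _).
  by rewrite mulr_sumr; apply: eq_bigr => z _; ring.
have intkgW z : z \in points N T w -> mu.-integrable unit_itv (EFin \o (fun x => k (t - z.1) * (g x * W x z.2))).
  by move=> zp; apply: integrableZl_EFin => //; exact: intgW.
have intS : mu.-integrable unit_itv (EFin \o
    (fun x => \sum_(z <- points N T w) k (t - z.1) * (g x * W x z.2))).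
  exact: integrable_sum_EFin.
rewrite E; split.
  exact: integrableD_EFin.
rewrite RintegralD// Rintegral_sum// lerD//.
rewrite big_seq [leRHS]big_seq; apply: ler_sum => z zp.
have /andP[kz0 _] := kK (t - z.1).
rewrite RintegralZl//; last exact: intgW.
by rewrite mulrC ler_wpM2l// psi_le//; have [] := pointsT zp.
Qed.

(** Three inequalities are combined: [dbexp <= bexp], the rate is at most the truncated intensity
    integrated against [g], and truncation lowers the intensity. *)
Let drift_le w : ((drift w)%:E <= \int[mu]_(t in Rplus) \int[mu]_(x in unit_itv)
  (integrand ((t, x), w) * intensity linf h W N t x w))%E.
Proof.
have [ul lT] := path_facts w.
have dint := path_density_integrable mk kK k0 lT c0 psiM g01 T0 e0.
have rate0 t : 0 <= rate w t by case/andP: (path_rate_bounded kK (points N T w) c0 psiM t).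
have dens0 t : 0 <= density w t.
  by rewrite /density; apply: mulr_ge0 => //; apply: mulr_ge0 => //; exact: dbexp_ge0.
pose I : set R := `]0, T]%classic.
have -> : (drift w)%:E = (\int[mu]_(t in Rplus) ((EFin \o density w) \_ I) t)%E.
  rewrite -integral_mkcondr (_ : Rplus `&` I = I); last first.
    apply/seteqP; split=> t; rewrite /Rplus/I/= !in_itv/=; first by case.
    by move=> /[dup] tT /andP[/ltW -> _].
  have dint' : mu.-integrable `]0, T] (EFin \o density w).
    by apply: integrableS dint => //; apply: subset_itvr; rewrite bnd_simp.
  rewrite /drift -Rintegral_itv_obnd_cbnd// /Rintegral fineK//.
  exact: integrable_fin_num dint'.
apply: ge0_le_integral_nonmeasurable => t t0.
  by rewrite /patch; case: ifP => // _; rewrite /= lee_fin.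
rewrite patchE; case: ifPn => [/set_mem|nt]; last first.
  apply: integral_ge0 => x ux; rewrite /integrand patchE memNset ?mul0e// => -[[/= h1 _] _].
  by move/negP: nt; apply; apply/mem_set.
rewrite /I/= in_itv/= => tT.
have [intg rate_le] := int_rate w tT.
have AY0 : 0 <= bexp e (compens w t) * past w t by rewrite mulr_ge0//; apply/ltW/bexp_gt0.
apply: (@le_trans _ _ (\int[mu]_(x in unit_itv) (bexp e (compens w t) * past w t *
   (g x * (linf x + \sum_(z <- points N T w) W x z.2 * k (t - z.1))))%:E)%E).
  rewrite -[leRHS]fineK; last by apply: integrable_fin_num => //; exact: integrableZl_EFin.
  rewrite lee_fin -[leRHS]/(Rintegral mu unit_itv (fun x => bexp e (compens w t) * past w t *
     (g x * (linf x + \sum_(z <- points N T w) W x z.2 * k (t - z.1))))) RintegralZl//.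
  apply: (@le_trans _ _ (bexp e (compens w t) * past w t * rate w t)).
    rewrite /density mulrAC ler_wpM2r// ler_wpM2r//; exact: dbexp_le_bexp.
  by rewrite ler_wpM2l.
apply: ge0_le_integral_nonmeasurable => x ux.
  rewrite lee_fin mulr_ge0// mulr_ge0// addr_ge0 ?linf0//.
  rewrite big_seq sumr_ge0// => z /pointsT[_ _ uz]; rewrite mulr_ge0//.
    by case/andP: (WC ux uz).
  by case/andP: (kK (t - z.1)).
rewrite integrandE// mulrA EFinM lee_wpmul2l//; last exact: intensity_lower.
by rewrite lee_fin mulr_ge0.
Qed.

Let measurable_jump_product :
  measurable_fun setT (fun w => bexp e (compens w T) * \prod_(z <- points N T w) (1 - g z.2)).
Proof.
apply: measurable_funM.
  by apply: measurableT_comp; [apply: continuous_measurable_fun; exact: continuous_bexp|exact: measurable_compens].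
under eq_fun do rewrite prod_jump.
apply: measurableT_comp => //; apply: measurableT_comp => //.
apply: (history_measurable_measurable ppN (t := T)).
by apply: history_measurable_point_sum => //; rewrite T0 lexx.
Qed.

Lemma bexp_expectation_le1 :
  (\int[P]_w (bexp e (compens w T) * \prod_(z <- points N T w) (1 - g z.2))%:E <= 1)%E.
Proof.
apply: (@le_trans _ _ (bexp e 0)%:E); last by rewrite lee_fin bexp0_le1.
apply: (@integral_balance _ _ _ P jump_sum drift _ (bexp e 0) e^-1).
- move=> w; apply: sumr_ge0 => z _.
  by rewrite !mulr_ge0//; apply/ltW/bexp_gt0.
- move=> w; have [ul lT] := path_facts w.
  exact: (path_density_bounded mk kK k0 lT c0 psiM g01 T0 e0).
- move=> w; rewrite mulr_ge0//; first exact/ltW/bexp_gt0.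
  by rewrite prodr_ge0// => z _; case/andP: (q01 z.2).
- exact/ltW/bexp_gt0.
- exact: measurable_jump_product.
- move=> w; have [ul lT] := path_facts w.
  exact: (path_identity mk kK k0 ul lT c0 psiM g01 T0 e0).
- have -> : (\int[P]_w (jump_sum w)%:E = \int[P]_w \esum_(z in N w) integrand (z, w))%E.
    by apply: eq_integral => w _; rewrite esum_integrand.
  rewrite (hC predictable_integrand integrand_ge0).
  apply: ge0_le_integral_nonmeasurable => w _; last exact: drift_le.
  have [ul lT] := path_facts w; rewrite lee_fin.
  by case/andP: (path_density_bounded mk kK k0 lT c0 psiM g01 T0 e0).
Qed.

End FixedScale.

Lemma measurable_exponent : measurable_fun setT (fun w => compens w T - point_sum N T f w).
Proof.
apply: measurable_funB; first exact: measurable_compens.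
apply: (history_measurable_measurable ppN (t := T)).
by apply: history_measurable_point_sum => //; rewrite T0 lexx.
Qed.

Lemma exponential_inequality :
  (\int[P]_w (expR (compens w T - point_sum N T f w))%:E <= 1)%E.
Proof.
pose e n : R := n.+1%:R^-1.
have e0 n : 0 < e n by rewrite invr_gt0.
pose Z n w := (bexp (e n) (compens w T) * expR (- point_sum N T f w))%:E.
have mZ n : measurable_fun setT (Z n).
  apply/measurable_EFinP; apply: measurable_funM.
    by apply: measurableT_comp; [apply: continuous_measurable_fun; exact: continuous_bexp|exact: measurable_compens].
  apply: measurableT_comp => //; apply: measurableT_comp => //.
  apply: (history_measurable_measurable ppN (t := T)).
  by apply: history_measurable_point_sum => //; rewrite T0 lexx.
have Z0 n w : setT w -> (0 <= Z n w)%E.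
  by move=> _; rewrite lee_fin mulr_ge0 ?expR_ge0//; exact/ltW/bexp_gt0.
have ndZ w : setT w -> nondecreasing_seq (Z ^~ w).
  move=> _ m n mn; rewrite lee_fin ler_wpM2r ?expR_ge0//.
  rewrite lef_pV2 ?posrE ?addr_gt0 ?expR_gt0// lerD2l lef_pV2 ?posrE//.
  by rewrite ler_nat.
have Zlim w : Z n w @[n --> \oo] --> (expR (compens w T - point_sum N T f w))%:E.
  rewrite expRD; apply: cvg_EFin; first exact: nearW.
  by apply: cvgM; [exact: cvg_bexp|exact: cvg_cst].
rewrite (_ : (fun w => _) = (fun w => limn (Z ^~ w))); last first.
  by apply/funext => w; apply/esym/cvg_lim => //; exact: Zlim.
rewrite (monotone_convergence P measurableT mZ Z0 ndZ).
apply: lime_le.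
  apply: ereal_nondecreasing_is_cvgn => m n mn.
  by apply: ge0_le_integral_nonmeasurable => w _; [exact: Z0|exact: ndZ].
apply: nearW => n; apply: le_trans (bexp_expectation_le1 (e0 n)).
by apply: ge0_le_integral_nonmeasurable => w _; [exact: Z0|rewrite /Z prod_jump].
Qed.

End ExponentialInequality.

Lemma geometric_nneseries_lty (R : realType) (r : R) : 0 <= r < 1 ->
  (\sum_(n <oo) (r ^+ n.+1)%:E < +oo)%E.
Proof.
move=> /andP[r0 r1].
have cv : cvgn (series (geometric 1 r)).
  by apply: is_cvg_geometric_series; rewrite ger0_norm.
apply: (@le_lt_trans _ _ (limn (series (geometric 1 r)))%:E); last exact: ltry.
apply: lime_le.
  by apply: is_cvg_nneseries => n _ _; rewrite lee_fin exprn_ge0.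
apply: nearW => n; rewrite sumEFin lee_fin.
apply: (@le_trans _ _ (series (geometric 1 r) n)).
  rewrite /series/= ; apply: ler_sum => i _.
  by rewrite mul1r exprS ler_piMl ?exprn_ge0// ltW.
apply: nondecreasing_cvgn_le => //; apply/nondecreasing_seqP => m.
by rewrite /series/= big_nat_recr//= lerDl mul1r exprn_ge0.
Qed.

Lemma markov_expR d (Omega : measurableType d) (R : realType)
    (P : probability Omega R) (X : Omega -> R) (a : R) :
  measurable_fun setT X -> (\int[P]_w (expR (X w))%:E <= 1)%E ->
  (P [set w | (a <= X w)%R] <= (expR (- a))%:E)%E.
Proof.
move=> mX EX; set F := [set w | _].
have mF : measurable F.
  rewrite (_ : F = X @^-1` `[a, +oo[); first by rewrite -[X in measurable X]setTI; exact: mX.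
  by apply/seteqP; split=> w; rewrite /F /= in_itv/= andbT.
have h : ((expR a)%:E * P F <= 1)%E.
  rewrite -integral_cst//; apply: le_trans EX.
  rewrite integral_mkcond; apply: ge0_le_integral_nonmeasurable => w _; rewrite /patch.
    by case: ifP => // _; rewrite lee_fin expR_ge0.
  by case: ifPn => [/set_mem Fw|_]; rewrite lee_fin ?ler_expR// expR_ge0.
move: h; have /fineK <- : P F \is a fin_num by apply: fin_num_measure.
by rewrite -EFinM !lee_fin mulrC -ler_pdivlMr ?expR_gt0// mul1r expRN.
Qed.

(** The exceptional events have probabilities at most [exp (- del (n + 1))], a summable sequence.
    They are indexed from time 1 because the exponential bound is available at positive times. *)
Lemma eventually_lt_linear d (Omega : measurableType d) (R : realType)
    (P : probability Omega R) (X : nat -> Omega -> R) (del : R) :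
  0 < del -> (forall n, measurable_fun setT (X n.+1)) ->
  (forall n, (\int[P]_w (expR (X n.+1 w))%:E <= 1)%E) ->
  {ae P, forall w, \forall n \near \oo, X n w < del * n%:R}.
Proof.
move=> del0 mX EX.
pose F n := [set w | del * n.+1%:R <= X n.+1 w].
have mF n : measurable (F n).
  rewrite (_ : F n = X n.+1 @^-1` `[del * n.+1%:R, +oo[).
    by rewrite -[X in measurable X]setTI; exact: mX.
  by apply/seteqP; split=> w; rewrite /F /= in_itv/= andbT.
have : P (lim_sup_set F) = 0.
  apply: lim_sup_set_cvg0 => //.
  apply: le_lt_trans (@geometric_nneseries_lty R (expR (- del)) _); last first.
    by rewrite expR_ge0/= -expR0 ltr_expR oppr_lt0.
  apply: lee_nneseries => // n _.
  apply: le_trans (markov_expR _ (mX n) (EX n)) _.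
  by rewrite lee_fin -expRM_natl mulrN mulrC.
move=> PF; exists (lim_sup_set F); split=> //.
  by apply: bigcap_measurable => // n _; exact: bigcup_measurable.
move=> w /= nw n _; apply: contrapT => nF; apply: nw.
exists n.+1 => //= -[//|m] /= nm; rewrite ltNge; apply/negP => Fm.
by apply: nF; exists m.
Qed.

(** From [1 + x <= exp x] one gets [exp (- x) <= 1 / (1 + x) <= 1 - x + x^2], and [x^2 <= x B]. *)
Lemma expR_deficit (R : realType) (x B : R) : 0 <= x <= B -> x * (1 - B) <= 1 - expR (- x).
Proof.
move=> /andP[x0 xB].
have h : expR (- x) * (1 + x) <= 1.
  by rewrite -[leRHS](expRxMexpNx_1 x) mulrC ler_wpM2r ?expR_ge0// expR_ge1Dx.
have e0 := expR_ge0 (- x).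
have h2 : expR (- x) <= 1 - x + x ^+ 2.
  have x10 : 0 < 1 + x by rewrite ltr_pwDl.
  rewrite -(ler_pM2r x10) (le_trans h)//.
  have -> : (1 - x + x ^+ 2) * (1 + x) = 1 + x ^+ 3 by ring.
  by rewrite lerDl exprn_ge0.
have : x * x <= x * B by rewrite ler_wpM2l.
move: h2; rewrite expr2 mulrBr mulr1; lra.
Qed.

(** * Almost sure lower growth rates *)

Section KernelOperator.
Context {R : realType}.
Local Notation mu := (@lebesgue_measure R).
Variables (W : R -> R -> R) (CW : R).
Hypothesis mW : measurable_fun (unit_itv `*` unit_itv) (fun p : R * R => W p.1 p.2).
Hypothesis WC : forall x y, unit_itv x -> unit_itv y -> 0 <= W x y <= CW.

(** Extended by 0 outside [[0, 1]], so that measurability and bounds hold on the whole line and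
    survive iteration. *)
Definition kernel_op (f : R -> R) : R -> R :=
  (fun x => \int[mu]_(y in unit_itv) (W x y * f y)) \_ unit_itv.

Lemma measurable_unit_itv : measurable (unit_itv : set R).
Proof. exact: measurable_itv. Qed.
Let munit := measurable_unit_itv.

Lemma Rintegral_unit_itv_cst (a : R) : \int[mu]_(y in unit_itv) a = a.
Proof.
rewrite Rintegral_cst// /unit_itv [X in fine X]lebesgue_measure_itv/= lte_fin ltr01.
by rewrite oppr0 addr0 mulr1.
Qed.

Lemma measurable_kernel_section x : unit_itv x -> measurable_fun unit_itv (W x).
Proof.
move=> ux.
have /(measurable_restrictT _ (measurableX measurable_unit_itv measurable_unit_itv)).1 mW' := mW.
have := measurableT_comp mW' (@pair1_measurable _ _ R R x).
move=> /(@measurable_funTS _ _ _ _ unit_itv); apply: eq_measurable_fun => y /set_mem uy /=.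
by rewrite patchE mem_set.
Qed.

(** Tonelli, for the integrand extended by 0 to the plane. *)
Lemma measurable_kernel_op (f : R -> R) : measurable_fun unit_itv f ->
  (forall y, unit_itv y -> 0 <= f y) -> measurable_fun setT (kernel_op f).
Proof.
move=> mf f0.
pose F (p : R * R) := ((EFin \o (fun p : R * R => W p.1 p.2 * f p.2)) \_ (unit_itv `*` unit_itv)) p.
have mF : measurable_fun setT F.
  have mS : measurable (unit_itv `*` unit_itv : set (R * R)) by exact: measurableX.
  suff h : measurable_fun (unit_itv `*` unit_itv) (EFin \o (fun p : R * R => W p.1 p.2 * f p.2)).
    exact: (measurable_restrictT _ mS).1 h.
  apply/measurable_EFinP; apply: measurable_funM => //.
  have /(measurable_restrictT _ measurable_unit_itv).1 mf' := mf.
  have := measurableT_comp mf' (@measurable_snd _ _ R R).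
  move=> /(@measurable_funTS _ _ _ _ (unit_itv `*` unit_itv)); apply: eq_measurable_fun => p /set_mem[_ up] /=.
  by rewrite patchE mem_set.
have F0 p : (0 <= F p)%E.
  rewrite /F /patch; case: ifPn => // /set_mem[u1 u2] /=; rewrite lee_fin mulr_ge0 ?f0//.
  by case/andP: (WC u1 u2).
have := measurable_fun_fubini_tonelli_F (m2 := mu) F mF F0.
move=> /(measurableT_comp (@fine_measurable R setT measurableT)).
apply: eq_measurable_fun => x _; rewrite /kernel_op /= /fubini_F.
have [ux|ux] := pselect (unit_itv x).
  rewrite patchE mem_set// /Rintegral; congr fine; rewrite [RHS]integral_mkcond.
  apply: eq_integral => y _; rewrite /F !patchE.
  by have [uy|uy] := pselect (unit_itv y); [rewrite !mem_set|rewrite !memNset// => -[]].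
rewrite patchE memNset// integral0_eq// => y _.
by rewrite /F patchE memNset// => -[].
Qed.

Definition nneg_bounded (f : R -> R) (B : R) : Prop :=
  measurable_fun setT f /\ forall y, 0 <= f y <= B.

Lemma integrable_kernel_section (f : R -> R) (x : R) : mu.-integrable unit_itv (EFin \o f) -> unit_itv x ->
  mu.-integrable unit_itv (EFin \o (fun y => W x y * f y)).
Proof.
move=> intf ux.
have h : mu.-integrable unit_itv (EFin \o (fun y => CW * f y)).
  by apply: integrableZl_EFin.
apply: le_integrable h => //.
  apply/measurable_EFinP; apply: measurable_funM; first exact: measurable_kernel_section.
  by have /measurable_int/measurable_EFinP := intf.
move=> y uy; have /andP[W0 WCW] := WC ux uy.
by rewrite /= lee_fin !normrM ler_wpM2r// !ger0_norm// (le_trans W0).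
Qed.

Lemma nneg_bounded_integrable f B : nneg_bounded f B -> mu.-integrable unit_itv (EFin \o f).
Proof.
move=> [mf fB]; apply: (@bounded_itv_integrable _ _ _ B); first exact: measurable_funTS.
by move=> x _; have /andP[f0 fBx] := fB x; rewrite ger0_norm.
Qed.

Lemma kernel_op_nneg_bounded f B : nneg_bounded f B -> nneg_bounded (kernel_op f) (CW * B).
Proof.
move=> fB; have [mf fB'] := fB; split.
  apply: measurable_kernel_op; first exact: measurable_funTS.
  by move=> y _; case/andP: (fB' y).
have u0 : unit_itv (0 : R) by rewrite /unit_itv/= in_itv/= lexx ler01.
have CW0 : 0 <= CW by have /andP[/le_trans h /h] := WC u0 u0.
have B0 : 0 <= B by have /andP[/le_trans h /h] := fB' 0.
move=> x; rewrite /kernel_op patchE; case: ifPn => [/set_mem ux|_]; last first.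
  by rewrite lexx mulr_ge0.
have int0 y : unit_itv y -> 0 <= W x y * f y.
  by move=> uy; rewrite mulr_ge0//; [case/andP: (WC ux uy)|case/andP: (fB' y)].
rewrite Rintegral_ge0//=.
apply: (@le_trans _ _ (\int[mu]_(y in unit_itv) (CW * B))); last first.
  by rewrite Rintegral_unit_itv_cst.
apply: le_Rintegral => //.
- by apply: integrable_kernel_section => //; exact: nneg_bounded_integrable fB.
- by apply: (@bounded_itv_integrable _ _ _ `|CW * B|).
- move=> y uy; have /andP[? ?] := WC ux uy; have /andP[? ?] := fB' y.
  by rewrite ler_pM.
Qed.

End KernelOperator.

Lemma Rintegral_dominated_cvg d (T : measurableType d) (R : realType)
    (mu : {measure set T -> \bar R}) (D : set T) (f_ : nat -> T -> R) (f g : T -> R) :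
  measurable D -> (forall n, measurable_fun D (f_ n)) ->
  (forall x, D x -> f_ n x @[n --> \oo] --> f x) ->
  mu.-integrable D (EFin \o g) -> (forall n x, D x -> `|f_ n x| <= g x) ->
  mu.-integrable D (EFin \o f) /\
  \int[mu]_(x in D) f_ n x @[n --> \oo] --> \int[mu]_(x in D) f x.
Proof.
move=> mD mf_ f_f intg f_g.
have mf : measurable_fun D f by apply: measurable_fun_cvg f_f.
have := @dominated_convergence _ _ _ mu D mD (fun n => EFin \o f_ n) (EFin \o f) (EFin \o g).
case.
- by move=> n; apply/measurable_EFinP.
- exact/measurable_EFinP.
- apply/aeW => x Dx; apply: cvg_EFin; first exact: nearW.
  exact: f_f.
- by [].
- by apply/aeW => x n Dx; rewrite /= lee_fin f_g.
move=> intf _ cvgf; split=> //.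
rewrite /Rintegral; apply: fine_cvg; rewrite fineK//.
exact: integrable_fin_num intf.
Qed.

(** The functions [min(h, n + 1)] cut off to []0, n + 1]] converge to [h] under the majorant [h], so
    their masses converge to that of [h]. [L] is the right end of the support, beyond which the
    primitive keeps the full mass [eta]. *)
Lemma truncated_kernel (R : realType) (h : R -> R) (e : R) :
  (forall t, Rplus t -> 0 <= h t) ->
  (@lebesgue_measure R).-integrable Rplus (EFin \o h) -> 0 < e ->
  exists (k : R -> R) (K eta : R) (L : nat),
    [/\ measurable_fun setT k, forall v, 0 <= k v <= K,
        forall v, v <= 0 -> k v = 0, forall v, 0 < v -> k v <= h v &
    [/\ 0 <= eta, L1norm Rplus h - e <= eta, eta <= L1norm Rplus h &
        forall v, L%:R <= v -> eta <= primitive k v] ].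
Proof.
move=> h0 inth e0.
pose D0 : set R := `]0, +oo[%classic.
have D0R : D0 `<=` Rplus by apply: subset_itvr; rewrite bnd_simp.
have mh : measurable_fun Rplus h by have /measurable_int/measurable_EFinP := inth.
pose kn (n : nat) : R -> R := (fun v => Num.min (h v) n.+1%:R) \_ (`]0, n.+1%:R]%classic).
have sub n : `]0, n.+1%:R]%classic `<=` D0 by apply: subset_itvl.
have mkn n : measurable_fun setT (kn n).
  apply/(measurable_restrictT _ _).1 => //; apply: measurable_minr => //.
  by apply: measurable_funS mh => //; [exact: measurable_itv|exact: subset_trans (sub n) D0R].
have knK n v : 0 <= kn n v <= n.+1%:R.
  rewrite /kn patchE; case: ifPn => [/set_mem vn|_]; last by rewrite lexx ler0n.
  by rewrite le_min ge_min lexx orbT ler0n h0//; exact/D0R/(sub n).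
have kn0 n v : v <= 0 -> kn n v = 0.
  move=> v0; rewrite /kn patchE memNset//= in_itv/= => /andP[v1 _].
  by have := lt_le_trans v1 v0; rewrite ltxx.
have knh n v : 0 < v -> kn n v <= h v.
  move=> v0; rewrite /kn patchE; case: ifPn => _; first by rewrite ge_min lexx.
  by apply: h0; rewrite /Rplus/= in_itv/= ltW.
have inth0 : (@lebesgue_measure R).-integrable D0 (EFin \o h).
  by apply: integrableS inth => //; exact: measurable_itv.
have knlim v : D0 v -> kn n v @[n --> \oo] --> h v.
  rewrite /D0/= in_itv/= andbT => v0; apply: cvg_near_cst.
  exists (Num.truncn (Num.max v (h v))) => // n /= vn.
  have : Num.max v (h v) < n.+1%:R by rewrite (lt_le_trans (truncnS_gt _))// ler_nat.
  rewrite gt_max => /andP[vn' hn].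
  by rewrite /kn patchE mem_set ?min_l ?(ltW hn)//= in_itv/= v0 ltW.
have kn_le n v : D0 v -> `|kn n v| <= h v.
  rewrite /D0/= in_itv/= andbT => v0; have /andP[k0 _] := knK n v.
  by rewrite ger0_norm// knh.
have [|n|_ cvgk] := @Rintegral_dominated_cvg _ _ _ (@lebesgue_measure R) D0 kn h h _ _ knlim inth0 kn_le.
- exact: measurable_itv.
- by apply: measurable_funTS; exact: mkn.
have E n : \int[@lebesgue_measure R]_(v in D0) kn n v = primitive (kn n) n.+1%:R.
  rewrite /primitive /kn -!Rintegral_mkcondr; congr (Rintegral _ _ _).
  rewrite (setIidr (sub n)) setIidr//.
  by apply: subset_itvr; rewrite bnd_simp.
have Eh : \int[@lebesgue_measure R]_(v in D0) h v = L1norm Rplus h.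
  transitivity (\int[@lebesgue_measure R]_(v in Rplus) h v).
    by rewrite /D0 Rintegral_itv_obnd_cbnd//; exact: inth0.
  by apply: eq_Rintegral => v /set_mem/h0 hv; rewrite ger0_norm.
move: cvgk; rewrite Eh => /cvgrPdist_lt/(_ e e0)[n0 _ /(_ n0 (leqnn _)) /=].
rewrite E => close.
exists (kn n0), n0.+1%:R, (primitive (kn n0) n0.+1%:R), n0.+1; split=> //.
- exact: kn0.
- exact: knh.
split.
- by apply: (primitive_ge0 (K := n0.+1%:R)) => v; exact: knK.
- by rewrite lerBlDr addrC -lerBlDr; apply: le_trans (ler_norm _) (ltW close).
- rewrite -E -Eh; apply: le_Rintegral => //; first exact: measurable_itv.
    apply: le_integrable inth0 => //; first exact: measurable_itv.
      by apply/measurable_EFinP; apply: measurable_funTS; exact: mkn.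
    move=> v vD; rewrite /= lee_fin (le_trans (kn_le n0 v vD))//.
    exact: ler_norm.
  by move=> v vD; apply: le_trans (ler_norm _) (kn_le n0 v vD).
- move=> v nv; have /andP[+ _] := primitive_lipschitz (mkn n0) (knK n0) nv.
  by rewrite subr_ge0.
Qed.

(** * One step of the recursion for lower growth rates *)

Section LiminfStep.
Variable R : realType.
Implicit Types (x y : nat -> R).

(** The statement [liminf x n / n >= b], without division. *)
Definition asymptotically_above x (b : R) : Prop :=
  forall e, 0 < e -> \forall n \near \oo, (b - e) * n%:R <= x n.

(** Each bound loses a proportion [th * B] and an amount [th * n], so [th] has to shrink with the
    tolerance. The lag [L] costs at most [b * L], which is negligible against [n]. *)
Lemma asymptotically_above_recursion x y (c B eta b : R) :
  0 <= c -> 0 <= B -> 0 <= eta -> 0 <= b -> (forall n, 0 <= y n) ->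
  (forall e, 0 < e -> exists (th eta' : R) (L : nat),
     [/\ 0 < th <= e, th * B <= 1, eta - e <= eta', 0 <= eta' <= eta &
         \forall n \near \oo, (1 - th * B) * (c * n%:R + eta' * y (n - L)%N) - th * n%:R <= x n]) ->
  asymptotically_above y b -> asymptotically_above x (c + eta * b).
Proof.
move=> c0 B0 eta0 b0 y0 Hx Hy e e0.
pose S := c + eta * b.
have S0 : 0 <= S by rewrite addr_ge0// mulr_ge0.
(* e1 bounds the error on eta and theta, e2 the one on b *)
pose e1 := e / (4 * (B * S + 1 + b + 1)).
have BS0 : 0 <= B * S by rewrite mulr_ge0.
have D0 : 0 < 4 * (B * S + 1 + b + 1) by lra.
have e10 : 0 < e1 by rewrite divr_gt0.
have e1E : e1 * (4 * (B * S + 1 + b + 1)) = e by rewrite /e1 divfK// gt_eqF.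
have e1b : 0 <= e1 * b by rewrite mulr_ge0// ltW.
have e1BS : 0 <= e1 * (B * S) by rewrite mulr_ge0// ltW.
pose e2 := e / (8 * (eta + 1)).
have D20 : 0 < 8 * (eta + 1) by lra.
have e20 : 0 < e2 by rewrite divr_gt0.
have e2E : e2 * (8 * (eta + 1)) = e by rewrite /e2 divfK// gt_eqF.
have e2eta : 0 <= e2 * eta by rewrite mulr_ge0// ltW.
have [th [eta' [L [/andP[th0 the] thB etae /andP[eta'0 eta'eta] [n1 _ Hn1]]]]] := Hx e1 e10.
have [n2 _ Hn2] := Hy e2 e20.
pose n3 := (Num.truncn (b * L%:R / e2)).+1.
exists (maxn (maxn n1 (n2 + L)) n3) => // n /=.
rewrite !geq_max => /andP[/andP[n1n n2n] n3n].
apply: le_trans (Hn1 n n1n).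
have Ln : (L <= n)%N by rewrite (leq_trans _ n2n)// leq_addl.
have := Hn2 (n - L)%N; rewrite /= leq_subRL// addnC => /(_ n2n); rewrite natrB// => Hy2.
have bL : b * L%:R <= e2 * n%:R.
  rewrite mulrC [leRHS]mulrC mulrC -ler_pdivrMr//.
  by rewrite (le_trans (ltW (truncnS_gt _)))// ler_nat.
have n0 : 0 <= n%:R :> R by [].
have L0 : 0 <= L%:R :> R by [].
have yn : (b - 2 * e2) * n%:R <= y (n - L)%N.
  have ? : 0 <= e2 * L%:R by rewrite mulr_ge0// ltW.
  apply: le_trans Hy2; rewrite mulrBr !mulrBl; lra.
set v := y (n - L)%N in yn *.
have v0 : 0 <= v by exact: y0.
(* replace y by its truncation at b n, so that the loss caused by theta is linear in n *)
pose v' := Num.min v (b * n%:R).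
have v'v : v' <= v by rewrite ge_min lexx.
have v'b : v' <= b * n%:R by rewrite ge_min lexx orbT.
have v'0 : 0 <= v' by rewrite le_min v0 mulr_ge0.
have v'n : (b - 2 * e2) * n%:R <= v'.
  rewrite le_min yn ler_wpM2r//; lra.
have B1 : 0 <= 1 - th * B by rewrite subr_ge0.
apply: (@le_trans _ _ ((1 - th * B) * (c * n%:R + eta' * v') - th * n%:R)); last first.
  by rewrite lerD2r ler_wpM2l// lerD2l ler_wpM2l.
have X1 : c * n%:R + eta' * v' <= S * n%:R.
  rewrite /S mulrDl lerD2l -mulrA ler_pM//.
have X2 : (S - e1 * b - 2 * (e2 * eta)) * n%:R <= c * n%:R + eta' * v'.
  have h1 : eta' * ((b - 2 * e2) * n%:R) <= eta' * v' by rewrite ler_wpM2l.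
  have h2 : (eta - e1) * (b * n%:R) <= eta' * (b * n%:R) by rewrite ler_wpM2r ?mulr_ge0.
  have h3 : eta' * (e2 * n%:R) <= eta * (e2 * n%:R) by rewrite ler_wpM2r// mulr_ge0// ltW.
  rewrite /S; lra.
have X3 : th * B * (c * n%:R + eta' * v') <= e1 * (B * S) * n%:R.
  rewrite -(mulrA th) -(mulrA e1) -(mulrA B); apply: ler_pM => //; first exact: ltW.
    by rewrite mulr_ge0// addr_ge0// mulr_ge0.
  by rewrite ler_wpM2l.
have X4 : th * n%:R <= e1 * n%:R by rewrite ler_wpM2r.
(* By the choice of [e1] the three terms containing it sum to at most [e / 4], and by the choice of
   [e2] the remaining one is at most [e / 4]. *)
have ee : (e1 * b + 2 * (e2 * eta) + e1 * (B * S) + e1) * n%:R <= e * n%:R.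
  rewrite ler_wpM2r//; lra.
rewrite -/S; move: X2 X3 X4 ee; move: (c * n%:R + eta' * v') => X X2 X3 X4 ee.
rewrite (mulrBl X) mul1r (mulrBl n%:R S); lra.
Qed.

End LiminfStep.

(** * Growth rates of weighted event sums *)

Section Growth.
Context {d} {Omega : measurableType d} {R : realType}.
Variables (P : probability Omega R) (linf h : R -> R) (W : R -> R -> R).
Variable N : Omega -> set (R * R).
Local Notation mu := (@lebesgue_measure R).
Hypothesis ppN : point_process N.
Hypothesis hC : has_conditional_intensity P N (intensity linf h W N).
Hypothesis linf0 : forall x, unit_itv x -> 0 <= linf x.
Hypothesis intlinf : mu.-integrable unit_itv (EFin \o linf).
Variable CW : R.
Hypothesis mW : measurable_fun (unit_itv `*` unit_itv) (fun p : R * R => W p.1 p.2).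
Hypothesis WC : forall x y, unit_itv x -> unit_itv y -> 0 <= W x y <= CW.
Hypothesis Wsym : forall x y, unit_itv x -> unit_itv y -> W x y = W y x.
Hypothesis h0 : forall t, Rplus t -> 0 <= h t.
Hypothesis inth : mu.-integrable Rplus (EFin \o h).

Let munit : measurable (unit_itv : set R) := @measurable_unit_itv R.

Definition base_mass (f : R -> R) : R := \int[mu]_(x in unit_itv) (f x * linf x).

Lemma base_mass_integrable f B : nneg_bounded f B ->
  mu.-integrable unit_itv (EFin \o (fun x => f x * linf x)).
Proof.
move=> [mf fB].
have h1 : mu.-integrable unit_itv (EFin \o (fun x => B * linf x)).
  by apply: integrableZl_EFin => //.
apply: le_integrable h1 => //.
  apply/measurable_EFinP; apply: measurable_funM; first exact: measurable_funTS.
  by have /measurable_int/measurable_EFinP := intlinf.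
move=> x ux; have /andP[f0 fBx] := fB x.
by rewrite /= lee_fin !normrM ler_wpM2r// !ger0_norm// (le_trans f0).
Qed.

Lemma base_mass_ge0 f B : nneg_bounded f B -> 0 <= base_mass f.
Proof.
move=> [_ fB]; apply: Rintegral_ge0 => x ux.
by rewrite mulr_ge0 ?linf0//; case/andP: (fB x).
Qed.

(** The exponential inequality is applied to [th * f]. With [a = th * (1 - th * B)], [expR_deficit]
    puts [a * f] below [1 - exp (- th * f)], so [a] times the base mass and [a] times
    [kernel_op W f] are admissible as [c] and [psi]. *)
Lemma compensator_dominated (f : R -> R) (B th : R) (k : R -> R) (K eta : R) (L : nat) :
  nneg_bounded f B -> 0 < th -> th * B <= 1 ->
  measurable_fun setT k -> (forall v, 0 <= k v <= K) ->
  (forall v, v <= 0 -> k v = 0) -> (forall v, 0 < v -> k v <= h v) ->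
  0 <= eta -> (forall v, L%:R <= v -> eta <= primitive k v) ->
  {ae P, forall w, \forall n \near \oo,
    (1 - th * B) * (base_mass f * n%:R + eta * point_sum N (n - L)%N%:R (kernel_op W f) w)
      - th * n%:R <= point_sum N n%:R f w}.
Proof.
move=> fB th0 thB mk kK k0 kh eta0 etaL.
have [mf fB'] := fB.
have f0 y : 0 <= f y by case/andP: (fB' y).
have opB := kernel_op_nneg_bounded mW WC fB.
have [mop opB'] := opB.
have op0 y : 0 <= kernel_op W f y by case/andP: (opB' y).
have B1 : 0 <= 1 - th * B by rewrite subr_ge0.
have a0 : 0 <= th * (1 - th * B) by rewrite mulr_ge0// ltW.
pose a := th * (1 - th * B).
pose psi y := a * kernel_op W f y.
pose c := a * base_mass f.
pose thf y := th * f y.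
have mthf : measurable_fun setT thf by exact: measurable_funM.
have thf0 y : 0 <= thf y by rewrite mulr_ge0// ltW.
have mpsi : measurable_fun setT psi by exact: measurable_funM.
have psiM y : 0 <= psi y <= a * (CW * B).
  by have /andP[? ?] := opB' y; rewrite mulr_ge0//= ler_wpM2l.
have c0 : 0 <= c by rewrite mulr_ge0// (base_mass_ge0 fB).
have g_ge y : a * f y <= 1 - expR (- thf y).
  have -> : a * f y = thf y * (1 - th * B) by rewrite /a /thf mulrAC.
  by apply: expR_deficit; rewrite thf0 ler_wpM2l ?(ltW th0)//; case/andP: (fB' y).
have gB : nneg_bounded (fun y => 1 - expR (- thf y)) 1.
  split.
    by apply: measurable_funB => //; apply: measurableT_comp => //; exact: measurableT_comp.
  by move=> y; rewrite subr_ge0 gerBl expR_ge0 andbT -expR0 ler_expR oppr_le0.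
have mWs y : unit_itv y -> measurable_fun unit_itv (W ^~ y).
  move=> uy; have := measurable_kernel_section mW uy; apply: eq_measurable_fun => x /set_mem ux.
  exact: Wsym.
(* The exponential inequality integrates [W] in its first variable and the operator in its second;
   symmetry identifies the two. *)
have psi_le y : unit_itv y ->
    psi y <= \int[mu]_(x in unit_itv) ((1 - expR (- thf x)) * W x y).
  move=> uy; rewrite /psi /kernel_op patchE mem_set// -RintegralZl//; last first.
    exact: (integrable_kernel_section mW WC (nneg_bounded_integrable fB)).
  apply: le_Rintegral => //.
  - apply: integrableZl_EFin => //.
    exact: (integrable_kernel_section mW WC (nneg_bounded_integrable fB)).
  - have := integrable_kernel_section mW WC (nneg_bounded_integrable gB) uy.
    apply: eq_integrable => // x /set_mem ux.
    by rewrite /= mulrC Wsym.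
  - move=> x ux; rewrite Wsym// mulrCA mulrC ler_wpM2r//.
    by case/andP: (WC ux uy).
have c_le : c <= \int[mu]_(x in unit_itv) ((1 - expR (- thf x)) * linf x).
  rewrite /c /base_mass -RintegralZl//; last exact: base_mass_integrable fB.
  apply: le_Rintegral => //.
  - by apply: integrableZl_EFin => //; exact: base_mass_integrable fB.
  - exact: base_mass_integrable gB.
  - by move=> x ux; rewrite mulrA ler_wpM2r// linf0.
pose X n w := path_compensator k (points N n%:R w) psi c n%:R - point_sum N n%:R thf w.
have n0 n : 0 < n.+1%:R :> R by rewrite ltr0n.
have mX n : measurable_fun setT (X n.+1).
  exact: (measurable_exponent ppN mk kK c mthf thf0 mpsi psiM (n0 n)).
have EX n : (\int[P]_w (expR (X n.+1 w))%:E <= 1)%E.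
  exact: (exponential_inequality ppN hC linf0 intlinf mWs WC mk kK k0 kh mthf thf0 mpsi psiM psi_le c0 c_le (n0 n)).
(* The threshold [th^2 n] has a summable exponential and, after division by [th], costs only
   [th * n]. *)
have del0 : 0 < th ^+ 2 by rewrite exprn_gt0.
have := eventually_lt_linear del0 mX EX.
apply: filterS => w [n1 _ Hn1]; exists (maxn n1 L) => // n /=.
rewrite geq_max => /andP[n1n Ln].
have {Hn1} := Hn1 n n1n; rewrite /X => Xlt.
have sumE : point_sum N n%:R thf w = th * point_sum N n%:R f w.
  by rewrite /point_sum mulr_sumr.
(* Only the events up to time [n - L] are kept: each of them is at least [L] old at time [n], so its
   primitive has reached [eta]. *)
have compge : a * (base_mass f * n%:R + eta * point_sum N (n - L)%N%:R (kernel_op W f) w)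
    <= path_compensator k (points N n%:R w) psi c n%:R.
  rewrite mulrDr /path_compensator /c -mulrA lerD2l.
  have nLn : (n - L)%N%:R <= n%:R :> R by rewrite ler_nat leq_subr.
  rewrite (point_sum_points ppN _ _ nLn) !mulr_sumr; apply: ler_sum => z _.
  rewrite /psi -mulrA ler_wpM2l// mulrCA ler_wpM2l//.
  have [zL|zL] := leP z.1 (n - L)%N%:R; last by rewrite mulr0 (primitive_ge0 kK).
  rewrite mulr1 etaL//; move: zL; rewrite natrB//; lra.
move: Xlt; rewrite sumE => Xlt.
have : th * point_sum N n%:R f w > th * ((1 - th * B) * (base_mass f * n%:R + eta * point_sum N (n - L)%N%:R (kernel_op W f) w) - th * n%:R).
  rewrite mulrBr mulrA (mulrA th th) -expr2 -/a; move: Xlt compge; lra.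
by rewrite ltr_pM2l// => /ltW.
Qed.

Lemma iter_kernel_op_bounded f B j : nneg_bounded f B ->
  nneg_bounded (iter j (kernel_op W) f) (CW ^+ j * B).
Proof.
move=> fB; elim: j => [|j IH] /=; first by rewrite mul1r.
by rewrite exprS -mulrA; exact: (kernel_op_nneg_bounded mW WC).
Qed.

Lemma point_sum_ge0 f B T w : nneg_bounded f B -> 0 <= point_sum N T f w.
Proof. by move=> [_ fB]; apply: sumr_ge0 => z _; case/andP: (fB z.2). Qed.

(** The tolerances run through [1 / (i + 1)] and the levels through the integers, so one null set
    covers all one-step bounds. Off this set the recursion is deterministic. *)
Lemma asymptotic_growth f B : nneg_bounded f B ->
  {ae P, forall w, forall m : nat,
    asymptotically_above (fun n => point_sum N n%:R f w)
      (\sum_(j < m) L1norm Rplus h ^+ j * base_mass (iter j (kernel_op W) f))}.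
Proof.
move=> fB.
set H := L1norm Rplus h.
have H0 : 0 <= H by apply: Rintegral_ge0.
pose F j := iter j (kernel_op W) f.
pose b j := CW ^+ j * B.
have FB j : nneg_bounded (F j) (b j) by exact: iter_kernel_op_bounded.
have b0 j : 0 <= b j by have [_ /(_ 0)/andP[h1 /(le_trans h1)]] := FB j.
pose Step j i w := exists (th eta' : R) (L : nat),
     [/\ 0 < th <= i.+1%:R^-1, th * b j <= 1, H - i.+1%:R^-1 <= eta', 0 <= eta' <= H &
         \forall n \near \oo, (1 - th * b j) * (base_mass (F j) * n%:R +
            eta' * point_sum N (n - L)%N%:R (F j.+1) w) - th * n%:R <= point_sum N n%:R (F j) w].
have aeStep j i : {ae P, forall w, Step j i w}.
  have i0 : 0 < i.+1%:R^-1 :> R by rewrite invr_gt0.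
  have [k [K [eta [L [mk kK k0 kh [eta0 etae etaH etaL]]]]]] := truncated_kernel h0 inth i0.
  (* The second entry of the minimum forces [th * b j <= 1], as [compensator_dominated] requires. *)
  pose th := Num.min (i.+1%:R^-1 : R) (b j + 1)^-1.
  have bj1 : 0 < b j + 1 by rewrite ltr_wpDl.
  have th0 : 0 < th by rewrite lt_min i0 invr_gt0.
  have thb : th * b j <= 1.
    apply: (@le_trans _ _ ((b j + 1)^-1 * b j)).
      by rewrite ler_wpM2r// ge_min lexx orbT.
    by rewrite mulrC ler_pdivrMr// mul1r lerDl.
  have := compensator_dominated (FB j) th0 thb mk kK k0 kh eta0 etaL.
  apply: filterS => w Hw; exists th, eta, L; split=> //.
    by rewrite th0 ge_min lexx.
  by rewrite eta0.
have aeall : {ae P, forall w, forall j i, Step j i w}.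
  by apply: ae_foralln => j; apply: ae_foralln => i.
apply: filterS aeall => w Hw m.
(* Generalized over the starting level, because the rate at level [j] is derived from the rate at
   level [j + 1]. *)
suff : forall j, asymptotically_above (fun n => point_sum N n%:R (F j) w)
      (\sum_(l < m) H ^+ l * base_mass (F (j + l)%N)) by move=> /(_ 0%N).
elim: m => [|m IH] j.
  rewrite big_ord0 => e e0; apply: nearW => n.
  apply: le_trans (point_sum_ge0 _ _ (FB j)).
  by rewrite sub0r mulNr oppr_le0; apply: mulr_ge0 => //; exact: ltW.
rewrite big_ord_recl /= expr0 mul1r addn0.
rewrite (_ : \sum_(i < m) _ = H * \sum_(l < m) H ^+ l * base_mass (F (j.+1 + l)%N)); last first.
  by rewrite mulr_sumr; apply: eq_bigr => l _; rewrite /bump leq0n add1n exprS mulrA addSnnS.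
have mass0 l : 0 <= base_mass (F l) by exact: (base_mass_ge0 (FB l)).
apply: (@asymptotically_above_recursion _ _ (fun n => point_sum N n%:R (F j.+1) w) _ (b j)) => //.
- by apply: sumr_ge0 => l _; rewrite mulr_ge0// exprn_ge0.
- by move=> n; exact: (point_sum_ge0 _ _ (FB j.+1)).
move=> e e0; pose i := Num.truncn e^-1.
have ie : i.+1%:R^-1 <= e.
  by rewrite -[leRHS]invrK lef_pV2 ?posrE ?invr_gt0// ltW// truncnS_gt.
have [th [eta' [L [/andP[th0 thi] thb etae etaH Hn]]]] := Hw j i.
exists th, eta', L; split=> //.
- by rewrite th0 (le_trans thi).
- by rewrite (le_trans _ etae)// lerD2l lerN2.
Qed.

End Growth.

(** * The spectral radius *)

Section NeumannSeries.
Context {R : realType}.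
Local Notation mu := (@lebesgue_measure R).
Variables (W : R -> R -> R) (CW H : R).
Hypothesis mW : measurable_fun (unit_itv `*` unit_itv) (fun p : R * R => W p.1 p.2).
Hypothesis WC : forall x y, unit_itv x -> unit_itv y -> 0 <= W x y <= CW.
Hypothesis H0 : 0 <= H.

Let munit : measurable (unit_itv : set R) := @measurable_unit_itv R.
Local Notation integrable1 u := (mu.-integrable unit_itv (EFin \o u)).
Local Notation mass u := (\int[mu]_(y in unit_itv) u y).

(** When [H] is the norm of [h], this is [T_hom] on [[0, 1]], extended by 0. *)
Definition scaled_op (u : R -> R) : R -> R := fun x => H * kernel_op W u x.
Local Notation A := scaled_op.
Local Notation nneg u := (forall y, unit_itv y -> 0 <= u y).

Let CW0 : 0 <= CW.
Proof.
have u0 : unit_itv (0 : R) by rewrite /unit_itv/= in_itv/= lexx ler01.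
by have /andP[/le_trans h /h] := WC u0 u0.
Qed.

Let kernel_opE u x : unit_itv x -> kernel_op W u x = mass (fun y => W x y * u y).
Proof. by move=> ux; rewrite /kernel_op patchE mem_set. Qed.

Let intW u x : integrable1 u -> unit_itv x -> integrable1 (fun y => W x y * u y).
Proof. exact: (integrable_kernel_section mW WC). Qed.

Lemma scaled_op_lin a b (u v : R -> R) x : integrable1 u -> integrable1 v -> unit_itv x ->
  A (fun y => a * u y + b * v y) x = a * A u x + b * A v x.
Proof.
move=> iu iv ux; rewrite /scaled_op !kernel_opE//.
transitivity (H * \int[mu]_(y in unit_itv) (a * (W x y * u y) + b * (W x y * v y))).
  by congr (_ * _); apply: eq_Rintegral => y _; ring.
rewrite RintegralD//; try by apply: integrableZl_EFin => //; exact: intW.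
by rewrite !RintegralZl//; [ring|exact: intW|exact: intW].
Qed.

Lemma scaled_op_le (u v : R -> R) x : integrable1 u -> integrable1 v ->
  (forall y, unit_itv y -> u y <= v y) -> unit_itv x -> A u x <= A v x.
Proof.
move=> iu iv uv ux; rewrite /scaled_op !kernel_opE// ler_wpM2l//.
apply: le_Rintegral => //; [exact: intW|exact: intW|].
by move=> y uy; rewrite ler_wpM2l ?uv//; case/andP: (WC ux uy).
Qed.

Lemma scaled_op_ge0 (u : R -> R) x : (forall y, unit_itv y -> 0 <= u y) -> 0 <= A u x.
Proof.
move=> u0; rewrite mulr_ge0// /kernel_op patchE; case: ifPn => // /set_mem ux.
by apply: Rintegral_ge0 => y uy; rewrite mulr_ge0 ?u0//; case/andP: (WC ux uy).
Qed.

Lemma scaled_op_le_mass (u : R -> R) x : integrable1 u -> (forall y, unit_itv y -> 0 <= u y) ->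
  unit_itv x -> A u x <= H * CW * mass u.
Proof.
move=> iu u0 ux; rewrite /scaled_op kernel_opE// -mulrA ler_wpM2l// -RintegralZl//.
apply: le_Rintegral => //; [exact: intW|exact: integrableZl_EFin|].
by move=> y uy; rewrite ler_wpM2r ?u0//; case/andP: (WC ux uy).
Qed.

Lemma integrable_le (u v : R -> R) : measurable_fun unit_itv u -> integrable1 v ->
  (forall y, unit_itv y -> `|u y| <= v y) -> integrable1 u.
Proof.
move=> mu_ iv uv; apply: le_integrable iv => //; first exact/measurable_EFinP.
by move=> y uy; rewrite /= lee_fin (le_trans (uv y uy))// ler_norm.
Qed.

Let integrable_measurable u : integrable1 u -> measurable_fun unit_itv u.
Proof. by move=> iu; have /measurable_int/measurable_EFinP := iu. Qed.

Lemma measurable_scaled_op (u : R -> R) : integrable1 u -> measurable_fun unit_itv (A u).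
Proof.
move=> iu; have mu_ := integrable_measurable iu.
pose up (y : R) : R := Num.max (u y) 0; pose un (y : R) : R := Num.max (- u y) 0.
have mup : measurable_fun unit_itv up by exact: measurable_maxr.
have mun : measurable_fun unit_itv un by apply: measurable_maxr => //; exact: measurableT_comp.
have iau : integrable1 (fun y => `|u y|) by exact: integrable_norm iu.
have iup : integrable1 up.
  apply: (integrable_le mup iau) => y _.
  by rewrite ger0_norm ?le_max ?lexx ?orbT// ge_max ler_norm normr_ge0.
have iun : integrable1 un.
  apply: (integrable_le mun iau) => y _.
  by rewrite ger0_norm ?le_max ?lexx ?orbT// ge_max -normrN ler_norm normr_ge0.
have mA (v : R -> R) : measurable_fun unit_itv v -> (forall y, unit_itv y -> 0 <= v y) ->
    measurable_fun unit_itv (A v).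
  move=> mv v0; apply: measurable_funTS; apply: measurable_funM => //.
  exact: (measurable_kernel_op mW WC).
apply: (eq_measurable_fun (fun x : R => A up x - A un x : R)).
  move=> x /set_mem ux.
  have := scaled_op_lin 1 (-1) iup iun ux; rewrite mul1r mulN1r => <-.
  rewrite /scaled_op !kernel_opE//; congr (_ * _); apply: eq_Rintegral => y _.
  rewrite mul1r mulN1r /up /un; congr (_ * _).
  by case: (leP (u y) 0) => uy; case: (leP (- u y) 0) => uy'; lra.
by apply: measurable_funB; apply: mA => // y _; rewrite le_max lexx orbT.
Qed.

(** The pointwise modulus of [u + i v]. *)
Definition norm2 (u v : R -> R) : R -> R := fun y => Num.sqrt (u y ^+ 2 + v y ^+ 2).

Lemma norm2_ge0 u v y : 0 <= norm2 u v y.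
Proof. exact: sqrtr_ge0. Qed.

Lemma norm_le_norm2 u v y : `|u y| <= norm2 u v y /\ `|v y| <= norm2 u v y.
Proof.
by split; rewrite -sqrtr_sqr ler_wsqrtr// ?lerDl ?lerDr sqr_ge0.
Qed.

Lemma norm2_integrable (u v : R -> R) : integrable1 u -> integrable1 v -> integrable1 (norm2 u v).
Proof.
move=> iu iv.
have i2 : integrable1 (fun y => `|u y| + `|v y|).
  by apply: integrableD_EFin => //; exact: integrable_norm.
apply: (integrable_le _ i2).
  have msqrt : measurable_fun [set: R] (@Num.sqrt R).
    by apply: continuous_measurable_fun; exact: sqrt_continuous.
  have m2 : measurable_fun unit_itv (fun y => u y ^+ 2 + v y ^+ 2).
    by apply: measurable_funD; apply: measurable_funX; exact: integrable_measurable.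
  by apply: eq_measurable_fun (measurableT_comp msqrt m2).
move=> y _; rewrite ger0_norm ?norm2_ge0// -[leRHS]ger0_norm ?addr_ge0// -sqrtr_sqr ler_wsqrtr//.
rewrite sqrrD !real_normK ?num_real// addrAC lerDl mulrn_wge0// mulr_ge0//.
Qed.

(** Where the value of [A (u + i v)] at [x] is nonzero, a rotation makes it real and positive; it is
    then [A] of the real part of the rotated function, which lies below the modulus. The numbers
    [al] and [be] are the cosine and sine of the angle. *)
Lemma norm2_scaled_op (u v : R -> R) x : integrable1 u -> integrable1 v -> unit_itv x ->
  norm2 (A u) (A v) x <= A (norm2 u v) x.
Proof.
move=> iu iv ux; set n := norm2 _ _ x.
have n0 : 0 <= n by exact: norm2_ge0.
have [n_eq0|nneq0] := eqVneq n 0.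
  by rewrite n_eq0; apply: scaled_op_ge0 => y _; exact: norm2_ge0.
have npos : 0 < n by rewrite lt0r nneq0.
have nn : n ^+ 2 = A u x ^+ 2 + A v x ^+ 2 by rewrite sqr_sqrtr// addr_ge0// sqr_ge0.
pose al := A u x / n; pose be := A v x / n.
have alnn : al * n = A u x by rewrite divfK.
have benn : be * n = A v x by rewrite divfK.
have ab1 : al ^+ 2 + be ^+ 2 = 1.
  by rewrite !expr_div_n -mulrDl -nn divff// expf_neq0.
have -> : n = al * A u x + be * A v x.
  apply: (mulfI nneq0); rewrite -expr2 nn.
  rewrite (_ : n * _ = (al * n) * A u x + (be * n) * A v x); last by ring.
  by rewrite alnn benn.
rewrite -scaled_op_lin//; apply: scaled_op_le => //.
- by apply: integrableD_EFin => //; exact: integrableZl_EFin.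
- exact: norm2_integrable.
move=> y _; rewrite (le_trans (ler_norm _))// -sqrtr_sqr ler_wsqrtr//.
rewrite -[leRHS]mul1r -ab1 -subr_ge0.
have -> : (al ^+ 2 + be ^+ 2) * (u y ^+ 2 + v y ^+ 2) - (al * u y + be * v y) ^+ 2 =
   (al * v y - be * u y) ^+ 2 by ring.
exact: sqr_ge0.
Qed.

Let integrable_cst (c : R) : integrable1 (fun=> c).
Proof. by apply: (@bounded_itv_integrable _ _ _ `|c|). Qed.

Lemma integrable_scaled_op (u : R -> R) : integrable1 u -> integrable1 (A u).
Proof.
move=> iu; have iau : integrable1 (fun y => `|u y|) by exact: integrable_norm iu.
apply: (integrable_le (v := fun=> H * CW * mass (fun y => `|u y|))) => //.
  exact: (measurable_scaled_op iu).
move=> x ux; apply: le_trans (scaled_op_le_mass iau _ ux) => //.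
rewrite ler_norml; apply/andP; split; last first.
  by apply: (scaled_op_le) => // y _; exact: ler_norm.
have iN : integrable1 (fun y => -1 * `|u y|) by exact: integrableZl_EFin.
have := scaled_op_lin (-1) 0 iau (integrable_cst 0) ux.
rewrite (mul0r (A _ _)) addr0 mulN1r => <-.
apply: (scaled_op_le) => //.
  apply: integrableD_EFin => //; exact: (integrable_cst (0 * 0)).
by move=> y _; rewrite mul0r addr0 mulN1r lerNl -normrN ler_norm.
Qed.

Lemma integrable_iter_scaled_op (u : R -> R) n : integrable1 u -> integrable1 (iter n A u).
Proof. by move=> iu; elim: n => //= n; exact: integrable_scaled_op. Qed.

Lemma iter_scaled_op_ge0 (u : R -> R) n : nneg u -> nneg (iter n A u).
Proof. by move=> u0; elim: n => //= n IH y _; exact: (scaled_op_ge0). Qed.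

Lemma iter_scaled_op_le (u v : R -> R) n : integrable1 u -> integrable1 v ->
  (forall y, unit_itv y -> u y <= v y) ->
  forall y, unit_itv y -> iter n A u y <= iter n A v y.
Proof.
move=> iu iv uv; elim: n => //= n IH y uy.
by apply: (scaled_op_le) => //; exact: integrable_iter_scaled_op.
Qed.

Lemma iter_scaled_op_lin a b (u v : R -> R) n : integrable1 u -> integrable1 v ->
  forall x, unit_itv x ->
  iter n A (fun y => a * u y + b * v y) x = a * iter n A u x + b * iter n A v x.
Proof.
move=> iu iv; elim: n => //= n IH x ux.
rewrite -(scaled_op_lin a b)//; try exact: integrable_iter_scaled_op.
rewrite /scaled_op /kernel_op !patchE mem_set//; congr (_ * _).
by apply: eq_Rintegral => y /set_mem uy; rewrite IH.
Qed.

(** A bound for the norm of [A^(n+1)] from L1 to bounded functions. *)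
Let coef n := if n is n'.+1 then (H * CW) ^+ 2 * mass (iter n' A (fun=> 1)) else H * CW.

Let coef_ge0 n : 0 <= coef n.
Proof.
case: n => [|n] /=; first by rewrite mulr_ge0.
rewrite mulr_ge0 ?sqr_ge0//; apply: Rintegral_ge0; exact: iter_scaled_op_ge0.
Qed.

(* The first and the last of the factors [A] gain a bound by the mass, those in
   between only act on constants. *)
Lemma iter_scaled_op_le_mass (u : R -> R) n x : integrable1 u -> nneg u -> unit_itv x ->
  iter n.+1 A u x <= coef n * mass u.
Proof.
move=> iu u0 ux; case: n => [|n] /=; first exact: (scaled_op_le_mass).
pose c := H * CW * mass u.
have iA : integrable1 (iter n.+1 A u) by exact: integrable_iter_scaled_op.
apply: le_trans (scaled_op_le_mass iA _ ux) _.
  exact: (iter_scaled_op_ge0 n.+1 u0).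
have -> : (H * CW) ^+ 2 * mass (iter n A (fun=> 1)) * mass u =
   H * CW * (c * mass (iter n A (fun=> 1))) by rewrite /c; ring.
rewrite ler_wpM2l ?mulr_ge0// -RintegralZl//; last exact: integrable_iter_scaled_op.
apply: le_Rintegral => //.
  by apply: integrableZl_EFin => //; exact: integrable_iter_scaled_op.
move=> y uy; rewrite iterSr.
have := iter_scaled_op_lin c 0 n (integrable_cst 1) (integrable_cst 0) uy.
rewrite (mul0r (iter _ _ _ _)) addr0 => <-.
apply: iter_scaled_op_le => //.
- exact: integrable_scaled_op.
- by move=> t ut; rewrite mul0r addr0 mulr1; exact: (scaled_op_le_mass).
Qed.

Variable S : R.
Hypothesis Sbound : forall n, \sum_(j < n) mass (iter j A (fun=> 1)) <= S.

(** A bound for the sum of all [coef n], hence for the Neumann series without its identity term. *)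
Let RR := H * CW + (H * CW) ^+ 2 * S.

Let coef_sum n : \sum_(j < n) coef j <= RR.
Proof.
have mono m : \sum_(j < m) coef j <= \sum_(j < m.+1) coef j.
  by rewrite big_ord_recr /= lerDl coef_ge0.
apply: le_trans (mono n) _; rewrite big_ord_recl lerD2l -mulr_sumr.
by rewrite ler_wpM2l ?sqr_ge0.
Qed.

Let coef_cvg0 : coef n @[n --> \oo] --> 0.
Proof.
apply: cvg_series_cvg_0; apply: nondecreasing_is_cvgn.
  by apply: nondecreasing_series => n _ _; exact: coef_ge0.
by exists RR => _ [n _ <-]; rewrite seriesEord; exact: coef_sum.
Qed.

Let RR0 : 0 <= RR.
Proof. by apply: le_trans (coef_sum 0); rewrite big_ord0. Qed.

Lemma sum_iter_scaled_op_le (s : R -> R) n x : integrable1 s -> nneg s -> unit_itv x ->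
  \sum_(j < n) iter j A s x <= s x + RR * mass s.
Proof.
move=> is_ s0 ux; have ms0 : 0 <= mass s by exact: Rintegral_ge0.
case: n => [|n]; first by rewrite big_ord0 addr_ge0 ?s0// mulr_ge0.
rewrite big_ord_recl lerD2l.
apply: (@le_trans _ _ ((\sum_(j < n) coef j) * mass s)); last by rewrite ler_wpM2r.
by rewrite mulr_suml; apply: ler_sum => j _; exact: iter_scaled_op_le_mass.
Qed.

(** Iterating [p <= s + A p] bounds [p] by a partial Neumann series of [s] plus [A^(n+1) p]. The
    remainder is at most [coef n * mass p] and tends to 0, since the [coef n] are summable. *)
Lemma subinvariant_le (p s : R -> R) : integrable1 p -> integrable1 s ->
  nneg p -> nneg s -> (forall x, unit_itv x -> p x <= s x + A p x) ->
  forall x, unit_itv x -> p x <= s x + RR * mass s.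
Proof.
move=> ip is_ p0 s0 ps x ux.
have step n : p x <= s x + (\sum_(j < n) coef j) * mass s + iter n.+1 A p x.
  elim: n => [|n IH]; first by rewrite big_ord0 mul0r addr0; exact: ps.
  apply: le_trans IH _; rewrite big_ord_recr /= mulrDl -!addrA !lerD2l.
  have := iter_scaled_op_le_mass n is_ s0 ux.
  have : iter n.+1 A p x <= iter n.+1 A s x + iter n.+2 A p x.
    have iAp := integrable_scaled_op ip.
    have := iter_scaled_op_lin 1 1 n.+1 is_ iAp ux; rewrite !mul1r -iterSr => <-.
    apply: iter_scaled_op_le => //.
      by apply: integrableD_EFin => //; exact: integrableZl_EFin.
    by move=> y uy; rewrite !mul1r; exact: ps.
  rewrite /=; lra.
have ms0 : 0 <= mass s by exact: Rintegral_ge0.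
have mp0 : 0 <= mass p by exact: Rintegral_ge0.
have step' n : p x - (s x + RR * mass s) <= coef n * mass p.
  rewrite lerBlDl; apply: le_trans (step n) _; apply: lerD.
    by rewrite lerD2l ler_wpM2r.
  exact: iter_scaled_op_le_mass.
rewrite -subr_le0.
have cv : coef n * mass p @[n --> \oo] --> 0.
  by rewrite -(mul0r (mass p)); apply: cvgM => //; exact: cvg_cst.
rewrite -(cvg_lim (@Rhausdorff R) cv); apply: limr_ge; first by apply/cvg_ex; exists 0.
exact: nearW.
Qed.

Let integrable_comb (a b : R) (u v : R -> R) : integrable1 u -> integrable1 v ->
  integrable1 (fun y => a * u y + b * v y).
Proof. by move=> iu iv; apply: integrableD_EFin => //; exact: integrableZl_EFin. Qed.

Lemma cvg_dominated_increments (c e : nat -> R) (M : R) :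
  (forall n, `|c n.+1 - c n| <= e n) -> (forall n, \sum_(j < n) e j <= M) ->
  cvgn c /\ forall n, `|c n - c 0%N| <= M.
Proof.
move=> ce eM; have e0 n : 0 <= e n by exact: le_trans (ce n).
split; last first.
  move=> n; apply: le_trans (eM n).
  rewrite -(telescope_sumr c (leq0n n)) big_mkord.
  by apply: le_trans (ler_norm_sum _ _ _) _; exact: ler_sum.
have cve : cvgn (series e).
  apply: nondecreasing_is_cvgn; first by apply: nondecreasing_series => n _ _; exact: e0.
  by exists M; move=> _ [n _ <-]; rewrite seriesEord; exact: eM.
have cvt : cvgn (series (telescope c)).
  by apply: normed_cvg; apply: series_le_cvg cve => //= n; exact: ce.
rewrite (_ : c = fun n => c 0%N + series (telescope c) n).
  by apply: is_cvgD => //; exact: is_cvg_cst.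
by apply/funext => n; exact: eq_sum_telescope.
Qed.

(** Multiplication of [x + i y] by [a + i b], a number of modulus at most 1. *)
Lemma norm2_rotation a b (x y x' y' : R -> R) t : a ^+ 2 + b ^+ 2 <= 1 ->
  x' t = a * x t - b * y t -> y' t = a * y t + b * x t -> norm2 x' y' t <= norm2 x y t.
Proof.
move=> ab xE yE; rewrite /norm2 ler_wsqrtr// xE yE.
rewrite (_ : (_ - _) ^+ 2 + _ = (a ^+ 2 + b ^+ 2) * (x t ^+ 2 + y t ^+ 2)); last by ring.
by rewrite -[leRHS]mul1r ler_wpM2r// addr_ge0// sqr_ge0.
Qed.

(* Solves [z f - T f = g] for [|z| >= 1] by iterating [f |-> w (g + T f)], where
   [w = a + i b] is the inverse of [z]. *)
Lemma resolvent_equation (a b : R) (gr gi : R -> R) : a ^+ 2 + b ^+ 2 <= 1 ->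
  integrable1 gr -> integrable1 gi ->
  exists u v : R -> R, [/\ integrable1 u, integrable1 v &
    forall x, unit_itv x -> u x = a * (gr x + A u x) - b * (gi x + A v x) /\
                            v x = a * (gi x + A v x) + b * (gr x + A u x)].
Proof.
move=> ab igr igi.
pose step (p : (R -> R) * (R -> R)) : (R -> R) * (R -> R) :=
  (fun x => a * (gr x + A p.1 x) - b * (gi x + A p.2 x),
   fun x => a * (gi x + A p.2 x) + b * (gr x + A p.1 x)).
pose p n := iter n step (fun=> 0, fun=> 0).
pose u n := (p n).1; pose v n := (p n).2.
have iuv n : integrable1 (u n) /\ integrable1 (v n).
  elim: n => [|n [iu iv]]; first by split; exact: (integrable_cst 0).
  have i1 : integrable1 (fun x => gr x + A (u n) x).
    by apply: integrableD_EFin => //; exact: (integrable_scaled_op).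
  have i2 : integrable1 (fun x => gi x + A (v n) x).
    by apply: integrableD_EFin => //; exact: (integrable_scaled_op).
  split; last exact: (integrable_comb a b i2 i1).
  by have := integrable_comb a (- b) i1 i2; apply: eq_integrable => // x _ /=; rewrite mulNr.
pose s := norm2 gr gi.
have is_ : integrable1 s by exact: norm2_integrable.
have s0 y : unit_itv y -> 0 <= s y by move=> _; exact: norm2_ge0.
have Asub (f g : R -> R) x : integrable1 f -> integrable1 g -> unit_itv x ->
    A (fun y => f y - g y) x = A f x - A g x.
  move=> if_ ig ux; have := scaled_op_lin 1 (-1) if_ ig ux.
  by rewrite mul1r mulN1r => <-; congr (A _ x); apply/funext => y; rewrite mul1r mulN1r.
pose du n y := u n.+1 y - u n y; pose dv n y := v n.+1 y - v n y.
have idu n : integrable1 (du n).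
  by have := integrable_comb 1 (-1) (iuv n.+1).1 (iuv n).1;
     apply: eq_integrable => // x _ /=; rewrite mul1r mulN1r.
have idv n : integrable1 (dv n).
  by have := integrable_comb 1 (-1) (iuv n.+1).2 (iuv n).2;
     apply: eq_integrable => // x _ /=; rewrite mul1r mulN1r.
have A0 x : unit_itv x -> A (fun=> 0) x = 0.
  move=> ux; have := scaled_op_lin 0 0 (integrable_cst 0) (integrable_cst 0) ux.
  by rewrite !mul0r addr0.
(* The increments follow the iteration without [g]: the first is [w g], each later one is [w] times
   [A] of its predecessor, and [|w| <= 1]. *)
have dbound n x : unit_itv x -> norm2 (du n) (dv n) x <= iter n A s x.
  elim: n x => [|n IH] x ux.
    apply: norm2_rotation ab _ _.
      by rewrite /du /u /p /= !A0// !addr0 subr0.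
    by rewrite /dv /v /p /= !A0// !addr0 subr0.
  apply: (@le_trans _ _ (norm2 (A (du n)) (A (dv n)) x)).
    apply: norm2_rotation ab _ _.
      rewrite /du (Asub _ _ _ (iuv n.+1).1 (iuv n).1 ux) (Asub _ _ _ (iuv n.+1).2 (iuv n).2 ux).
      by rewrite /u /p !iterS /step /=; ring.
    rewrite /dv (Asub _ _ _ (iuv n.+1).1 (iuv n).1 ux) (Asub _ _ _ (iuv n.+1).2 (iuv n).2 ux).
    by rewrite /v /p !iterS /step /=; ring.
  apply: le_trans (norm2_scaled_op (idu n) (idv n) ux) _.
  apply: (scaled_op_le) => //; first exact: norm2_integrable.
  exact: (integrable_iter_scaled_op).
(* [G] dominates the sum of all increments, hence every iterate, as the iteration starts at 0. *)
pose G y := s y + (H * CW + (H * CW) ^+ 2 * S) * mass s.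
have iG : integrable1 G by apply: integrableD_EFin => //; exact: integrable_cst.
(* Shared by the real and the imaginary parts. Pointwise limits exist because the increments are
   summable, and [A] passes to the limit by dominated convergence with majorant [W x y * G y]. *)
have limit (q : nat -> R -> R) (dq : nat -> R -> R) : (forall n, integrable1 (q n)) ->
    q 0%N = (fun=> 0) -> (forall n x, q n.+1 x - q n x = dq n x) ->
    (forall n x, unit_itv x -> `|dq n x| <= norm2 (du n) (dv n) x) ->
    exists Q : R -> R, [/\ integrable1 Q,
      forall x, unit_itv x -> q n x @[n --> \oo] --> Q x &
      forall x, unit_itv x -> A (q n) x @[n --> \oo] --> A Q x].
  move=> iq q0 dqE dqle.
  have qcv x : unit_itv x -> cvgn (q ^~ x) /\ forall n, `|q n x| <= G x.
    move=> ux; have [] := @cvg_dominated_increments (q ^~ x) (fun n => iter n A s x) (G x).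
    - by move=> n; rewrite dqE; apply: le_trans (dqle n x ux) _; exact: dbound.
    - by move=> n; exact: (sum_iter_scaled_op_le).
    by move=> cq qG; split => // n; have := qG n; rewrite q0 subr0.
  have mq n : measurable_fun unit_itv (q n).
    by have /measurable_int/measurable_EFinP := iq n.
  exists (fun x => lim (q n x @[n --> \oo])).
  have [iQ _] := @Rintegral_dominated_cvg _ _ _ mu unit_itv q
    (fun x => lim (q n x @[n --> \oo])) G munit mq (fun x ux => (qcv x ux).1) iG
    (fun n x ux => (qcv x ux).2 n).
  split => // x ux; first exact: (qcv x ux).1.
  rewrite /scaled_op /kernel_op patchE mem_set//; apply: cvgM; first exact: cvg_cst.
  rewrite (_ : (fun n => _) = fun n => mass (fun y => W x y * q n y)); last first.
    by apply/funext => n; rewrite patchE mem_set.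
  have [] := @Rintegral_dominated_cvg _ _ _ mu unit_itv (fun n y => W x y * q n y)
    (fun y => W x y * lim (q n y @[n --> \oo])) (fun y => W x y * G y) munit => //.
  - move=> n; have := integrable_kernel_section mW WC (iq n) ux.
    by move=> /measurable_int/measurable_EFinP.
  - by move=> y uy; apply: cvgM; [exact: cvg_cst|exact: (qcv y uy).1].
  - exact: (integrable_kernel_section mW WC).
  - move=> n y uy; have /andP[W0 _] := WC ux uy.
    by rewrite normrM (ger0_norm W0) ler_wpM2l//; exact: (qcv y uy).2.
have [U [iU cU cAU]] : exists Q : R -> R, [/\ integrable1 Q,
      forall x, unit_itv x -> u n x @[n --> \oo] --> Q x &
      forall x, unit_itv x -> A (u n) x @[n --> \oo] --> A Q x].
  by apply: (limit u du) => // [n|n x _]; [exact: (iuv n).1|exact: (norm_le_norm2 _ _ _).1].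
have [V [iV cV cAV]] : exists Q : R -> R, [/\ integrable1 Q,
      forall x, unit_itv x -> v n x @[n --> \oo] --> Q x &
      forall x, unit_itv x -> A (v n) x @[n --> \oo] --> A Q x].
  by apply: (limit v dv) => // [n|n x _]; [exact: (iuv n).2|exact: (norm_le_norm2 _ _ _).2].
exists U, V; split=> // x ux.
have c1 : a * (gr x + A (u n) x) @[n --> \oo] --> a * (gr x + A U x).
  by apply: cvgM; [exact: cvg_cst|apply: cvgD; [exact: cvg_cst|exact: cAU]].
have c2 : b * (gi x + A (v n) x) @[n --> \oo] --> b * (gi x + A V x).
  by apply: cvgM; [exact: cvg_cst|apply: cvgD; [exact: cvg_cst|exact: cAV]].
have c3 : a * (gi x + A (v n) x) @[n --> \oo] --> a * (gi x + A V x).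
  by apply: cvgM; [exact: cvg_cst|apply: cvgD; [exact: cvg_cst|exact: cAV]].
have c4 : b * (gr x + A (u n) x) @[n --> \oo] --> b * (gr x + A U x).
  by apply: cvgM; [exact: cvg_cst|apply: cvgD; [exact: cvg_cst|exact: cAU]].
split.
  apply: (@cvg_unique R _ (u n.+1 x @[n --> \oo])).
  - exact: Rhausdorff.
  - by have := cU x ux; rewrite -(cvg_shiftS (u ^~ x)).
  - exact: cvgB c1 c2.
apply: (@cvg_unique R _ (v n.+1 x @[n --> \oo])).
- exact: Rhausdorff.
- by have := cV x ux; rewrite -(cvg_shiftS (v ^~ x)).
- exact: cvgD c3 c4.
Qed.

End NeumannSeries.

(** * The resolvent set of [T_hom] *)

Section SpectralBound.
Context {R : realType}.
Local Notation mu := (@lebesgue_measure R).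
Local Notation normc := (@ComplexField.Normc.normc R).
Local Notation Re := (@complex.Re R).
Local Notation Im := (@complex.Im R).
Variables (h : R -> R) (W : R -> R -> R) (CW : R).
Hypothesis mW : measurable_fun (unit_itv `*` unit_itv) (fun p : R * R => W p.1 p.2).
Hypothesis WC : forall x y, unit_itv x -> unit_itv y -> 0 <= W x y <= CW.
Local Notation H := (L1norm Rplus h).
Local Notation T := (T_hom h W).

Let munit : measurable (unit_itv : set R) := @measurable_unit_itv R.
Local Notation integrable1 u := (mu.-integrable unit_itv (EFin \o u)).
Local Notation mass u := (\int[mu]_(y in unit_itv) u y).
Local Notation A := (scaled_op W H).

Let H0 : 0 <= H.
Proof. exact: Rintegral_ge0. Qed.

Variable S : R.
Hypothesis Sbound : forall n, \sum_(j < n) mass (iter j A (fun=> 1)) <= S.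

Let T_homE f x : unit_itv x -> T f x = A f x.
Proof. by move=> ux; rewrite /T_hom /scaled_op /kernel_op patchE mem_set. Qed.

Lemma integrable_normc (f : R -> R[i]) : L1C f -> integrable1 (normc \o f).
Proof.
move=> [fr fi]; have := norm2_integrable fr fi; apply: eq_integrable => // x _ /=.
by rewrite /norm2; case: (f x).
Qed.

Lemma L1normC_eq0 (f : R -> R[i]) : L1C f ->
  L1normC f = 0 <-> {ae mu, forall x, unit_itv x -> f x = 0}.
Proof.
move=> f1; have if1 := integrable_normc f1.
have n0 (c : R[i]) : 0 <= normc c by case: c => c1 c2; exact: sqrtr_ge0.
have mf := measurable_int _ if1.
have := @ae_eq_integral_abs _ _ _ mu _ munit _ mf.
have -> : (\int[mu]_(x in unit_itv) `|(EFin \o (normc \o f)) x| = (L1normC f)%:E)%E.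
  rewrite /L1normC /Rintegral fineK; last exact: integrable_fin_num if1.
  by apply: eq_integral => x _; rewrite /= ger0_norm.
move=> [to of_]; split.
  move=> f0; have := to (congr1 EFin f0); apply: filterS => x /[apply] -[].
  exact: ComplexField.Normc.eq0_normc.
move=> ae0; suff /of_ [] : ae_eq mu unit_itv (EFin \o (normc \o f)) (cst 0%E) by [].
by move: ae0; apply: (@filterS _ _ (ae_filter_ringOfSetsType mu)) => x /[apply] /= ->; rewrite ComplexField.Normc.normc0.
Qed.

Lemma L1C_shift_op z (f : R -> R[i]) : L1C f -> L1C (shift_op T z f).
Proof.
case: z => a b [fr fi].
have iA (u : R -> R) : integrable1 u -> integrable1 (T u).
  move=> /(integrable_scaled_op mW WC H0); apply: eq_integrable => // x /set_mem ux /=.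
  by rewrite T_homE.
split.
  have : integrable1 (fun x => (a * Re (f x) - b * Im (f x)) - T (Re \o f) x).
    by do !apply: integrableB_EFin => //; try exact: integrableZl_EFin; exact: iA.
  by apply: eq_integrable => // x _ /=; rewrite /shift_op; case: (f x).
have : integrable1 (fun x => (a * Im (f x) + b * Re (f x)) - T (Im \o f) x).
  apply: integrableB_EFin => //; last exact: iA.
  by apply: integrableD_EFin => //; exact: integrableZl_EFin.
by apply: eq_integrable => // x _ /=; rewrite /shift_op; case: (f x).
Qed.

(** Since [|f| <= |z f|], the triangle inequality brings [|f|] to the form required by
    [subinvariant_le]. *)
Lemma normc_le_shift_op z (f : R -> R[i]) : 1 < normc z -> L1C f ->
  forall x, unit_itv x -> normc (f x) <= normc (shift_op T z f x) + A (normc \o f) x.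
Proof.
move=> z1 f1 x ux; have [fr fi] := f1.
have n0 (c : R[i]) : 0 <= normc c by case: c => c1 c2; exact: sqrtr_ge0.
apply: (@le_trans _ _ (normc z * normc (f x))).
  by rewrite ler_peMl// ltW.
rewrite -ComplexField.Normc.normcM.
have -> : z * f x = shift_op T z f x + complexify T f x by rewrite /shift_op subrK.
apply: le_trans (le_normcD _ _) _; rewrite lerD2l.
have -> : normc (complexify T f x) = norm2 (A (Re \o f)) (A (Im \o f)) x.
  by rewrite /norm2 /= !T_homE.
apply: le_trans (norm2_scaled_op mW WC H0 fr fi ux) _.
apply: (scaled_op_le mW WC H0) => //.
- exact: norm2_integrable.
- exact: integrable_normc.
- by move=> y _; rewrite /norm2 /=; case: (f y).
Qed.

Lemma L1normC_le_shift_op z (f : R -> R[i]) : 1 < normc z -> L1C f ->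
  L1normC f <= (1 + (H * CW + (H * CW) ^+ 2 * S)) * L1normC (shift_op T z f).
Proof.
move=> z1 f1; set K := H * CW + _; set s := shift_op T z f.
have n0 (c : R[i]) : 0 <= normc c by case: c => c1 c2; exact: sqrtr_ge0.
have is_ := integrable_normc (L1C_shift_op z f1).
have ip := integrable_normc f1.
have bound := subinvariant_le mW WC H0 Sbound ip is_ (fun y _ => n0 _) (fun y _ => n0 _)
  (normc_le_shift_op z1 f1).
have iK : integrable1 (fun=> K * L1normC s).
  by apply: (@bounded_itv_integrable _ _ _ `|K * L1normC s|).
apply: (@le_trans _ _ (mass (fun y => normc (s y) + K * L1normC s))).
  by apply: le_Rintegral => //; exact: integrableD_EFin.
rewrite (@RintegralD _ _ _ mu _ _ _ munit is_ iK) [X in _ + X]Rintegral_unit_itv_cst.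
by rewrite [leRHS]mulrDl mul1r.
Qed.

Lemma resolvent_set_T_hom z : 1 < normc z -> resolvent_set T z.
Proof.
move=> z1; have n0 (c : R[i]) : 0 <= normc c by case: c => c1 c2; exact: sqrtr_ge0.
split; last by exists (1 + (H * CW + (H * CW) ^+ 2 * S)) => f f1; exact: L1normC_le_shift_op.
- move=> f g f1 g1 fg.
  (* Injectivity is the norm bound applied to the difference, on which [z - T] vanishes almost
     everywhere by linearity. *)
  pose e x := f x - g x; have [fr fi] := f1; have [gr gi] := g1.
  have ReB (c c' : R[i]) : Re (c - c') = Re c - Re c' by case: c; case: c'.
  have ImB (c c' : R[i]) : Im (c - c') = Im c - Im c' by case: c; case: c'.
  have e1 : L1C e.
    split; [have := @integrableB_EFin _ _ _ mu _ _ _ munit fr gr|have := @integrableB_EFin _ _ _ mu _ _ _ munit fi gi];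
      by apply: eq_integrable => // x _ /=; rewrite ?ReB ?ImB.
  have e0 : {ae mu, forall x, unit_itv x -> shift_op T z e x = 0}.
    apply: (@filterS _ _ (ae_filter_ringOfSetsType mu) _ _ _ fg) => x fgx ux; have := fgx ux.
    rewrite /shift_op /complexify !T_homE// => fge.
    have AB (u v : R -> R) : integrable1 u -> integrable1 v ->
        A (fun y => u y - v y) x = A u x - A v x.
      move=> iu iv; have := scaled_op_lin H mW WC 1 (-1) iu iv ux.
      rewrite mul1r mulN1r => <-; congr (A _ x); apply/funext => y.
      by rewrite mul1r mulN1r.
    rewrite (_ : (fun y => Re (e y)) = fun y => Re (f y) - Re (g y)); last first.
      by apply/funext => y; rewrite ReB.
    rewrite (_ : (fun y => Im (e y)) = fun y => Im (f y) - Im (g y)); last first.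
      by apply/funext => y; rewrite ImB.
    rewrite !AB// /e mulrBr.
    move/eqP: fge; rewrite -subr_eq0 => /eqP <-.
    by case: (z * f x); case: (z * g x) => *; apply/eqP; rewrite eq_complex /=;
      apply/andP; split; apply/eqP; ring.
  have se0 := (L1normC_eq0 (L1C_shift_op z e1)).2 e0.
  have := L1normC_le_shift_op z1 e1; rewrite se0 mulr0 => e_le0.
  have /(L1normC_eq0 e1).1 : L1normC e = 0.
    by apply/eqP; rewrite eq_le e_le0 Rintegral_ge0.
  by apply: (@filterS _ _ (ae_filter_ringOfSetsType mu)) => x /[apply] /eqP; rewrite subr_eq0 => /eqP.
- move=> g [gr gi].
  have z0 : z != 0 by apply/eqP => z0; move: z1; rewrite z0 ComplexField.Normc.normc0 ltr10.
  have wE : normc z^-1 <= 1 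
    by rewrite ComplexField.Normc.normcV invf_le1 ?(lt_trans ltr01 z1)//; exact: ltW.
  set a := Re z^-1; set b := Im z^-1.
  have zE : z^-1 = Complex a b by rewrite /a /b; case: (z^-1).
  have ab : a ^+ 2 + b ^+ 2 <= 1.
    by rewrite -(@ler_sqrt _ _ 1)// sqrtr1; move: wE; rewrite zE.
  (* For [w = z^-1] the fixed point of [f |-> w (g + T f)] solves [z f - T f = g]. *)
  have [u [v [iu iv uv]]] := resolvent_equation mW WC H0 Sbound ab gr gi.
  exists (fun x => Complex (u x) (v x)) => //.
  apply: aeW => x ux; have [ue ve] := uv x ux.
  apply: (mulfI (_ : z^-1 != 0)); first by rewrite invr_eq0.
  rewrite /shift_op mulrBr mulKf// zE /complexify /= !T_homE//.
  case: (g x) ue ve => g1 g2 /= ue ve.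
  by apply/eqP; rewrite eq_complex /= {1}ue {1}ve; apply/andP; split; apply/eqP; ring.
Qed.

Lemma spectral_radius_le1 : (spectral_radius T <= 1)%E.
Proof.
apply: ge_ereal_sup => _ [z zs <-]; rewrite lee_fin leNgt; apply/negP => z1.
exact: zs (resolvent_set_T_hom z1).
Qed.

End SpectralBound.

(** * Lower bounds from the positivity of a kernel power *)

Section KernelLowerBound.
Context {R : realType}.
Local Notation mu := (@lebesgue_measure R).
Variables (W : R -> R -> R) (CW : R).
Hypothesis mW : measurable_fun (unit_itv `*` unit_itv) (fun p : R * R => W p.1 p.2).
Hypothesis WC : forall x y, unit_itv x -> unit_itv y -> 0 <= W x y <= CW.
Hypothesis Wsym : forall x y, unit_itv x -> unit_itv y -> W x y = W y x.

Let munit : measurable (unit_itv : set R) := @measurable_unit_itv R.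
Local Notation mass u := (\int[mu]_(y in unit_itv) u y).
Local Notation K := (kernel_op W).

(** Tonelli on the unit square, and the symmetry of [W]. *)
Lemma kernel_op_selfadjoint (f g : R -> R) (B B' : R) : nneg_bounded f B -> nneg_bounded g B' ->
  mass (fun x => g x * K f x) = mass (fun x => K g x * f x).
Proof.
move=> fB gB'; have [mf f0] := fB; have [mg g0] := gB'.
have Kf := kernel_op_nneg_bounded mW WC fB.
have Kg := kernel_op_nneg_bounded mW WC gB'.
pose F (p : R * R) := ((EFin \o (fun p : R * R => g p.1 * (W p.1 p.2 * f p.2))) \_ (unit_itv `*` unit_itv)) p.
have mF : measurable_fun setT F.
  have mS : measurable (unit_itv `*` unit_itv : set (R * R)) by exact: measurableX.
  suff h : measurable_fun (unit_itv `*` unit_itv) (EFin \o (fun p : R * R => g p.1 * (W p.1 p.2 * f p.2))).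
    exact: (measurable_restrictT _ mS).1 h.
  apply/measurable_EFinP; apply: measurable_funM.
    by apply: measurable_funTS; exact: (measurableT_comp mg (@measurable_fst _ _ R R)).
  apply: measurable_funM => //.
  by apply: measurable_funTS; exact: (measurableT_comp mf (@measurable_snd _ _ R R)).
have F0 p : (0 <= F p)%E.
  rewrite /F /patch; case: ifPn => // /set_mem[u1 u2] /=; rewrite lee_fin.
  have [/andP[? _] /andP[? _]] := (f0 p.2, g0 p.1).
  by have /andP[? _] := WC u1 u2; rewrite !mulr_ge0.
have finW (u : R -> R) B0 x : nneg_bounded u B0 -> unit_itv x ->
    (\int[mu]_(y in unit_itv) (W x y * u y)%:E = (K u x)%:E)%E.
  move=> uB ux; rewrite /kernel_op patchE mem_set// /Rintegral fineK//.
  apply: integrable_fin_num => //.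
  exact: (integrable_kernel_section mW WC (nneg_bounded_integrable uB) ux).
have int1 x : unit_itv x -> (\int[mu]_y F (x, y) = (g x * K f x)%:E)%E.
  move=> ux; transitivity (\int[mu]_(y in unit_itv) ((g x)%:E * (W x y * f y)%:E))%E.
    rewrite [RHS]integral_mkcond; apply: eq_integral => y _; rewrite /F !patchE.
    by have [uy|uy] := pselect (unit_itv y);
      [rewrite !mem_set|rewrite !memNset// => -[]].
  rewrite ge0_integralZl//.
  - by rewrite (finW _ _ _ fB ux) -EFinM.
  - apply/measurable_EFinP; apply: measurable_funM; last exact: measurable_funTS.
    exact: measurable_kernel_section.
  - move=> y uy; rewrite lee_fin mulr_ge0//; first by case/andP: (WC ux uy).
    by case/andP: (f0 y).
  - by case/andP: (g0 x).
have int2 y : unit_itv y -> (\int[mu]_x F (x, y) = (K g y * f y)%:E)%E.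
  move=> uy; transitivity (\int[mu]_(x in unit_itv) ((f y)%:E * (W y x * g x)%:E))%E.
    rewrite [RHS]integral_mkcond; apply: eq_integral => x _; rewrite /F !patchE.
    have [ux|ux] := pselect (unit_itv x); last by rewrite !memNset// => -[].
    by rewrite !mem_set//= -EFinM (Wsym ux uy); congr EFin; ring.
  rewrite ge0_integralZl//.
  - by rewrite (finW _ _ _ gB' uy) -EFinM mulrC.
  - apply/measurable_EFinP; apply: measurable_funM; last exact: measurable_funTS.
    exact: measurable_kernel_section.
  - move=> x ux; rewrite lee_fin mulr_ge0//; first by case/andP: (WC uy ux).
    by case/andP: (g0 x).
  - by case/andP: (f0 y).
rewrite /Rintegral; congr fine.
transitivity (\int[mu]_x \int[mu]_y F (x, y))%E.
  rewrite integral_mkcond; apply: eq_integral => x _; rewrite patchE.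
  have [ux|ux] := pselect (unit_itv x); first by rewrite mem_set// int1.
  by rewrite memNset// integral0_eq// => y _; rewrite /F patchE memNset// => -[].
rewrite (@fubini_tonelli _ _ _ _ _ mu mu F mF F0).
rewrite [RHS]integral_mkcond; apply: eq_integral => x _; rewrite patchE.
have [ux|ux] := pselect (unit_itv x); first by rewrite mem_set// int2.
by rewrite memNset// integral0_eq// => y _; rewrite /F patchE memNset// => -[].
Qed.

Lemma iter_kernel_op_selfadjoint n (f g : R -> R) (B B' : R) :
  nneg_bounded f B -> nneg_bounded g B' ->
  mass (fun x => g x * iter n K f x) = mass (fun x => iter n K g x * f x).
Proof.
elim: n f g B B' => // n IH f g B B' fB gB'.
rewrite iterSr (IH _ _ _ _ (kernel_op_nneg_bounded mW WC fB) gB').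
exact: (kernel_op_selfadjoint fB (iter_kernel_op_bounded mW WC n gB')).
Qed.

(** Iterating the operator on a column produces the columns of the kernel powers. *)
Let column x : R -> R := (fun y => W y x) \_ unit_itv.

Let column_bounded x : unit_itv x -> nneg_bounded (column x) CW.
Proof.
move=> ux; split.
  apply: (measurable_restrictT _ munit).1.
  have := measurable_kernel_section mW ux; apply: eq_measurable_fun => y /set_mem uy.
  exact: Wsym.
move=> y; rewrite /column patchE; case: ifPn => [/set_mem uy|_]; first exact: WC.
by have /andP[/le_trans h /h] := WC ux ux; rewrite lexx.
Qed.

Let kernel_powE k x y : unit_itv x -> unit_itv y ->
  kernel_pow W k.+1 x y = iter k K (column y) x.
Proof.
elim: k x => [|k IH] x ux uy; first by rewrite /kernel_pow/= /column patchE mem_set.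
rewrite iterS /kernel_op patchE mem_set//.
rewrite /kernel_pow /=; apply: eq_Rintegral => z /set_mem uz.
by rewrite -IH.
Qed.

(** [K^(k+1) f] at [x] is the pairing of the column at [x] with [K^k f]. Self-adjointness moves the
    [k] factors onto the column, where they form [kernel_pow W k.+1 y x], which is at least
    [kappa]. *)
Lemma iter_kernel_op_lower (k : nat) (kappa : R) (f : R -> R) (B : R) :
  (0 < k)%N -> 0 <= kappa ->
  (forall x y, unit_itv x -> unit_itv y -> kappa <= kernel_pow W k x y) ->
  nneg_bounded f B -> forall x, unit_itv x -> kappa * mass f <= iter k K f x.
Proof.
case: k => // k _ kap0 kapW fB x ux.
have cB := column_bounded ux.
have KB := iter_kernel_op_bounded mW WC k cB.
have -> : iter k.+1 K f x = mass (fun y => column x y * iter k K f y).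
  rewrite iterS {1}/kernel_op patchE mem_set//; apply: eq_Rintegral => y yu.
  by have uy := set_mem yu; rewrite /column patchE yu Wsym.
rewrite (iter_kernel_op_selfadjoint k fB cB) -RintegralZl//; last exact: nneg_bounded_integrable fB.
apply: le_Rintegral => //.
- by apply: integrableZl_EFin => //; exact: nneg_bounded_integrable fB.
- apply: (@nneg_bounded_integrable _ _ (CW ^+ k * CW * B)).
  have [[mc c0] [mf f0]] := (KB, fB); split; first exact: measurable_funM.
  by move=> y; have [/andP[? ?] /andP[? ?]] := (c0 y, f0 y); rewrite mulr_ge0//= ler_pM.
- move=> y uy; rewrite ler_wpM2r//; first by case: fB => _ /(_ y)/andP[].
  by rewrite -kernel_powE// kapW.
Qed.

End KernelLowerBound.

(** * Unboundedness of the growth rates *)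

Section LevelSums.
Context {R : realType}.
Local Notation mu := (@lebesgue_measure R).
Variables (linf h : R -> R) (W : R -> R -> R) (CW : R).
Hypothesis linf0 : forall x, unit_itv x -> 0 <= linf x.
Hypothesis intlinf : mu.-integrable unit_itv (EFin \o linf).
Hypothesis linf_pos : 0 < L1norm unit_itv linf.
Hypothesis mW : measurable_fun (unit_itv `*` unit_itv) (fun p : R * R => W p.1 p.2).
Hypothesis WC : forall x y, unit_itv x -> unit_itv y -> 0 <= W x y <= CW.
Hypothesis Wsym : forall x y, unit_itv x -> unit_itv y -> W x y = W y x.
Hypothesis hrho : (1 < spectral_radius (T_hom h W))%E.
Variables (k : nat) (kappa : R).
Hypothesis k0 : (0 < k)%N.
Hypothesis kappa0 : 0 < kappa.
Hypothesis Wlower : forall x y, unit_itv x -> unit_itv y -> kappa <= kernel_pow W k x y.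

Let munit : measurable (unit_itv : set R) := @measurable_unit_itv R.
Local Notation mass u := (\int[mu]_(y in unit_itv) u y).
Local Notation K := (kernel_op W).
Local Notation H := (L1norm Rplus h).
Local Notation one := (fun=> 1 : R).

Let H0 : 0 <= H. Proof. exact: Rintegral_ge0. Qed.

Let one_bounded : nneg_bounded one 1.
Proof. by split=> // y; rewrite ler01 lexx. Qed.

Lemma kernel_op_le (f g : R -> R) B B' : nneg_bounded f B -> nneg_bounded g B' ->
  (forall y, unit_itv y -> f y <= g y) -> forall x, unit_itv x -> K f x <= K g x.
Proof.
move=> fB gB' fg x ux.
have := @scaled_op_le _ W CW 1 mW WC ler01 f g x (nneg_bounded_integrable fB)
  (nneg_bounded_integrable gB') fg ux.
by rewrite /scaled_op !mul1r.
Qed.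

Lemma kernel_opZ (c : R) (f : R -> R) B : nneg_bounded f B ->
  forall x, K (fun y => c * f y) x = c * K f x.
Proof.
move=> fB x; rewrite /kernel_op !patchE; case: ifPn => [/set_mem ux|_]; last by rewrite mulr0.
rewrite -RintegralZl//.
  by apply: eq_Rintegral => y _; rewrite mulrCA.
exact: (integrable_kernel_section mW WC (nneg_bounded_integrable fB) ux).
Qed.

Lemma iter_kernel_op_ge_cst (c : R) (f : R -> R) B j : 0 <= c -> nneg_bounded f B ->
  (forall x, unit_itv x -> c <= f x) ->
  forall x, unit_itv x -> c * iter j K one x <= iter j K f x.
Proof.
move=> c0 fB cf; elim: j => [|j IH] x ux; first by rewrite mulr1 cf.
have oneB := iter_kernel_op_bounded mW WC j one_bounded.
rewrite !iterS -(kernel_opZ c oneB).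
apply: (@kernel_op_le _ _ (c * (CW ^+ j * 1)) (CW ^+ j * B)) => //.
  have [m1 b1] := oneB; split; first exact: measurable_funM.
  by move=> y; have /andP[? ?] := b1 y; rewrite mulr_ge0//= ler_wpM2l.
exact: iter_kernel_op_bounded.
Qed.

Lemma iter_scaled_opE j : iter j (scaled_op W H) one = fun x => H ^+ j * iter j K one x.
Proof.
elim: j => [|j IH]; first by apply/funext => x; rewrite mul1r.
apply/funext => x; rewrite !iterS IH /scaled_op.
by rewrite (kernel_opZ _ (iter_kernel_op_bounded mW WC j one_bounded)) mulrA exprS.
Qed.

Lemma mass_iter_unbounded (B : R) : exists n, B < \sum_(j < n) H ^+ j * mass (iter j K one).
Proof.
apply: contrapT => /forallNP hB.
suff : (spectral_radius (T_hom h W) <= 1)%E by rewrite leNgt hrho.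
apply: (spectral_radius_le1 mW WC (S := B)) => n.
have /negP := hB n; rewrite -leNgt; apply: le_trans.
apply: ler_sum => j _; rewrite iter_scaled_opE RintegralZl//.
exact: (nneg_bounded_integrable (iter_kernel_op_bounded mW WC j one_bounded)).
Qed.

(** The kernel bound is used at both ends, hence [kappa ^+ 2] and the two extra [k]. The inner [K^k]
    raises [f] above the constant [kappa * mass f], on which [K^j] acts; the outer [K^k] raises the
    result above [kappa] times its mass, and this constant is integrated against [linf]. *)
Lemma base_mass_iter_lower (f : R -> R) (B : R) j : nneg_bounded f B ->
  kappa ^+ 2 * mass f * L1norm unit_itv linf * mass (iter j K one)
   <= base_mass linf (iter (k + (j + k)) K f).
Proof.
move=> fB; set al := L1norm _ _.
have fB' := iter_kernel_op_bounded mW WC.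
have mf0 : 0 <= mass f by apply: Rintegral_ge0 => y _; case: fB => _ /(_ y)/andP[].
have low := iter_kernel_op_lower mW WC Wsym k0 (ltW kappa0) Wlower.
have mass_low : kappa * mass f * mass (iter j K one) <= mass (iter (j + k) K f).
  rewrite -RintegralZl//; last exact: nneg_bounded_integrable (fB' _ _ j one_bounded).
  apply: le_Rintegral => //.
  - by apply: integrableZl_EFin => //; exact: nneg_bounded_integrable (fB' _ _ j one_bounded).
  - exact: nneg_bounded_integrable (fB' _ _ (j + k)%N fB).
  - move=> x ux; rewrite iterD; apply: (iter_kernel_op_ge_cst _ _ (fB' _ _ k fB)) => //.
      by rewrite mulr_ge0// ltW.
    exact: (low _ _ fB).
have -> : al = mass linf.
  by apply: eq_Rintegral => x /set_mem ux; rewrite ger0_norm// linf0.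
rewrite (_ : _ * _ * _ * _ = kappa * (kappa * mass f * mass (iter j K one)) * mass linf); last by ring.
rewrite -RintegralZl//; apply: le_Rintegral => //.
- exact: integrableZl_EFin.
- exact: (base_mass_integrable intlinf (fB' _ _ (k + (j + k))%N fB)).
- move=> x ux; rewrite ler_wpM2r ?linf0// iterD.
  apply: le_trans (low _ _ (fB' _ _ (j + k)%N fB) x ux).
  by rewrite ler_wpM2l// ltW.
Qed.

Lemma level_sums_unbounded (f : R -> R) (B b : R) : nneg_bounded f B -> 0 < mass f ->
  exists m, b < \sum_(j < m) H ^+ j * base_mass linf (iter j K f).
Proof.
move=> fB mf0.
(* For [H = 0] only the term [j = 0] would survive and the sums would not exceed 1. *)
have Hpos : 0 < H.
  rewrite lt0r H0 andbT; apply/eqP => Hz.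
  have [n] := mass_iter_unbounded 1; rewrite ltNge => /negP; apply.
  case: n => [|n]; first by rewrite big_ord0.
  rewrite big_ord_recl big1 ?addr0; last by move=> i _; rewrite Hz expr0n mul0r.
  by rewrite expr0 mul1r Rintegral_unit_itv_cst.
(* The first [2 k] terms are discarded, and each later one carries the extra power [H^(2k)] of the
   shifted index. *)
pose c := H ^+ (k + k) * (kappa ^+ 2 * mass f * L1norm unit_itv linf).
have c0 : 0 < c by rewrite !mulr_gt0// ?exprn_gt0.
have [n Hn] := mass_iter_unbounded (b / c).
exists (k + k + n)%N; move: Hn; rewrite ltr_pdivrMr// => Hn.
apply: (lt_le_trans Hn).
rewrite big_split_ord /= -[leLHS]add0r; apply: lerD.
  apply: sumr_ge0 => j _; rewrite mulr_ge0 ?exprn_ge0//.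
  exact: (base_mass_ge0 linf0 (iter_kernel_op_bounded mW WC _ fB)).
rewrite mulr_suml; apply: ler_sum => j _.
have := base_mass_iter_lower j fB.
rewrite (_ : k + (j + k) = k + k + j)%N; last by rewrite addnA addnAC.
move=> /(ler_wpM2l (exprn_ge0 (k + k + j) H0)); apply: le_trans.
by rewrite /c (exprD _ (k + k)) le_eqVlt; apply/orP; left; apply/eqP; ring.
Qed.

End LevelSums.

(** * Divergence of the event counts *)

(** Only an inequality: the count also includes the events at time 0 and those in []s, t]]. *)
Lemma point_sum_le_event_count d (Omega : measurableType d) (R : realType)
    (N : Omega -> set (R * R)) (ppN : point_process N) (A : set R) (s t : R) w :
  A `<=` unit_itv -> s <= t -> ((point_sum N s \1_A w)%:E <= event_count N t A w)%E.
Proof.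
move=> A01 st; rewrite /event_count /counting.
have finA : finite_set (N w `&` (`[0, t] `*` A)).
  apply: sub_finite_set (pp_locally_finite ppN w t) => z [Nz [z1 z2]].
  by split=> //; split=> //; exact: A01.
rewrite asboolT//= lee_fin /point_sum.
have -> : \sum_(z <- points N s w) \1_A z.2 = (count (fun z : R * R => z.2 \in A) (points N s w))%:R :> R.
  rewrite -sum1_count natr_sum [RHS]big_mkcond /=; apply: eq_bigr => z _.
  by rewrite indicE; case: (z.2 \in A).
rewrite ler_nat -size_filter; apply: uniq_leq_size; first by rewrite filter_uniq// fset_uniq.
move=> z; rewrite mem_filter => /andP[/set_mem zA /(mem_points ppN)[Nz /andP[z0 zs]]].
rewrite in_fset_set//; apply/mem_set; split=> //; split=> //.
by rewrite /= in_itv/= (ltW z0) (le_trans zs).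
Qed.

Theorem theorem5 (R : realType) (d : measure_display)
    (Omega : measurableType d) (P : probability Omega R)
    (linf h : R -> R) (W : R -> R -> R) (N : Omega -> set (R * R))
    (hpar : hawkes_parameters linf h W)
    (hN : linear_graphon_hawkes P linf h W N)
    (hrho : (1 < spectral_radius (T_hom h W))%E)
    (A : set R) (mA : measurable A) (A01 : A `<=` unit_itv)
    (posA : (0 < lebesgue_measure A)%E) :
  {ae P, forall w, (event_count N T A w * (T^-1)%:E)%E @[T --> +oo%R] --> +oo%E}.
Proof.
have [ppN hC] := hN.
case: hpar => linf0 mlinf [M linfM] linf_pos h0 inth _ W0 mW [CW WCW] Wsym [k [kap [k0 kap0 _ Wlow]]].
have WC x y : unit_itv x -> unit_itv y -> 0 <= W x y <= CW.
  by move=> ux uy; rewrite W0// WCW.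
have munit := @measurable_unit_itv R.
have intlinf : lebesgue_measure.-integrable unit_itv (EFin \o linf).
  apply/integrableP; split; first exact/measurable_EFinP.
  apply: (@le_lt_trans _ _ (\int[lebesgue_measure]_(x in (unit_itv : set R)) (`|M|)%:E)%E).
    apply: ae_ge0_le_integral => //.
    - by apply: measurableT_comp => //; exact/measurable_EFinP.
    - move: linfM; apply: (@filterS _ _ (ae_filter_ringOfSetsType _)) => x /[apply] xM.
      by rewrite lee_fin (le_trans xM)// ler_norm.
  rewrite integral_cst// [X in (_ * X)%E]lebesgue_measure_itv/= lte_fin ltr01.
  by rewrite -EFinD -EFinM ltry.
have fB : nneg_bounded (\1_A : R -> R) 1.
  split; first exact: measurable_indic.
  by move=> y; rewrite indicE; case: (y \in A); rewrite ?lexx ler01.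
have mass0 : 0 < \int[lebesgue_measure]_(y in unit_itv) (\1_A y : R).
  rewrite /Rintegral integral_indic// (setIidl A01) fine_gt0// posA/=.
  apply: (@le_lt_trans _ _ (lebesgue_measure (unit_itv : set R))).
    by apply: le_measure => //; exact/mem_set.
  by rewrite lebesgue_measure_itv/= lte_fin ltr01 -EFinD ltry.
have := asymptotic_growth ppN hC linf0 intlinf mW WC Wsym h0 inth fB.
apply: filterS => w Hw; apply/cvgeyPge => B.
(* The summand 1 pays for the tolerance 1 in the growth bound, and the factor 2 for passing from the
   integer part [n] to [T < n + 1 <= 2 n]. *)
have [m Hm] := level_sums_unbounded linf0 intlinf linf_pos mW WC Wsym hrho k0 kap0 Wlow
  (2 * `|B| + 1) fB mass0.
have [n0 _ Hn0] := Hw m 1 ltr01.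
near=> T.
have T1 : 1 <= T by near: T; exact: nbhs_pinfty_ge.
have Tn0 : n0%:R + 1 <= T by near: T; exact: nbhs_pinfty_ge.
have T0 : 0 <= T by exact: le_trans T1.
set n := Num.truncn T.
have /andP[nT Tn] : n%:R <= T < n.+1%:R by exact: truncn_itv.
have n0n : (n0 <= n)%N.
  by rewrite -ltnS -(ltr_nat R) (le_lt_trans _ Tn)// (le_trans _ Tn0)// lerDl.
have n1 : 1 <= n%:R :> R.
  by rewrite ler1n -ltnS -(ltr_nat R) (le_lt_trans _ Tn).
apply: (@le_trans _ _ ((point_sum N n%:R \1_A w)%:E * (T^-1)%:E)%E); last first.
  by rewrite lee_wpmul2r ?lee_fin ?invr_ge0//; exact: point_sum_le_event_count.
have Tpos : 0 < T by exact: lt_le_trans T1.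
rewrite -EFinM lee_fin ler_pdivlMr//.
apply: le_trans (Hn0 n n0n).
apply: (@le_trans _ _ (2 * `|B| * n%:R)); last by rewrite ler_wpM2r//; lra.
apply: (@le_trans _ _ (`|B| * T)); first by rewrite ler_wpM2r// ler_norm.
rewrite mulrAC -[leRHS]mulrC ler_wpM2l// (le_trans (ltW Tn))// -natr1; lra.
Unshelve. all: by end_near.
Qed.
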